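(* Let $Q(x,y,z)$ be an irreducible complex quadratic form and $\mathcal S_Q=\{Q=1\}\subset\mathbb C^3$. (1) Any holomorphic function $f$ on the complex surface $\mathcal S_Q$ is a limit, in the topology of uniform convergence on compacts, of polynomial functions in $\mathbb C^3$. The approximating polynomials each admit a representation on $\mathcal S_Q$ of the form $\lambda+\sum_{k=1}^{n}\prod_{l=1}^{k}L_{k,l}(x,y,z)$, with $\lambda\in\mathbb C$, $L_{k,l}$ linear forms and $n$ the degree of the polynomial. As a result, such an $f$ can be described by a double-indexed set of multipoles $\{w_{jk}\in\overline{\mathcal M}(j)\}_{0\le j\le k<\infty}$ (the multipoles $w_{jk}$, $0\le j\le k$, representing the $k$-th approximating polynomial). (2) The subset $\mathcal F(\mathcal S_Q)\subset\mathcal O(\mathcal S_Q)$ of functions that admit a representation as a series $\sum_{k=0}^\infty\big[\prod_{j=1}^kL_{kj}\big]$, with each $L_{kj}$ a linear form in $x,y,z$, converging uniformly on each compact in $\mathcal S_Q$, is dense in the space of all holomorphic functions $\mathcal O(\mathcal S_Q)$ and invariant under multiplication by scalars and the natural $O_Q(3;\mathbb C)$-action. Each function $f\in\mathcal F(\mathcal S_Q)$ admits a canonical holomorphic extension $$f(\lambda x,\lambda y,\lambda z)=\sum_{k=0}^\infty\lambda^k\Big[\prod_{j=1}^kL_{kj}(x,y,z)\Big]$$ into the round hull $\mathcal S_Q^\bullet$; here $(x,y,z)\in\mathcal S_Q$ and $|\lambda|<1$. (3) Any continuous function $f:H\to\mathbb C$ on the totally real quadratic surfaces $H=\Upsilon_Q$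 or $H=\mathcal S_Q^{\mathbb R}$ is a limit, in the topology of uniform convergence on compacts in $H$, of polynomial functions in $\mathbb C^3$. As a result, the set $\mathcal F(H)$ is dense in $\mathcal C(H)$. Each function from $\mathcal F(H)$ admits a canonical analytic extension into the open portion of the real cone over $H$, a portion that is bounded by $H$ and contains the origin. Again, $f$ can be described by a double-indexed set of multipoles $\{w_{jk}\in\overline{\mathcal M}(j)\}_{0\le j\le k<\infty}$.
   Context: $\mathcal O(\mathcal S_Q)$ is the algebra of holomorphic functions on $\mathcal S_Q$ and $\mathcal C(H)$ the space of continuous complex functions on $H$, both with the topology of uniform convergence on compacts. For a closed set $H\subset\mathbb C^3$, $\mathcal F(H)$ is the set of functions on $H$ representable as a series $\sum_{k=0}^\infty[\prod_{j=1}^kL_{kj}]$ ($L_{kj}$ linear forms in $x,y,z$; the $k=0$ term is a constant) converging uniformly on compacts in $H$. The round hull of $Y\subset\mathbb C^3$ is $Y^\bullet=\{\lambda v: v\in Y,\ \lambda\in\mathbb C,\ |\lambda|<1\}$. $O_Q(3;\mathbb C)\subset GL(3;\mathbb C)$ is the subgroup preserving $Q$. Writing $Q(v)=vAA^Tv^T$ with $A\in GL(3;\mathbb C)$, $\Upsilon_Q=\{v:vA\in\mathbb R^3,\ Q(v)=1\}$. $\mathcal S_Q^{\mathbb R}=\mathcal S_Q\cap\mathbb R^3$ (considered when $Q$ has real coefficients). The real cone over $H$ consists of the points $tv$, $v\in H$, $t\ge0$. Multipoles: $V(1)$ is the space of complex linear forms in $x,y,z$; $\mathcal M(k)=[V(1)\setminus\{0\}]^k/\Sigma_k$,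 where $\Sigma_k$ is generated by permutations and by rescalings $(L_i)\mapsto(\lambda_iL_i)$ with $\prod\lambda_i=1$; its points correspond to nonzero products of $k$ linear forms. $\overline{\mathcal M}(k)=\mathcal M(k)\cup\{\mathbf 0\}$, with $\mathbf 0$ representing the zero product; for $k=0$, $\overline{\mathcal M}(0)=\mathbb C$ (constants). A set of multipoles $w_0,\dots,w_n$, $w_j\in\overline{\mathcal M}(j)$, represents the polynomial equal to the sum of the corresponding products. *)

(* Defs.v *)
(* The notations of multinomials clash with those of MathComp-Analysis, hence
   the filtered import: [mpoly 3 C] is {mpoly C[3]}, [multinom 3] is 'X_{1..3},
   [bmultinom 3 N] is 'X_{1..3 < N}, [p \is ishomog1 d mdeg] is
   [p \is d.-homog] and [dhomog 3 C d] is the space of such polynomials.  It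
   comes first because mpoly.v redefines [symmetric]. *)
From HB Require Import structures.
From mathcomp Require Import -(notations) mpoly.
From mathcomp Require Import all_boot all_order all_fingroup all_algebra.
From mathcomp Require Import generic_quotient.
From mathcomp Require Import all_classical all_reals.
From mathcomp Require Import topology normedtype sequences derive.
From mathcomp Require Import complex.

Set Implicit Arguments.
Unset Strict Implicit.
Unset Printing Implicit Defensive.

Import Order.TTheory GRing.Theory Num.Theory.
Import numFieldNormedType.Exports.

Local Open Scope classical_set_scope.
Local Open Scope ring_scope.
Local Open Scope quotient_scope.

(* Typing the complex numbers as a numClosedFieldType gives them the topology
   and the norm that MathComp-Analysis attaches to any numFieldType; a bare
   [R[i]] carries no topology. *)
Definition complexes (R : realType) : numClosedFieldType := R[i].

(* Everything below is meant for C := complexes R.  Points of C^3 are row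
   vectors; a function on a subset H of C^3 is a total function on C^3 whose
   values outside H are irrelevant. *)

Definition peval (C : numClosedFieldType) (p : mpoly 3 C) (v : 'rV[C]_3) : C :=
  meval (fun i => v 0 i) p.

Definition quadratic_form (C : numClosedFieldType) (Q : mpoly 3 C) : Prop :=
  Q \is ishomog1 2 mdeg.

Definition irreducible_mpoly (F : fieldType) n (p : mpoly n F) : Prop :=
  [/\ p != 0, p \isn't a GRing.unit &
      forall a b : mpoly n F,
        p = a * b -> a \is a GRing.unit \/ b \is a GRing.unit].

Definition quadric (C : numClosedFieldType) (Q : mpoly 3 C) : set 'rV[C]_3 :=
  [set v | peval Q v = 1].

(* Q(v) = v A A^T v^T with A in GL(3; C). *)
Definition factors_form (C : numClosedFieldType) (Q : mpoly 3 C) (A : 'M[C]_3) :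
    Prop :=
  A \in unitmx /\
  forall v : 'rV[C]_3, peval Q v = (v *m A *m A^T *m v^T) 0 0.

(* Upsilon_Q, which depends on the choice of A. *)
Definition totally_real_sphere (C : numClosedFieldType) (Q : mpoly 3 C)
    (A : 'M[C]_3) : set 'rV[C]_3 :=
  [set v | (forall i, (v *m A) 0 i \is Num.real) /\ peval Q v = 1].

Definition real_quadric (C : numClosedFieldType) (Q : mpoly 3 C) :
    set 'rV[C]_3 :=
  quadric Q `&` [set v | forall i, v 0 i \is Num.real].

Definition orthogonal_group (C : numClosedFieldType) (Q : mpoly 3 C) :
    set 'M[C]_3 :=
  [set g | g \in unitmx /\
           forall v : 'rV[C]_3, peval Q (v *m g) = peval Q v].

Definition round_hull (C : numClosedFieldType) (Y : set 'rV[C]_3) :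
    set 'rV[C]_3 :=
  [set u | exists2 v, Y v & exists2 l : C, `|l| < 1 & u = l *: v].

(* The part of the real cone {t v : v in H, 0 <= t} cut off by H, on the side
   of the origin; [0 <= t] in C forces t to be real. *)
Definition cone_portion (C : numClosedFieldType) (H : set 'rV[C]_3) :
    set 'rV[C]_3 :=
  [set u | exists2 v, H v & exists2 t : C, 0 <= t < 1 & u = t *: v].

(* Holomorphic functions on a subset X of C^3, in the sense of analytic
   subsets: locally the restriction of a function that is complex
   differentiable on an open subset of C^3 ([differentiable] is relative to the
   scalar field C).  X need not be open; in particular the origin is a
   non-interior point of the round hull of a quadric. *)
Definition holomorphic_on (C : numClosedFieldType) (X : set 'rV[C]_3)
    (f : 'rV[C]_3 -> C) : Prop :=
  forall p, X p -> exists (U : set 'rV[C]_3) (h : 'rV[C]_3 -> C),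
    [/\ open U, U p, (forall z, U z -> differentiable h z) &
        forall z, U z -> X z -> f z = h z].

(* Analytic functions on a subset X of C^3: near each point p of X, sum of an
   absolutely convergent power series in the coordinates of u - p.  On subsets
   of R^3, or of the image of R^3 under an element of GL(3; C), this is real
   analyticity (of complex valued functions).  The norm on 'rV[C]_3 is the sup
   norm. *)
Definition analytic_on (C : numClosedFieldType) (X : set 'rV[C]_3)
    (f : 'rV[C]_3 -> C) : Prop :=
  forall p, X p -> exists (a : multinom 3 -> C) (r : C),
    [/\ 0 < r,
        (exists M : C, forall N : nat,
           \sum_(m : bmultinom 3 N) `|a m| * r ^+ mdeg m <= M) &
        forall u, X u -> `|u - p| < r ->
          (fun N : nat => \sum_(m : bmultinom 3 N)
             (a m * \prod_(i < 3) (u - p) 0 i ^+ (m : multinom 3) i))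
          @ \oo --> f u].

Definition cvg_on_compacts (C : numClosedFieldType) (H : set 'rV[C]_3)
    (fs : nat -> 'rV[C]_3 -> C) (f : 'rV[C]_3 -> C) : Prop :=
  {family compactly_in H, fs @ \oo --> f}.

Definition dense_subset (C : numClosedFieldType) (H : set 'rV[C]_3)
    (A B : set ('rV[C]_3 -> C)) : Prop :=
  A `<=` B /\
  B `<=` closure (A : set {family compactly_in H, 'rV[C]_3 -> C}).

Definition holomorphic_functions (C : numClosedFieldType)
    (X : set 'rV[C]_3) : set ('rV[C]_3 -> C) :=
  [set f | holomorphic_on X f].

Definition continuous_functions (C : numClosedFieldType)
    (H : set 'rV[C]_3) : set ('rV[C]_3 -> C) :=
  [set f | {within H, continuous f}].

Definition linear_form (C : numClosedFieldType) : Type := dhomog 3 C 1.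

(* The k-th term of the series given by the constant c (its term k = 0) and
   the linear forms L k j, j < k. *)
Definition series_term (C : numClosedFieldType) (c : C)
    (L : forall k : nat, 'I_k -> linear_form C) (k : nat) : mpoly 3 C :=
  if k is 0%N then mpolyC 3 c
  else \prod_(j < k) mpoly_of_dhomog (L k j).

Definition represents (C : numClosedFieldType) (H : set 'rV[C]_3) (c : C)
    (L : forall k : nat, 'I_k -> linear_form C) (f : 'rV[C]_3 -> C) : Prop :=
  cvg_on_compacts H
    (fun n v => \sum_(0 <= k < n) peval (series_term c L k) v) f.

Definition series_functions (C : numClosedFieldType) (H : set 'rV[C]_3) :
    set ('rV[C]_3 -> C) :=
  [set f | exists (c : C) (L : forall k : nat, 'I_k -> linear_form C),
             represents H c L f].

Definition nonzero_form (C : numClosedFieldType) : choiceType :=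
  {L : dhomog 3 C 1 | L != 0}.

(* Being in the same orbit of the group generated by the permutations of the k
   factors and the rescalings with product 1; such scalars are nonzero. *)
Definition multipole_rel (C : numClosedFieldType) (k : nat)
    (t u : {ffun 'I_k -> nonzero_form C}) : bool :=
  `[< exists (s : 'S_k) (l : 'I_k -> C),
        \prod_(i < k) l i = 1 /\
        forall i, val (u i) = l i *: val (t (s i)) >].

Lemma multipole_rel_refl (C : numClosedFieldType) k :
  reflexive (@multipole_rel C k).
Proof.
move=> t; apply/asboolP; exists 1%g, (fun=> 1); split; first by rewrite big1.
by move=> i; rewrite perm1 scale1r.
Qed.

Lemma multipole_rel_sym (C : numClosedFieldType) k :
  symmetric (@multipole_rel C k).
Proof.
suff H t u : @multipole_rel C k t u -> multipole_rel u t.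
  by move=> t u; apply/idP/idP; exact: H.
move=> /asboolP[s [l [l1 tu]]]; apply/asboolP.
exists (s^-1)%g, (fun i => (l ((s^-1)%g i))^-1); split.
  rewrite (reindex_inj (@perm_inj _ s)) /=.
  under eq_bigr do rewrite permK.
  by rewrite prodfV l1 invr1.
move=> i; rewrite tu permKV scalerA mulVf ?scale1r//.
have /eqP := l1; rewrite (bigD1 ((s^-1)%g i)) //=; apply: contraTneq => ->.
by rewrite mul0r eq_sym oner_neq0.
Qed.

Lemma multipole_rel_trans (C : numClosedFieldType) k :
  transitive (@multipole_rel C k).
Proof.
move=> u t w /asboolP[s [l [l1 tu]]] /asboolP[s' [l' [l'1 uw]]].
apply/asboolP; exists (s' * s)%g, (fun i => l' i * l (s' i)); split.
  rewrite big_split /= l'1 mul1r; rewrite (reindex_perm s') in l1; exact: l1.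
by move=> i; rewrite uw tu scalerA permM.
Qed.

Canonical multipole_equiv (C : numClosedFieldType) (k : nat) :=
  EquivRel (@multipole_rel C k) (@multipole_rel_refl C k)
    (@multipole_rel_sym C k) (@multipole_rel_trans C k).

Definition multipole (C : numClosedFieldType) (k : nat) : Type :=
  {eq_quot @multipole_rel C k}.

Definition multipole_prod (C : numClosedFieldType) (k : nat)
    (w : multipole C k) : mpoly 3 C :=
  \prod_(i < k) mpoly_of_dhomog (val (repr w i)).

Lemma multipole_prod_pi (C : numClosedFieldType) (k : nat)
    (t : {ffun 'I_k -> nonzero_form C}) :
  multipole_prod (\pi_({eq_quot @multipole_rel C k}) t) =
  \prod_(i < k) mpoly_of_dhomog (val (t i)).
Proof.
rewrite /multipole_prod; case: piP => u.
move=> /eqmodP /asboolP[s [l [l1 tu]]].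
under eq_bigr do rewrite tu linearZ /= -mul_mpolyC.
rewrite big_split /= -(rmorph_prod (@mpolyC 3 C)) l1 rmorph1 mul1r.
by rewrite [RHS](reindex_perm s).
Qed.

(* The completed spaces: constants for k = 0, and M(k) with an added point
   [None] standing for the zero product for k > 0. *)
Definition multipole_bar (C : numClosedFieldType) (k : nat) : Type :=
  if k is 0%N then C : Type else option (multipole C k).

Definition multipole_bar_prod (C : numClosedFieldType) (k : nat) :
    multipole_bar C k -> mpoly 3 C :=
  match k with
  | 0%N => fun c => mpolyC 3 c
  | k'.+1 => fun w => if w is Some w' then multipole_prod w' else 0
  end.

Definition multipoles_poly (C : numClosedFieldType) (n : nat)
    (w : forall j : 'I_n.+1, multipole_bar C j) : mpoly 3 C :=
  \sum_(j < n.+1) multipole_bar_prod (w j).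

(* Main.v *)
Require Import Defs.
From HB Require Import structures.
From mathcomp Require Import -(notations) mpoly.
From mathcomp Require Import all_boot all_order all_fingroup all_algebra.
From mathcomp Require Import generic_quotient.
From mathcomp Require Import all_classical all_reals.
From mathcomp Require Import topology normedtype sequences landau derive exp trigo.
From mathcomp Require Import complex.
From mathcomp Require Import ring lra zify.

Set Implicit Arguments.
Unset Strict Implicit.
Unset Printing Implicit Defensive.

Import Order.TTheory GRing.Theory Num.Theory.
Import numFieldNormedType.Exports.

Local Open Scope classical_set_scope.
Local Open Scope ring_scope.

(** Since Q is irreducible over C, a linear change of coordinates turns it into
    z^2 - x y ([irreducible_normal_form]).

    Approximation on the complex quadric.  The group C^* acts on the quadric by
    t.(x, y, z) = (t x, y / t, z).  For f holomorphic on the quadric, the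
    function t -> f (t.v) is holomorphic on C^* and its Fejer sums at t = 1
    converge to f v, uniformly for v in bounded sets ([fejer]).  Its Laurent
    coefficients are semi-invariants of the action: they have the form x^n g(z)
    or y^n g(z) with g a limit of entire functions ([coef_negative],
    [coef_positive]), and entire functions of one variable are limits of
    polynomials by Fejer summation again ([entire_poly]).  Hence f is a limit of
    polynomials ([S0_papprox]).  The complex analysis needed is kept to means
    over roots of unity: Goursat's quartering argument ([goursat]) shows that
    the mean of a holomorphic function over a circle centred at the origin does
    not depend on the radius ([mean_dilate]).

    Multipoles.  The cone z^2 = x y is parametrized by (s^2, t^2, s t), so a form
    of degree k restricts to it as a binary form of degree 2 k.  That binary form
    splits into linear factors, which grouped in pairs are restrictions of linear
    forms in x, y, z ([cone_poly_product]).  The quadric and the cone agree up to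
    lower degree; by induction each polynomial coincides on the quadric with a
    sum of products of linear forms ([quadric_multipoles]).  In particular
    polynomials are finite series of the required kind, so density follows from
    approximation.

    Extension.  The terms of a series converging on the quadric S are bounded on
    bounded parts of S and homogeneous.  A point u with Q u nonzero is a square
    root of Q u times a point of S, so where |Q u| < 1 the terms decay
    geometrically; at the origin a mean value argument replaces this
    ([hull_normal]).  Geometric decay on a ball gives a power series by Cauchy's
    estimates ([normal_series_expansion]).  On the totally real surfaces the same
    argument bounds the terms at real points only.  The k-th term is a polynomial
    of degree at most k on each line, and Bernstein's inequality extends the bound
    to complex points at the price of a factor Y^k with Y > 1 arbitrary
    ([bernstein], [complex_extension]); this suffices away from the origin, where
    Y is taken close to 1, and at the origin homogeneity absorbs the loss
    ([cone_normal_vertex]).  That limits of polynomials on S are holomorphic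
    follows from polynomial parametrizations that cover S ([limit_holomorphic]).

    Approximation on the totally real surfaces.  There the coordinates, in a
    suitable basis, are real; a continuous function is a uniform limit of finite
    minima of functions built from absolute values of coordinates, and the
    absolute value is a uniform limit of polynomials ([weierstrass]). *)

Local Notation "x %:C" := (real_complex _ x).
Local Notation o0 := (@Ordinal 3 0 isT).
Local Notation o1 := (@Ordinal 3 1 isT).
Local Notation o2 := (@Ordinal 3 2 isT).

(** * Moduli of complex numbers and of vectors *)

Section ComplexModulus.
Variable R : realType.
Local Notation C := (complexes R).
Implicit Types (z w : C) (x e : R) (u v : 'rV[C]_3).

(** The norm of C takes its values in C. Its real part carries the same
    information, and keeps all the estimates in the totally ordered field R. *)
Definition cmod z : R := complex.Re `|z|.

Lemma cmodE z : `|z| = (cmod z)%:C.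
Proof. by rewrite /cmod; rewrite (normc_def z). Qed.

Lemma cmod_ge0 z : 0 <= cmod z.
Proof. by rewrite -ler0c -cmodE. Qed.

Lemma cmodM z w : cmod (z * w) = cmod z * cmod w.
Proof. by apply: complexI; rewrite rmorphM /= -!cmodE normrM. Qed.

Lemma cmodD z w : cmod (z + w) <= cmod z + cmod w.
Proof. by rewrite -lecR rmorphD /= -!cmodE ler_normD. Qed.

Lemma cmodN z : cmod (- z) = cmod z.
Proof. by apply: complexI; rewrite -!cmodE normrN. Qed.

Lemma cmodB z w : cmod (z - w) <= cmod z + cmod w.
Proof. by rewrite (le_trans (cmodD _ _))// cmodN. Qed.

Lemma cmodBC z w : cmod (z - w) = cmod (w - z).
Proof. by rewrite -cmodN opprB. Qed.

Lemma cmod0 : cmod 0 = 0.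
Proof. by apply: complexI; rewrite -!cmodE normr0. Qed.

Lemma cmod1 : cmod 1 = 1.
Proof. by apply: complexI; rewrite -!cmodE normr1. Qed.

Lemma cmod_eq0 z : (cmod z == 0) = (z == 0).
Proof. by rewrite -(normr_eq0 z) cmodE -(inj_eq (@complexI R)). Qed.

Lemma cmod_gt0 z : (0 < cmod z) = (z != 0).
Proof. by rewrite lt_neqAle cmod_ge0 andbT eq_sym cmod_eq0. Qed.

Lemma cmodX z n : cmod (z ^+ n) = cmod z ^+ n.
Proof. by apply: complexI; rewrite rmorphXn /= -!cmodE normrX. Qed.

Lemma cmodV z : cmod z^-1 = (cmod z)^-1.
Proof. by apply: complexI; rewrite (fmorphV (real_complex R)) /= -!cmodE normfV. Qed.

Lemma cmod_real x : cmod x%:C = `|x|.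
Proof. by rewrite /cmod normc_def /= expr0n /= addr0 sqrtr_sqr. Qed.

Lemma cmod_nat n : cmod n%:R = n%:R.
Proof. by rewrite -(rmorph_nat (real_complex R)) cmod_real normr_nat. Qed.

Lemma cmod_sum I (r : seq I) (P : pred I) (F : I -> C) :
  cmod (\sum_(i <- r | P i) F i) <= \sum_(i <- r | P i) cmod (F i).
Proof.
elim/big_ind2 : _ => [|a b c d ab cd|//]; first by rewrite cmod0.
by rewrite (le_trans (cmodD _ _))// lerD.
Qed.

Lemma cmod_prod I (r : seq I) (P : pred I) (F : I -> C) :
  cmod (\prod_(i <- r | P i) F i) = \prod_(i <- r | P i) cmod (F i).
Proof. by apply: (big_morph cmod cmodM cmod1). Qed.

Lemma lt_cmod z e : (`|z| < e%:C) = (cmod z < e).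
Proof. by rewrite cmodE ltcR. Qed.

Lemma le_cmod z e : (`|z| <= e%:C) = (cmod z <= e).
Proof. by rewrite cmodE lecR. Qed.

Lemma cmod_sqr z : cmod z ^+ 2 = complex.Re z ^+ 2 + complex.Im z ^+ 2.
Proof.
by rewrite /cmod normc_def /= sqr_sqrtr// addr_ge0 ?sqr_ge0.
Qed.

Lemma Re_le_cmod z : `|complex.Re z| <= cmod z.
Proof.
rewrite -(ler_pXn2r (n := 2)) ?nnegrE ?cmod_ge0 ?normr_ge0//.
by rewrite cmod_sqr real_normK ?num_real// lerDl sqr_ge0.
Qed.

Lemma Im_le_cmod z : `|complex.Im z| <= cmod z.
Proof.
rewrite -(ler_pXn2r (n := 2)) ?nnegrE ?cmod_ge0 ?normr_ge0//.
by rewrite cmod_sqr [`|_| ^+ 2]real_normK ?num_real// lerDr sqr_ge0.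
Qed.

Lemma cmod_le_ReIm z : cmod z <= `|complex.Re z| + `|complex.Im z|.
Proof.
rewrite -(ler_pXn2r (n := 2)) ?nnegrE ?cmod_ge0 ?addr_ge0 ?normr_ge0//.
rewrite cmod_sqr sqrrD !real_normK ?num_real//.
have := mulr_ge0 (normr_ge0 (complex.Re z)) (normr_ge0 (complex.Im z)); lra.
Qed.

Lemma gt0C (e : C) : 0 < e -> exists2 x : R, 0 < x & e = x%:C.
Proof.
case: e => a b; rewrite ltcE /= => /andP[/eqP -> a0].
by exists a.
Qed.

Lemma cauchy_cvgR (a : nat -> R) :
  (forall e : R, 0 < e -> exists n0, forall n m, (n0 <= n)%N -> (n0 <= m)%N ->
     `|a n - a m| <= e) ->
  exists l, forall e : R, 0 < e -> exists n0, forall n, (n0 <= n)%N ->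
     `|a n - l| <= e.
Proof.
move=> hC.
have : cvgn a.
  apply/cauchy_cvgP/cauchy_exP => e e0 /=.
  have [n0 h0] := hC (e / 2) ltac:(by rewrite divr_gt0).
  exists (a n0); exists n0 => // n /= n0n.
  by rewrite /ball /= (le_lt_trans (h0 _ _ _ _))// gtr_pMr// invf_lt1// ltr1n.
move=> /cvg_ex[l] /cvgrPdistC_le hl; exists l => e e0.
by have [n0 _ h0] := hl _ e0; exists n0 => n n0n; exact: h0.
Qed.

(** Completeness of C, read off from the real and imaginary parts. *)
Lemma cauchy_cvgC (u_ : nat -> C) :
  (forall e : R, 0 < e -> exists n0, forall n m, (n0 <= n)%N -> (n0 <= m)%N ->
     cmod (u_ n - u_ m) <= e) ->
  exists l, forall e : R, 0 < e -> exists n0, forall n, (n0 <= n)%N ->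
     cmod (u_ n - l) <= e.
Proof.
move=> hC.
have [a ha] : exists l, forall e : R, 0 < e -> exists n0, forall n, (n0 <= n)%N ->
     `|complex.Re (u_ n) - l| <= e.
  apply: cauchy_cvgR => e /hC[n0 h0]; exists n0 => n m nn nm.
  by rewrite -raddfB (le_trans (Re_le_cmod _))// h0.
have [b hb] : exists l, forall e : R, 0 < e -> exists n0, forall n, (n0 <= n)%N ->
     `|complex.Im (u_ n) - l| <= e.
  apply: cauchy_cvgR => e /hC[n0 h0]; exists n0 => n m nn nm.
  by rewrite -raddfB (le_trans (Im_le_cmod _))// h0.
exists (Complex a b) => e e0.
have e2 : 0 < e / 2 by rewrite divr_gt0.
have [n1 h1] := ha _ e2; have [n2 h2] := hb _ e2.
exists (maxn n1 n2) => n; rewrite geq_max => /andP[/h1 H1 /h2 H2].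
rewrite (le_trans (cmod_le_ReIm _))//.
by case: (u_ n) H1 H2 => c d /= H1 H2; lra.
Qed.

Lemma cvgC_P (u_ : nat -> C) (l : C) :
  (u_ @ \oo --> l) <-> (forall e : R, 0 < e -> exists n0, forall n, (n0 <= n)%N ->
     cmod (u_ n - l) <= e).
Proof.
split=> [/cvgrPdistC_le hl e e0|hl].
  have [|n0 _ h0] := hl e%:C; first by rewrite ltcR.
  by exists n0 => n n0n; rewrite -le_cmod; exact: h0.
apply/cvgrPdistC_le => e /gt0C[x x0 ->].
by have [n0 h0] := hl _ x0; exists n0 => // n /= n0n; rewrite le_cmod h0.
Qed.

(** The sup norm of C^3, again with values in R. *)
Definition vmod v : R := complex.Re `|v|.

Lemma vmodE v : `|v| = (vmod v)%:C.
Proof.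
rewrite /vmod; have : 0 <= `|v| by [].
by case: `|v| => a b; rewrite lecE /= => /andP[/eqP -> _].
Qed.

Lemma vmod_ge0 v : 0 <= vmod v.
Proof. by rewrite -ler0c -vmodE. Qed.

Lemma vmodD u v : vmod (u + v) <= vmod u + vmod v.
Proof. by rewrite -lecR rmorphD /= -!vmodE ler_normD. Qed.

Lemma vmodN v : vmod (- v) = vmod v.
Proof. by apply: complexI; rewrite -!vmodE normrN. Qed.

Lemma vmodB u v : vmod (u - v) <= vmod u + vmod v.
Proof. by rewrite (le_trans (vmodD _ _))// vmodN. Qed.

Lemma vmodBC u v : vmod (u - v) = vmod (v - u).
Proof. by rewrite -vmodN opprB. Qed.

Lemma vmod0 : vmod 0 = 0.
Proof. by apply: complexI; rewrite -!vmodE normr0. Qed.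

Lemma vmodZ z v : vmod (z *: v) = cmod z * vmod v.
Proof. by apply: complexI; rewrite rmorphM /= -vmodE -cmodE -vmodE normrZ. Qed.

Lemma lt_vmod v e : (`|v| < e%:C) = (vmod v < e).
Proof. by rewrite vmodE ltcR. Qed.

Lemma lt_vmodP v e : 0 < e -> (vmod v < e) <-> (forall i, cmod (v 0 i) < e).
Proof.
move=> e0; rewrite -lt_vmod.
have := @mx_norm_ball C 1 3; move=> /(congr1 (fun f => f 0 e%:C v)) h.
have -> : (`|v| < e%:C) = (ball 0 e%:C v) :> Prop.
  by rewrite h /ball_ /= sub0r normrN.
split=> [[_ hv] i|hv].
  by have := hv 0 i; rewrite /ball /= mxE sub0r normrN lt_cmod.
split; first by rewrite ltcR.
by move=> i j; rewrite /ball /= mxE sub0r normrN lt_cmod (ord1 i).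
Qed.

Lemma le_vmodP v e : 0 <= e -> (vmod v <= e) <-> (forall i, cmod (v 0 i) <= e).
Proof.
move=> e0; split=> [hv i|hv].
  apply/ler_addgt0Pr => d d0; apply/ltW.
  have ed : 0 < e + d by rewrite ltr_wpDl.
  by apply/(lt_vmodP _ ed): i; rewrite (le_lt_trans hv)// ltrDl.
apply/ler_addgt0Pr => d d0; apply/ltW.
have ed : 0 < e + d by rewrite ltr_wpDl.
by apply/(lt_vmodP _ ed) => i; rewrite (le_lt_trans (hv i))// ltrDl.
Qed.

Lemma cmod_le_vmod v i : cmod (v 0 i) <= vmod v.
Proof. by move: i; apply/le_vmodP => //; exact: vmod_ge0. Qed.

Lemma mulmx_bounded (A : 'M[C]_3) :
  exists2 K : R, 0 < K & forall v, vmod (v *m A) <= K * vmod v.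
Proof.
exists (1 + \sum_i \sum_j cmod (A i j)).
  by rewrite ltr_wpDr// sumr_ge0// => i _; rewrite sumr_ge0// => j _; apply: cmod_ge0.
move=> v; apply/le_vmodP.
  rewrite mulr_ge0 ?vmod_ge0// addr_ge0// sumr_ge0// => i _.
  by rewrite sumr_ge0// => j _; apply: cmod_ge0.
move=> j; rewrite mxE (le_trans (cmod_sum _ _ _))//.
rewrite mulrDl mul1r mulr_suml ler_wpDl ?vmod_ge0// ler_sum// => i _.
rewrite cmodM mulrC ler_pM ?cmod_ge0 ?cmod_le_vmod//.
rewrite (bigD1 j)//= lerDl sumr_ge0// => k _; exact: cmod_ge0.
Qed.

End ComplexModulus.

(** * Compactness and uniform convergence on compacts *)

Section Topology.
Variable R : realType.
Local Notation C := (complexes R).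
Implicit Types (z w : C) (x e r : R) (u v p : 'rV[C]_3) (H : set 'rV[C]_3).

Lemma nbhs_vmodP p (U : set 'rV[C]_3) :
  nbhs p U <-> exists2 e : R, 0 < e & forall v, vmod (v - p) < e -> U v.
Proof.
split=> [/nbhs_ballP[d /= /gt0C[x x0 ->] h]|[e e0 h]].
  by exists x => // v hv; apply: h; rewrite mx_norm_ball /ball_ /= vmodE ltcR vmodBC.
apply/nbhs_ballP; exists e%:C; first by rewrite /= ltcR.
by move=> v; rewrite mx_norm_ball /ball_ /= vmodE ltcR vmodBC; exact: h.
Qed.

Lemma open_vball p e : open [set v | vmod (v - p) < e].
Proof.
rewrite openE => v /= hv; apply/nbhs_vmodP; exists (e - vmod (v - p)); first by rewrite subr_gt0.
move=> u hu /=; rewrite -(subrK v u) -addrA (le_lt_trans (vmodD _ _))//; lra.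
Qed.

(** The closed ball is closed in a product of three squares of R^2. *)
Lemma compact_vball r : compact [set v | vmod v <= r].
Proof.
have cC : compact [set z : C | `|complex.Re z| <= r /\ `|complex.Im z| <= r].
  have -> : [set z : C | `|complex.Re z| <= r /\ `|complex.Im z| <= r] =
      (fun x : R * R => (Complex x.1 x.2 : C)) @` (`[-r, r] `*` `[-r, r]).
    apply/seteqP; split=> [[a b] /= [ha hb]|z [[a b] /= [ha hb]] <- /=].
      by exists (a, b) => //=; rewrite !in_itv /= -!ler_norml.
    by rewrite !in_itv /= -!ler_norml in ha hb.
  apply: continuous_compact; last by apply: compact_setX; exact: segment_compact.
  apply: continuous_subspaceT => -[a b].
  apply/cvgrPdist_le => e /gt0C[x x0 ->].
  have x2 : 0 < x / 2 by rewrite divr_gt0.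
  exists (ball a (x / 2), ball b (x / 2)); first by split; apply: nbhsx_ballx.
  move=> [c d] [/= h1 h2].
  rewrite le_cmod (le_trans (cmod_le_ReIm _))//=.
  by move: h1 h2; rewrite /ball /= => h1 h2; lra.
apply: (@subclosed_compact _ _ [set v : 'rV[C]_3 | forall i,
   [set z : C | `|complex.Re z| <= r /\ `|complex.Im z| <= r] (v ord0 i)]).
- rewrite closedE => v hv /=; apply/ler_addgt0Pr => e e0.
  rewrite leNgt; apply/negP => h; apply: hv.
  apply/nbhs_vmodP; exists e => // u hu /= hur.
  move: h; apply/negP; rewrite -leNgt.
  rewrite -(subrK u v) (le_trans (vmodD _ _))// addrC lerD// vmodBC; exact: ltW.
- exact: (@rV_compact C 3 (fun=> [set z : C | `|complex.Re z| <= r /\ `|complex.Im z| <= r]) (fun=> cC)).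
- move=> v /= hv i; split.
    by rewrite (le_trans (Re_le_cmod _))// (le_trans _ hv)// cmod_le_vmod.
  by rewrite (le_trans (Im_le_cmod _))// (le_trans _ hv)// cmod_le_vmod.
Qed.

Lemma compact_vmod_bounded (K : set 'rV[C]_3) : compact K ->
  exists r : R, forall v, K v -> vmod v <= r.
Proof.
move=> /compact_near_coveringP hK.
have := hK R +oo (fun r v => vmod v <= r) _.
case.
  move=> v Kv; exists ([set u | vmod (u - v) < 1], [set r | vmod v + 1 < r]) => /=.
    split; first by apply/nbhs_vmodP; exists 1.
    by exists (vmod v + 1); split=> //; rewrite num_real.
  move=> [u r] [/= h1 h2]; rewrite -(subrK v u) (le_trans (vmodD _ _))//; lra.
move=> M [_ h]; exists (M + 1) => v Kv; apply: h => //; rewrite ltrDl//.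
Qed.

Lemma compact_closed_vball H r : closed H -> compact (H `&` [set v | vmod v <= r]).
Proof. by move=> cH; rewrite setIC; apply: compact_closedI => //; exact: compact_vball. Qed.

(** The compact subsets of a closed set H are bounded, and the traces on H of
    closed balls are compact: uniform convergence on compacts is uniform
    convergence on bounded parts of H. *)
Lemma cvg_on_compactsP H fs f : closed H ->
  cvg_on_compacts H fs f <->
  (forall r e : R, 0 < e -> exists n0, forall n, (n0 <= n)%N ->
    forall v, H v -> vmod v <= r -> cmod (fs n v - f v) <= e).
Proof.
move=> cH; rewrite /cvg_on_compacts; split=> [/fam_cvgP h r e e0|h].
  have /h : compactly_in H (H `&` [set v | vmod v <= r]).
    by split; [exact: subIsetl|exact: compact_closed_vball].
  have hE : entourage [set x : C * C | cmod (x.2 - x.1) <= e].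
    rewrite -entourage_ballE; exists e%:C => /=; first by rewrite ltcR.
    by move=> [a b] /= hab; rewrite cmodBC; apply: ltW; rewrite -lt_cmod.
  have hN : nbhs (f : {uniform` (H `&` [set v | vmod v <= r]) -> C})
      [set g | forall v, (H `&` [set v | vmod v <= r]) v -> cmod (g v - f v) <= e].
    by apply/uniform_nbhs; eexists; split; [exact: hE|move=> g hg v /hg].
  move=> /(_ _ hN)[n0 _ h0].
  by exists n0 => n n0n v Hv vr; exact: h0.
apply/fam_cvgP => K [KH /compact_vmod_bounded[r Kr]].
move=> W /uniform_nbhs[E [+ EW]].
rewrite -entourage_ballE => -[_ /= /gt0C[e e0 ->] eE].
have e2 : 0 < e / 2 by rewrite divr_gt0.
have [n0 h0] := h r _ e2; exists n0 => // n /= n0n; apply: EW => v Kv.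
apply: eE; rewrite /ball /= lt_cmod cmodBC (le_lt_trans (h0 _ n0n _ (KH _ Kv) (Kr _ Kv)))//.
by rewrite gtr_pMr// invf_lt1// ltr1n.
Qed.

(** Continuity of the restriction of f to H. *)
Definition econt_on H (f : 'rV[C]_3 -> C) := forall p, H p -> forall e : R, 0 < e ->
  exists2 d : R, 0 < d & forall v, H v -> vmod (v - p) < d -> cmod (f v - f p) <= e.

Lemma within_continuousP H f : {within H, continuous f} <-> econt_on H f.
Proof.
rewrite subspace_continuousP; split=> h p Hp.
  move=> e e0; move: (h p Hp) => /cvgrPdistC_le /(_ e%:C).
  rewrite ltcR => /(_ e0) /nbhs_vmodP[d d0 hd].
  by exists d => // v Hv vp; rewrite -le_cmod; exact: hd.
apply/cvgrPdistC_le => _ /gt0C[e e0 ->].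
have [d d0 hd] := h p Hp _ e0.
apply/nbhs_vmodP; exists d => // v vp Hv.
by rewrite le_cmod hd.
Qed.

Lemma heine_cantor H f r e : closed H -> econt_on H f -> 0 < e ->
  exists2 d : R, 0 < d & forall u v, H u -> H v -> vmod u <= r -> vmod v <= r ->
    vmod (u - v) < d -> cmod (f u - f v) <= e.
Proof.
move=> cH cf e0.
have /compact_near_coveringP hK := @compact_closed_vball H r cH.
pose K := H `&` [set v | vmod v <= r].
have := hK R 0^'+ (fun d v => K v -> forall u, K u -> vmod (u - v) < d -> cmod (f u - f v) <= e) _.
case.
  move=> p [Hp _].
  have [d d0 hd] := cf p Hp (e / 2) ltac:(by rewrite divr_gt0).
  have d2 : 0 < d / 2 by rewrite divr_gt0.
  exists ([set v | vmod (v - p) < d / 2], [set x | x < d / 2]) => /=.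
    split; first by apply/nbhs_vmodP; exists (d / 2).
    exact: nbhs_right_lt.
  move=> [v x] [/= h1 h2] [Hv _] u [Hu _] uv.
  have -> : f u - f v = (f u - f p) - (f v - f p) by rewrite opprB addrA subrK.
  rewrite (le_trans (cmodB _ _))// (splitr e) lerD ?hd//; last by lra.
  rewrite -(subrK v u) -addrA (le_lt_trans (vmodD _ _))//; lra.
move=> d /= d0 hd; exists (d / 2); first by rewrite divr_gt0.
move=> u v Hu Hv ur vr uv; apply: (hd (d / 2)) => //=.
- rewrite /= sub0r normrN gtr0_norm ?divr_gt0//; lra.
- by rewrite divr_gt0.
Qed.

Lemma bounded_on_vball H f r : closed H -> econt_on H f ->
  exists2 B : R, 0 < B & forall v, H v -> vmod v <= r -> cmod (f v) <= B.
Proof.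
move=> cH cf.
have /compact_near_coveringP hK := @compact_closed_vball H r cH.
have := hK R +oo (fun B v => H v -> cmod (f v) <= B) _.
case.
  move=> p [Hp _].
  have [d d0 hd] := cf p Hp _ ltr01.
  exists ([set v | vmod (v - p) < d], [set B | cmod (f p) + 1 < B]) => /=.
    split; first by apply/nbhs_vmodP; exists d.
    by exists (cmod (f p) + 1); split=> //; rewrite num_real.
  move=> [v B] [/= h1 h2] Hv; rewrite -(subrK (f p) (f v)).
  rewrite (le_trans (cmodD _ _))//; have := hd _ Hv h1; lra.
move=> M [_ h]; exists (`|M| + 1); first by rewrite ltr_wpDl.
move=> v Hv vr; apply: (h (`|M| + 1)) => //.
by rewrite (le_lt_trans (ler_norm M))// ltrDl.
Qed.

End Topology.

(** * Dyadic averages on segments and Goursat's lemma *)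

Section Goursat.
Variable R : realType.
Local Notation C := (complexes R).
Implicit Types (z w p q : C) (x e r t : R) (F G : C -> C) (m n : nat).

(** Complex differentiability at a point, in the epsilon-delta form that the
    estimates of Goursat's lemma use directly. *)
Definition cdiff F z := exists D, forall e : R, 0 < e -> exists2 d : R, 0 < d &
  forall w, cmod (w - z) < d -> cmod (F w - F z - D * (w - z)) <= e * cmod (w - z).

(** The Riemann sum over the dyadic subdivision of the segment from z to z + q
    into 2^m pieces, with left tags, divided by q. Halving the segment rather
    than the mesh makes every property an induction on m. *)
Fixpoint avg m F z q : C :=
  if m is m'.+1 then (avg m' F z (q / 2) + avg m' F (z + q / 2) (q / 2)) / 2
  else F z.

Lemma cmod_half z : cmod (z / 2) = cmod z / 2.
Proof. by rewrite cmodM cmodV cmod_nat. Qed.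

Lemma avg_le m F z q B :
  (forall t, 0 <= t <= 1 -> cmod (F (z + t%:C * q)) <= B) -> cmod (avg m F z q) <= B.
Proof.
elim: m z q => [|m IH] z q h /=.
  by have := h 0; rewrite rmorph0 mul0r addr0; apply; rewrite lexx ler01.
rewrite cmod_half ler_pdivrMr// (le_trans (cmodD _ _))// mulrDr mulr1 lerD// IH// => t /andP[t0 t1].
  have -> : t%:C * (q / 2) = (t / 2)%:C * q by rewrite rmorphM fmorphV rmorph_nat; field.
  by apply: h; apply/andP; split; lra.
have -> : z + q / 2 + t%:C * (q / 2) = z + ((1 + t) / 2)%:C * q.
  by rewrite rmorphM fmorphV rmorph_nat rmorphD rmorph1; field.
by apply: h; apply/andP; split; lra.
Qed.

Lemma avgD m F G z q : avg m (fun w => F w + G w) z q = avg m F z q + avg m G z q.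
Proof. by elim: m z q => [//|m IH] z q /=; rewrite !IH; ring. Qed.

Lemma avgZ m c F z q : avg m (fun w => c * F w) z q = c * avg m F z q.
Proof. by elim: m z q => [//|m IH] z q /=; rewrite !IH; ring. Qed.

Lemma avgB m F G z q : avg m (fun w => F w - G w) z q = avg m F z q - avg m G z q.
Proof. by elim: m z q => [//|m IH] z q /=; rewrite !IH; ring. Qed.

Lemma avg_cst m c z q : avg m (fun=> c) z q = c.
Proof. by elim: m z q => [//|m IH] z q /=; rewrite !IH; field. Qed.

Lemma avg_shift m F z w q : avg m F (z + w) q = avg m (fun u => F (u + w)) z q.
Proof.
elim: m z q => [//|m IH] z q /=; rewrite -!IH.
by congr ((_ + avg _ _ _ _) / 2); rewrite addrAC.
Qed.

(** Refining the subdivision moves each tag by at most 2^-m times q. *)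
Lemma avg_cvg m k F z q e :
  (forall s t : R, 0 <= s <= 1 -> 0 <= t <= 1 -> `|s - t| <= 2 ^- m ->
     cmod (F (z + s%:C * q) - F (z + t%:C * q)) <= e) ->
  cmod (avg (m + k) F z q - avg m F z q) <= e.
Proof.
elim: m z q => [|m IH] z q h.
  rewrite add0n [avg 0 _ _ _]/=.
  have -> : avg k F z q - F z = avg k (fun w => F w - F z) z q.
    by rewrite avgB avg_cst.
  apply: avg_le => t t01; have := h t 0; rewrite rmorph0 mul0r addr0; apply => //.
    by rewrite lexx ler01.
  by rewrite subr0 expr0 invr1; case/andP: t01 => ? ?; rewrite ger0_norm.
rewrite addSn /=.
have -> (a b c d : C) : (a + b) / 2 - (c + d) / 2 = ((a - c) + (b - d)) / 2 by ring.
have hh s t : `|s - t| <= 2 ^- m -> `|(s - t) / 2| <= 2 ^- m.+1.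
  move=> st; rewrite normrM normfV normr_nat exprS invfM [2^-1 * _]mulrC ler_pM2r// invr_gt0 ltr0n//.
rewrite cmod_half ler_pdivrMr// (le_trans (cmodD _ _))// mulrDr mulr1 lerD//; apply: IH => s t s01 t01 st.
  have E x : x%:C * (q / 2) = (x / 2)%:C * q by rewrite rmorphM fmorphV rmorph_nat; field.
  rewrite !E; apply: h; try by case/andP: s01 => *; case/andP: t01 => *; apply/andP; split; lra.
  by rewrite -mulrBl; exact: hh.
have E x : z + q / 2 + x%:C * (q / 2) = z + ((1 + x) / 2)%:C * q.
  by rewrite rmorphM fmorphV rmorph_nat rmorphD rmorph1; field.
rewrite !E; apply: h; try by case/andP: s01 => *; case/andP: t01 => *; apply/andP; split; lra.
rewrite -mulrBl (_ : 1 + s - (1 + t) = s - t); [exact: hh|ring].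
Qed.

(** A Riemann sum for the integral of F along the boundary of the parallelogram
    with sides p and q. Parallel sides carry the same tags, so that it vanishes
    exactly on affine functions and is exactly additive under quartering. *)
Definition bsum m F z p q : C :=
  p * avg m F z p + q * avg m F (z + p) q - p * avg m F (z + q) p - q * avg m F z q.

Lemma bsumS m F z p q : bsum m.+1 F z p q =
  bsum m F z (p / 2) (q / 2) + bsum m F (z + p / 2) (p / 2) (q / 2)
  + bsum m F (z + q / 2) (p / 2) (q / 2)
  + bsum m F (z + (p / 2 + q / 2)) (p / 2) (q / 2).
Proof.
rewrite /bsum /=.
have hp w : w + p / 2 + p / 2 = w + p by field.
have hq w : w + q / 2 + q / 2 = w + q by field.
rewrite !hp !hq.
rewrite !addrA.
have E1 : z + p / 2 + q / 2 + p / 2 = z + p + q / 2 by field.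
have E2 : z + q / 2 + p / 2 = z + p / 2 + q / 2 by field.
have E3 : z + p / 2 + q / 2 + q / 2 = z + q + p / 2 by field.
rewrite E1 E3 E2.
by field.
Qed.

Lemma avg_affine m a D z q : exists c : C, forall z q,
  avg m (fun w => a + D * w) z q = a + D * z + D * q * c.
Proof.
elim: m => [|m [c IH]]; first by exists 0 => z' q'; rewrite mulr0 addr0.
by exists (c / 2 + 4^-1) => z' q' /=; rewrite !IH; field.
Qed.

Lemma bsum_affine m a D z p q : bsum m (fun w => a + D * w) z p q = 0.
Proof. have [c hc] := avg_affine m a D z q; rewrite /bsum !hc; ring. Qed.

Lemma bsumB m F G z p q :
  bsum m (fun w => F w - G w) z p q = bsum m F z p q - bsum m G z p q.
Proof. rewrite /bsum !avgB; ring. Qed.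

Lemma bsum_le m F z p q B :
  (forall s t : R, 0 <= s <= 1 -> 0 <= t <= 1 -> cmod (F (z + s%:C * p + t%:C * q)) <= B) ->
  cmod (bsum m F z p q) <= 2 * (cmod p + cmod q) * B.
Proof.
move=> h.
have i0 : (0 : R) <= (0 : R) <= 1 by lra.
have i1 : (0 : R) <= (1 : R) <= 1 by lra.
have h1 : cmod (avg m F z p) <= B.
  by apply: avg_le => t t01; have := h t 0 t01 i0; rewrite rmorph0 mul0r addr0.
have h2 : cmod (avg m F (z + p) q) <= B.
  by apply: avg_le => t t01; have := h 1 t i1 t01; rewrite rmorph1 mul1r.
have h3 : cmod (avg m F (z + q) p) <= B.
  by apply: avg_le => t t01; have := h t 1 t01 i1; rewrite rmorph1 mul1r addrAC.
have h4 : cmod (avg m F z q) <= B.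
  by apply: avg_le => t t01; have := h 0 t i0 t01; rewrite rmorph0 mul0r addr0.
rewrite /bsum.
have hM w (u : C) : cmod u <= B -> cmod (w * u) <= cmod w * B.
  by move=> hu; rewrite cmodM ler_wpM2l ?cmod_ge0.
have := hM p _ h1; have := hM q _ h2; have := hM p _ h3; have := hM q _ h4.
set a := p * _; set b := q * _; set c := p * _; set d := q * _.
move=> H1 H2 H3 H4.
have := cmodB (c + d - a) b; have := cmodB (c + d) a; have := cmodD c d.
lra.
Qed.

Definition bsum_bad F e z p q :=
  forall m0, exists2 m, (m0 <= m)%N & e < cmod (bsum m F z p q).

(** By additivity, if the four quarters had small boundary sums for all large
    m, so would the whole parallelogram. *)
Lemma bsum_bad_quarter F e z p q : bsum_bad F e z p q ->
  exists2 w, cmod (w - z) <= (cmod p + cmod q) / 2 & bsum_bad F (e / 4) w (p / 2) (q / 2).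
Proof.
move=> hb; apply: contrapT => hn.
have good w : cmod (w - z) <= (cmod p + cmod q) / 2 ->
    exists m0, forall m, (m0 <= m)%N -> cmod (bsum m F w (p / 2) (q / 2)) <= e / 4.
  move=> hw; apply: contrapT => h; apply: hn; exists w => // m0.
  apply: contrapT => h'; apply: h; exists m0 => m mm; rewrite leNgt; apply/negP => h''.
  by apply: h'; exists m.
have cp := cmod_ge0 p; have cq := cmod_ge0 q.
have [m1 h1] := good z ltac:(rewrite subrr cmod0; lra).
have [m2 h2] := good (z + p / 2) ltac:(rewrite addrC addKr cmod_half; lra).
have [m3 h3] := good (z + q / 2) ltac:(rewrite addrC addKr cmod_half; lra).
have [m4 h4] := good (z + (p / 2 + q / 2))
  ltac:(rewrite addrC addKr (le_trans (cmodD _ _))// !cmod_half; lra).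
have [[//|m] mm hB] := hb (m1 + m2 + m3 + m4).+1.
have {}h1 := h1 m ltac:(lia); have {}h2 := h2 m ltac:(lia).
have {}h3 := h3 m ltac:(lia); have {}h4 := h4 m ltac:(lia).
move: hB h1 h2 h3 h4; rewrite bsumS.
set a := bsum _ _ _ _ _; set b := bsum _ _ _ _ _.
set c := bsum _ _ _ _ _; set d := bsum _ _ _ _ _.
have := cmodD (a + b + c) d; have := cmodD (a + b) c; have := cmodD a b; lra.
Qed.

Lemma exp2R_small (K d : R) : 0 < d -> exists n, K * 2 ^- n < d.
Proof.
move=> d0; exists (Num.bound (`|K| / d)).
have := archi_boundP (x := `|K| / d) ltac:(by rewrite divr_ge0// ltW).
set n := Num.bound _ => hn.
have h2 : (n%:R : R) < 2 ^+ n by rewrite -natrX ltr_nat ltn_expl.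
rewrite ltr_pdivrMr ?exprn_gt0// (le_lt_trans (ler_norm _))//.
rewrite -ltr_pdivrMl// mulrC (lt_trans hn)//.
Qed.

(** The classical quartering argument. Were the boundary sums not eventually
    small, they would fail to be so on parallelograms shrinking to a point l
    with bounds e / 4^n. Subtracting the affine approximation of F at l, which
    changes nothing, leaves a sum that is a small multiple of 4^-n. *)
Lemma goursat F z p q e : (forall z, cdiff F z) -> 0 < e ->
  exists m0, forall m, (m0 <= m)%N -> cmod (bsum m F z p q) <= e.
Proof.
move=> dF e0; apply: contrapT => hn.
have bad0 : bsum_bad F e z p q.
  move=> m0; apply: contrapT => h'; apply: hn; exists m0 => m mm.
  by rewrite leNgt; apply/negP => h''; apply: h'; exists m.
pose h := cmod p + cmod q.
have h0 : 0 <= h by rewrite addr_ge0 ?cmod_ge0.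
pose P n (w : C) := bsum_bad F (e * 4 ^- n) w (p * 2 ^- n) (q * 2 ^- n).
have step n w : exists w', P n w -> cmod (w' - w) <= h * 2 ^- n.+1 /\ P n.+1 w'.
  have [Pw|nPw] := pselect (P n w); last by exists w.
  have [w' h1 h2] := bsum_bad_quarter Pw.
  exists w' => _; split.
    move: h1; rewrite !cmodM !cmodV !cmodX !cmod_nat => h1.
    rewrite (le_trans h1)// exprS /h.
    by rewrite invfM -mulrDl -mulrA [2^-1 * _]mulrC.
  move: h2; rewrite /P !exprS; congr bsum_bad.
  - by rewrite invfM; ring.
  - by rewrite invfM; ring.
  - by rewrite invfM; ring.
have [nx hnx] := choice (fun x : nat * C => step x.1 x.2).
pose zs := fix zs n := if n is n'.+1 then nx (n', zs n') else z.
have Pz n : P n (zs n).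
  elim: n => [|n IH]; first by rewrite /P !expr0 !invr1 !mulr1.
  by have [] := hnx (n, zs n) IH.
have zsS n : cmod (zs n.+1 - zs n) <= h * 2 ^- n.+1.
  by have [] := hnx (n, zs n) (Pz n).
have zsD n k : cmod (zs (n + k)%N - zs n) <= h * 2 ^- n - h * 2 ^- (n + k).
  elim: k => [|k IH]; first by rewrite addn0 !subrr cmod0.
  rewrite addnS -(subrK (zs (n + k)%N) (zs _)) -addrA (le_trans (cmodD _ _))//.
  rewrite (le_trans (lerD (zsS _) IH))// exprS invfM; lra.
have pow0 n : 0 < 2 ^- n :> R by rewrite invr_gt0 exprn_gt0.
have [l hl] : exists l, forall e : R, 0 < e -> exists n0, forall n, (n0 <= n)%N ->
     cmod (zs n - l) <= e.
  apply: cauchy_cvgC => d d0.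
  have [n0 hn0] := @exp2R_small (2 * h) d d0.
  exists n0 => n m nn nm.
  have := zsD n0 (n - n0)%N; have := zsD n0 (m - n0)%N; rewrite !subnKC//.
  have := mulr_ge0 h0 (ltW (pow0 n)); have := mulr_ge0 h0 (ltW (pow0 m)).
  have := cmodB (zs n - zs n0) (zs m - zs n0); rewrite opprB addrA subrK.
  lra.
have zsl n : cmod (zs n - l) <= h * 2 ^- n.
  apply/ler_addgt0Pr => d d0; have [n0 hn0] := hl d d0.
  have := hn0 (n + n0)%N (leq_addl _ _).
  have := zsD n n0; have := mulr_ge0 h0 (ltW (pow0 (n + n0)%N)).
  have := cmodB (zs (n + n0)%N - l) (zs (n + n0)%N - zs n).
  by rewrite opprB addrC addrA subrK [zs n - l]addrC; lra.
have [D hD] := dF l.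
pose e1 := e / (4 * h ^+ 2 + 1).
have e10 : 0 < e1 by rewrite divr_gt0// ltr_wpDl// mulr_ge0// sqr_ge0.
have [d d0 hd] := hD _ e10.
have [n hn2] := @exp2R_small (2 * h) d d0.
(* The affine approximation at l has error e1 times the diameter; the perimeter
   and the diameter are both of order h / 2^n, and e1 is chosen so that the
   product stays below e / 4^n. *)
have hsmall : e * 4 ^- n < e * 4 ^- n.
  have [m _ /lt_le_trans] := Pz n 0%N; apply.
  have -> : bsum m F (zs n) (p * 2 ^- n) (q * 2 ^- n) =
     bsum m (fun w => F w - (F l - D * l + D * w)) (zs n) (p * 2 ^- n) (q * 2 ^- n).
    by rewrite bsumB bsum_affine subr0.
  have hpq : cmod (p * 2 ^- n) + cmod (q * 2 ^- n) = h * 2 ^- n.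
    by rewrite !cmodM cmodV cmodX cmod_nat -mulrDl.
  apply: (@le_trans _ _ (2 * (h * 2 ^- n) * (e1 * (2 * (h * 2 ^- n))))).
    rewrite -hpq; apply: bsum_le => s t /andP[s0 s1] /andP[t0 t1].
    rewrite hpq; set w := zs n + _ + _.
    have wl : cmod (w - l) <= 2 * (h * 2 ^- n).
      have -> : w - l = zs n - l + (s%:C * (p * 2 ^- n) + t%:C * (q * 2 ^- n)).
        by rewrite /w; ring.
      rewrite (le_trans (cmodD _ _))// mulr_natl mulr2n lerD//.
      have E x (y : C) : 0 <= x -> x <= 1 -> cmod (x%:C * y) <= cmod y.
        by move=> x0 x1; rewrite cmodM cmod_real ger0_norm// ler_piMl ?cmod_ge0.
      by rewrite (le_trans (cmodD _ _))// -hpq lerD// E.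
    have wd : cmod (w - l) < d by rewrite (le_lt_trans wl)// mulrA.
    have hw := hd w wd.
    have -> : F w - (F l - D * l + D * w) = F w - F l - D * (w - l) by ring.
    by rewrite (le_trans hw)// ler_pM2l.
  have -> : 4 ^- n = 2 ^- n * 2 ^- n :> R.
    by rewrite -invfM -exprMn -natrM.
  rewrite /e1; set x := 2 ^- n.
  have -> : 2 * (h * x) * (e / (4 * h ^+ 2 + 1) * (2 * (h * x))) =
     (e * (x * x)) * (4 * h ^+ 2 / (4 * h ^+ 2 + 1)) by ring.
  rewrite ler_piMr// ?mulr_ge0// ?(ltW e0)//; try exact/ltW/pow0.
  by rewrite ler_pdivrMr ?mul1r ?lerDl// ltr_wpDl// mulr_ge0// sqr_ge0.
by rewrite ltxx in hsmall.
Qed.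

End Goursat.

(** * Complex differentiability in one and in three variables *)

Section LinForm.
Variable R : realType.
Local Notation C := (complexes R).

Definition covector (d : 'I_3 -> C) (v : 'rV[C]_3) : C := \sum_i d i * v 0 i.

Lemma covector_is_linear d : linear (covector d).
Proof.
move=> a u v; rewrite /covector scaler_sumr -big_split /=; apply: eq_bigr => i _.
by rewrite !mxE mulrDr mulrCA.
Qed.
HB.instance Definition _ d := GRing.isLinear.Build C 'rV[C]_3 C _ (covector d)
  (@covector_is_linear d).

Lemma covector_bounded d : exists2 K : R, 0 < K &
  forall v, cmod (covector d v) <= K * vmod v.
Proof.
exists (1 + \sum_i cmod (d i)).
  by rewrite ltr_wpDr// sumr_ge0// => i _; apply: cmod_ge0.
move=> v; rewrite (le_trans (cmod_sum _ _ _))// mulrDl mul1r mulr_suml.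
rewrite ler_wpDl ?vmod_ge0// ler_sum// => i _.
by rewrite cmodM ler_pM ?cmod_ge0 ?cmod_le_vmod.
Qed.
End LinForm.

Section Differentiability.
Variable R : realType.
Local Notation C := (complexes R).
Implicit Types (z w : C) (x e r : R) (u v p : 'rV[C]_3) (X : set 'rV[C]_3).

(** Differentiability at p along the subset X only, with the differential given
    by a linear form of the ambient space. This is what a local holomorphic
    extension leaves on X, and it does not mention the extension. *)
Definition vdiff X (f : 'rV[C]_3 -> C) p := exists d : 'I_3 -> C,
  forall e : R, 0 < e -> exists2 eta : R, 0 < eta & forall v, X v -> vmod (v - p) < eta ->
    cmod (f v - f p - covector d (v - p)) <= e * vmod (v - p).

Lemma differentiable_vdiff (f : 'rV[C]_3 -> C) p :
  differentiable f p <-> vdiff setT f p.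
Proof.
split=> [/diff_locallyP [_ /eqaddoP h]|[d hd]].
  exists (fun i => 'd f p (delta_mx 0 i)) => e e0.
  have := h e%:C; rewrite ltcR => /(_ e0) /nbhs_vmodP[eta eta0 H].
  exists eta => // v _ hv.
  have := H (v - p); rewrite subr0 => /(_ hv).
  rewrite !fctE /= subrK opprD addrA cmodE vmodE -rmorphM lecR.
  set x := 'd f p (v - p); set y := covector _ _.
  suff -> : x = y by [].
  rewrite /x /y /covector {1}(matrix_sum_delta (v - p)) big_ord1 linear_sum /=.
  by apply: eq_bigr => i _; rewrite linearZ /= mulrC.
have cL : continuous (covector d).
  move=> v.
  suff : covector d @ nbhs v --> covector d v by [].
  apply/(@cvgrPdistC_le _ _ _ (nbhs v) (nbhs_filter v)) => _ /gt0C[e e0 ->].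
  have [K K0 hK] := covector_bounded d.
  apply/nbhs_vmodP; exists (e / K); first by rewrite divr_gt0.
  move=> u hu; rewrite le_cmod -linearB (le_trans (hK _))//.
  by rewrite -ler_pdivlMl// mulrC ltW.
pose L : {linear 'rV[C]_3 -> C} := covector d.
have HL : forall eps : C, 0 < eps -> \forall v \near (0 : 'rV[C]_3), `|(f \o shift p - (cst (f p) + (L : 'rV[C]_3 -> C))) v| <= eps * `|v|.
  move => _ /gt0C[e e0 ->].
  have [eta eta0 he] := hd e e0.
  apply/nbhs_vmodP; exists eta => // v; rewrite subr0 => hv.
  have := he (v + p) I; rewrite addrK => /(_ hv).
  by rewrite !fctE /= opprD addrA cmodE vmodE -rmorphM lecR.
have Ed : 'd f p = L :> ('rV[C]_3 -> C).
  by apply: diff_unique => //; apply/eqaddoP.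
by apply/diff_locallyP; rewrite Ed; split => //; apply/eqaddoP.
Qed.

Lemma derivable_cdiff (F : C -> C) z : derivable F z 1 <-> cdiff F z.
Proof.
rewrite /derivable; split=> [/cvg_ex[D hD]|[D hD]].
  exists D => e e0; move/cvgrPdistC_le : hD => /(_ e%:C); rewrite ltcR => /(_ e0).
  move=> /nbhs_ballP[_ /= /gt0C[d d0 ->] H]; exists d => // w wz.
  have [->|wn] := eqVneq w z; first by rewrite !subrr mulr0 subrr cmod0 mulr0.
  have wz0 : w - z != 0 by rewrite subr_eq0.
  have := H (w - z); rewrite /ball /= sub0r normrN lt_cmod => /(_ wz wz0).
  rewrite /= le_cmod [_%:A]mulr1 subrK => hh.
  have -> : F w - F z - D * (w - z) = (w - z) * ((w - z)^-1 * (F w - F z) - D).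
    by field.
  by rewrite cmodM mulrC ler_wpM2r ?cmod_ge0.
apply/cvg_ex; exists D; apply/cvgrPdistC_le => _ /gt0C[e e0 ->].
have [d d0 H] := hD e e0.
apply/nbhs_ballP; exists d%:C; first by rewrite /= ltcR.
move=> h /=; rewrite /ball /= sub0r normrN lt_cmod => hd h0.
rewrite le_cmod [_%:A]mulr1.
have := H (h + z); rewrite addrK => /(_ hd) H'.
rewrite -(ler_pM2l (x := cmod h)) ?cmod_gt0// -cmodM [X in _ <= X]mulrC.
suff -> : h * (h^-1 * (F (h + z) - F z) - D) = F (h + z) - F z - D * h by [].
by field.
Qed.

Lemma cdiff_cst c z : cdiff (fun=> c) z.
Proof. by apply/derivable_cdiff; apply: derivable_cst. Qed.

Lemma cdiff_id z : cdiff id z.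
Proof. by apply/derivable_cdiff; apply: derivable_id. Qed.

Lemma cdiffD F G z : cdiff F z -> cdiff G z -> cdiff (fun w => F w + G w) z.
Proof. by move=> /derivable_cdiff hF /derivable_cdiff hG; apply/derivable_cdiff; apply: derivableD. Qed.

Lemma cdiffM F G z : cdiff F z -> cdiff G z -> cdiff (fun w => F w * G w) z.
Proof. by move=> /derivable_cdiff hF /derivable_cdiff hG; apply/derivable_cdiff; exact: (derivableM hF hG). Qed.

Lemma cdiffV F z : F z != 0 -> cdiff F z -> cdiff (fun w => (F w)^-1) z.
Proof. by move=> F0 /derivable_cdiff hF; apply/derivable_cdiff; apply: derivableV. Qed.

Lemma cdiffX F n z : cdiff F z -> cdiff (fun w => F w ^+ n) z.
Proof.
move=> hF; elim: n => [|n IH].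
  by have -> : (fun w => F w ^+ 0) = (fun=> 1) by []; exact: cdiff_cst.
have -> : (fun w => F w ^+ n.+1) = (fun w => F w * F w ^+ n) by apply: funext => w; rewrite exprS.
exact: cdiffM.
Qed.

Lemma cdiff_avg m (F : C -> C -> C) z a q : (forall w, cdiff (F ^~ w) z) ->
  cdiff (fun y => avg m (F y) a q) z.
Proof.
move=> h; elim: m a q => [|m IH] a q /=; first exact: h.
by apply: cdiffM; [apply: cdiffD; exact: IH|exact: cdiff_cst].
Qed.

Lemma cdiff_cont F z : cdiff F z -> forall e : R, 0 < e -> exists2 d : R, 0 < d &
  forall w, cmod (w - z) < d -> cmod (F w - F z) <= e.
Proof.
move=> [D hD] e e0; have [d d0 hd] := hD 1 ltr01.
have K0 : 0 < cmod D + 1 by rewrite ltr_wpDl ?cmod_ge0.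
exists (Num.min d (e / (cmod D + 1))); first by rewrite lt_min d0 divr_gt0.
move=> w; rewrite lt_min => /andP[/hd]; rewrite mul1r ltr_pdivlMr// => h1 h2.
have -> : F w - F z = (F w - F z - D * (w - z)) + D * (w - z) by rewrite subrK.
rewrite (le_trans (cmodD _ _))// cmodM.
by move: h1 h2; set a := cmod (_ - _ - _); set b := cmod (w - z); nra.
Qed.

Lemma pos_lower n (et : 'I_n.+1 -> R) : (forall i, 0 < et i) ->
  exists2 d : R, 0 < d & forall i, d <= et i.
Proof.
move=> h; exists (et [arg min_(i < ord0) et i]%O) => // i.
by case: arg_minP => // j _; apply.
Qed.

(** The chain rule for a curve drawn on X: it turns differentiability along the
    quadric into holomorphy of one-variable functions, the only holomorphy that
    the approximation argument uses. *)
Lemma cdiff_curve X f (g : C -> 'rV[C]_3) z :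
  (forall i, cdiff (fun w => g w 0 i) z) -> vdiff X f (g z) ->
  (exists2 d : R, 0 < d & forall w, cmod (w - z) < d -> X (g w)) ->
  cdiff (f \o g) z.
Proof.
move=> dg [d hd] [dX dX0 Xg].
have [D hD] := choice dg.
pose Dv : 'rV[C]_3 := \row_i D i.
have hv e : 0 < e -> exists2 eta : R, 0 < eta & forall w, cmod (w - z) < eta ->
    vmod (g w - g z - (w - z) *: Dv) <= e * cmod (w - z).
  move=> e0.
  have /choice[et het] : forall i, exists eta : R, 0 < eta /\ forall w,
      cmod (w - z) < eta -> cmod (g w 0 i - g z 0 i - D i * (w - z)) <= e * cmod (w - z).
    by move=> i; have [eta] := hD i e e0; exists eta.
  have [eta eta0 heta] := @pos_lower 2 et (fun i => (het i).1).
  exists eta => // w wz; apply/le_vmodP => [|i].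
    by rewrite mulr_ge0 ?cmod_ge0// ltW.
  rewrite !mxE mulrC; apply: (het i).2; exact: lt_le_trans wz (heta i).
have [K K0 hK] := covector_bounded d.
exists (covector d Dv) => e e0.
pose B := vmod Dv + 1.
have B0 : 0 < B by rewrite ltr_wpDl ?vmod_ge0.
have [d1 d10 h1] := hd (e / (2 * B)) ltac:(by rewrite divr_gt0// mulr_gt0).
have [d2 d20 h2] := hv (Num.min 1 (e / (2 * K)))
  ltac:(by rewrite lt_min ltr01 divr_gt0// mulr_gt0).
exists (Num.min dX (Num.min d2 (d1 / B))); first by rewrite !lt_min dX0 d20 divr_gt0.
move=> w; rewrite !lt_min => /andP[/Xg Xgw /andP[/h2 H2]]; rewrite ltr_pdivlMr// => wd1.
set c := cmod (w - z) in H2 wd1 *.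
have c0 : 0 <= c := cmod_ge0 _.
have gB : vmod (g w - g z) <= B * c.
  rewrite -(subrK ((w - z) *: Dv) (g w - g z)) (le_trans (vmodD _ _))//.
  rewrite vmodZ -/c mulrDl mul1r addrC [_ * c]mulrC lerD//.
  by rewrite (le_trans H2)// ler_piMl// ge_min lexx.
have H1 := h1 (g w) Xgw ltac:(by rewrite (le_lt_trans gB)// mulrC).
have -> : (f \o g) w - (f \o g) z - covector d Dv * (w - z) =
   (f (g w) - f (g z) - covector d (g w - g z)) +
   covector d (g w - g z - (w - z) *: Dv).
  have -> : covector d (g w - g z - (w - z) *: Dv) =
      covector d (g w - g z) - (w - z) * covector d Dv by rewrite linearB linearZ.
  by rewrite /=; ring.
rewrite (le_trans (cmodD _ _))// (splitr e) mulrDl lerD//.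
  rewrite (le_trans H1)// (le_trans (ler_wpM2l _ gB))//.
    by rewrite ltW// divr_gt0// mulr_gt0.
  rewrite mulrA ler_wpM2r// invfM mulrA -[_ * _ * B]mulrA mulVf ?mulr1// gt_eqF//.
rewrite (le_trans (hK _))// (le_trans (ler_wpM2l (ltW K0) H2))//.
rewrite mulrA ler_wpM2r// -ler_pdivlMl//.
rewrite ge_min invfM; apply/orP; right.
by rewrite [K^-1 * _]mulrC mulrA.
Qed.

End Differentiability.

(** * The complex exponential *)

Section ComplexExp.
Variable R : realType.
Local Notation C := (complexes R).
Implicit Types (z w : C) (x e r t : R).

Definition cis x : C := Complex (cos x) (sin x).

Definition cexp z : C := (expR (complex.Re z))%:C * cis (complex.Im z).

Definition twopii : C := Complex 0 (pi *+ 2).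

Lemma cisD x y : cis (x + y) = cis x * cis y.
Proof. by apply/eqP; rewrite eq_complex /= cosD sinD eqxx /= [X in _ == X]addrC eqxx. Qed.

Lemma cexpD z w : cexp (z + w) = cexp z * cexp w.
Proof.
rewrite /cexp !raddfD /= cisD expRD rmorphM /=.
by rewrite mulrACA.
Qed.

Lemma cmod_cis x : cmod (cis x) = 1.
Proof.
by rewrite /cmod normc_def /= cos2Dsin2 sqrtr1.
Qed.

Lemma cmod_cexp z : cmod (cexp z) = expR (complex.Re z).
Proof. by rewrite cmodM cmod_cis mulr1 cmod_real ger0_norm ?expR_ge0. Qed.

Lemma cexp_neq0 z : cexp z != 0.
Proof. by rewrite -cmod_gt0 cmod_cexp expR_gt0. Qed.

Lemma cexp0 : cexp 0 = 1.
Proof. by apply/eqP; rewrite eq_complex /= expR0 cos0 sin0; rewrite !mul0r !mul1r ?subr0 ?addr0 !eqxx. Qed.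

Lemma cexp_period z : cexp (z + twopii) = cexp z.
Proof.
rewrite cexpD; suff -> : cexp twopii = 1 by rewrite mulr1.
by apply/eqP; rewrite eq_complex /= expR0 cos2pi sin2pi; rewrite !mul0r !mul1r ?subr0 ?addr0 !eqxx.
Qed.

Lemma cmod_cexp_circle t : cmod (cexp (t%:C * twopii)) = 1.
Proof. by rewrite cmod_cexp /= mulr0 mul0r subr0 expR0. Qed.

(** Polar coordinates: every direction is a value of the cosine-sine pair,
    since acos covers [0, pi] and the sign of the imaginary part selects the
    half circle. *)
Lemma cexp_onto z : z != 0 -> exists l, cexp l = z.
Proof.
move=> z0; have m0 : 0 < cmod z by rewrite cmod_gt0.
case E : (z / (cmod z)%:C) => [a b].
have hab : a ^+ 2 + b ^+ 2 = 1.
  have h1 : cmod (z / (cmod z)%:C) = 1.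
    by rewrite cmodM cmodV cmod_real ger0_norm ?cmod_ge0// mulfV ?gt_eqF.
  by have := cmod_sqr (z / (cmod z)%:C); rewrite h1 E expr1n /= => <-.
have a1 : -1 <= a <= 1.
  by rewrite -ler_norml -(ler_pXn2r (n := 2)) ?nnegrE// expr1n real_normK ?num_real// -hab lerDl sqr_ge0.
have [th hth] : exists th, cis th = z / (cmod z)%:C.
  have sb : Num.sqrt (1 - a ^+ 2) = `|b| by rewrite -hab addrAC subrr add0r sqrtr_sqr.
  have [b0|b0] := leP 0 b.
    by exists (acos a); rewrite /cis acosK ?in_itv//= sin_acos// sb ger0_norm.
  by exists (- acos a); rewrite /cis cosN sinN acosK ?in_itv//= sin_acos// sb ltr0_norm// opprK.
exists (Complex (ln (cmod z)) th); rewrite /cexp /= lnK ?posrE// hth mulrC mulfVK//.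
by rewrite -cmod_eq0 cmod_real gt_eqF// normr_gt0 gt_eqF.
Qed.

Lemma is_derive_small (f : R -> R) (c : R) : is_derive (0 : R) 1 f c ->
  forall e : R, 0 < e -> exists2 d : R, 0 < d &
    forall x, `|x| < d -> `|f x - f 0 - c * x| <= e * `|x|.
Proof.
move=> [hd hc] e e0; move: hd; rewrite /derivable => hd.
have : h^-1 *: ((f \o shift 0) h%:A - f 0) @[h --> 0^'] --> c by rewrite -hc.
move=> /cvgrPdistC_le /(_ e e0) /nbhs_ballP[d /= d0 H].
exists d => // x xd.
have [->|x0] := eqVneq x 0; first by rewrite mulr0 subr0 subrr normr0 mulr0.
have := H x; rewrite /ball /= sub0r normrN => /(_ xd x0).
rewrite [_%:A]mulr1 addr0 => hh.
have -> : f x - f 0 - c * x = (x^-1 * (f x - f 0) - c) * x by field.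
by rewrite normrM ler_wpM2r.
Qed.

(** By the addition formula, differentiability at z reduces to
    differentiability at 0, which follows from the real derivatives of exp, cos
    and sin at 0. *)
Lemma cdiff_cexp z : cdiff cexp z.
Proof.
suff h e : 0 < e -> exists2 d : R, 0 < d & forall w : C, cmod w < d ->
    cmod (cexp w - 1 - w) <= e * cmod w.
  exists (cexp z) => e e0.
  have Ez := expR_gt0 (complex.Re z).
  have [d d0 hd] := h (e / expR (complex.Re z)) ltac:(by rewrite divr_gt0).
  exists d => // w /hd H.
  have -> : cexp w - cexp z - cexp z * (w - z) = cexp z * (cexp (w - z) - 1 - (w - z)).
    have Ew : cexp w = cexp z * cexp (w - z) by rewrite -cexpD addrC subrK.
    by rewrite Ew; ring.
  rewrite cmodM cmod_cexp (le_trans (ler_wpM2l (ltW Ez) H))//.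
  by rewrite mulrA [_ * (e / _)]mulrC divfK ?gt_eqF.
move=> e0; have [e1 [e10 e11 e18]] : exists e1 : R, [/\ 0 < e1, e1 <= 1 & e1 <= e / 16].
  exists (Num.min 1 (e / 16)).
  by rewrite lt_min ltr01 divr_gt0// !ge_min !lexx orbT.
have [d1 d10 h1] := is_derive_small (is_derive_expR 0) e10.
have [d2 d20 h2] := is_derive_small (is_derive_sin 0) e10.
have [d3 d30 h3] := is_derive_small (is_derive_cos 0) e10.
exists (Num.min (Num.min d1 d2) (Num.min d3 e1)); first by rewrite !lt_min d10 d20 d30 e10.
move=> w; rewrite !lt_min => /andP[/andP[wd1 wd2] /andP[wd3 we]].
have Rw := Re_le_cmod w; have Iw := Im_le_cmod w.
have := h1 _ (le_lt_trans Rw wd1); have := h2 _ (le_lt_trans Iw wd2).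
have := h3 _ (le_lt_trans Iw wd3).
rewrite expR0 cos0 sin0 oppr0 mul0r !mul1r ?subr0 ?addr0 => H3 H2 H1.
rewrite (le_trans (cmod_le_ReIm _))//.
move: Rw Iw H1 H2 H3 we; case: w wd1 wd2 wd3 => a b /= _ _ _.
set c := cmod _ => Rw Iw H1 H2 H3 we.
have c0 : 0 <= c := cmod_ge0 _.
have := cmod_ge0 (Complex a b); rewrite -/c => _.
rewrite !mul0r !subr0 ?addr0.
set E := expR a in H1 *; set Cb := cos b in H3 *; set Sb := sin b in H2 *.
have H1' : `|E - 1 - a| <= e1 * c by rewrite (le_trans H1)// ler_pM2l.
have H2' : `|Sb - b| <= e1 * c by rewrite (le_trans H2)// ler_pM2l.
have H3' : `|Cb - 1| <= e1 * c by rewrite (le_trans H3)// ler_pM2l.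
have Ea : `|E - 1| <= 2 * c.
  have := ler_normD (E - 1 - a) a; rewrite subrK.
  by move=> /le_trans; apply; nra.
have E3 : `|E| <= 3.
  have := ler_normD (E - 1) 1; rewrite subrK normr1.
  by move=> /le_trans; apply; lra.
have X1 : `|E * Cb - 1 - a| <= 4 * (e1 * c).
  have -> : E * Cb - 1 - a = (E - 1 - a) + E * (Cb - 1) by ring.
  rewrite (le_trans (ler_normD _ _))// normrM.
  have := ler_pM (normr_ge0 E) (normr_ge0 (Cb - 1)) E3 H3'; lra.
have X2 : `|E * Sb - b| <= 5 * (e1 * c).
  have -> : E * Sb - b = E * (Sb - b) + (E - 1) * b by ring.
  rewrite (le_trans (ler_normD _ _))// !normrM.
  have := ler_pM (normr_ge0 E) (normr_ge0 (Sb - b)) E3 H2'.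
  have := ler_pM (normr_ge0 (E - 1)) (normr_ge0 b) Ea Iw.
  have := ler_wpM2r c0 (ltW we).
  lra.
have X3 : 16 * (e1 * c) <= e * c by rewrite mulrA ler_wpM2r//; lra.
move: X1 X2 X3; set A := `|E * Cb - 1 - a|; set B := `|E * Sb - b|.
have := mulr_ge0 (ltW e10) c0; lra.
Qed.

End ComplexExp.

(** * Mean values over the unit circle *)

Section CircleMeans.
Variable R : realType.
Local Notation C := (complexes R).
Implicit Types (z w : C) (x e r : R) (m n : nat) (phi psi : C -> C).

(** The mean of phi over the 2^m-th roots of unity: it integrates the 2 i pi
    periodic function phi (exp z) along the segment from 0 to 2 i pi. *)
Definition cavg m phi : C := avg m (phi \o @cexp R) 0 (twopii R).

(** The mean value of phi over the unit circle, that is the contour integral of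
    phi(t) / (2 i pi t). *)
Definition is_mean phi L := forall e : R, 0 < e -> exists m0, forall m, (m0 <= m)%N ->
  cmod (cavg m phi - L) <= e.

Lemma ReD z w : complex.Re (z + w) = complex.Re z + complex.Re w.
Proof. by case: z; case: w. Qed.

Lemma avg_le_Re m (F G : C -> C) z q :
  (forall t : R, 0 <= t <= 1 ->
     cmod (F (z + t%:C * q)) <= complex.Re (G (z + t%:C * q))) ->
  cmod (avg m F z q) <= complex.Re (avg m G z q).
Proof.
elim: m z q => [|m IH] z q h /=.
  by have := h 0; rewrite rmorph0 mul0r addr0; apply; rewrite lexx ler01.
have Rh (a : C) : complex.Re (a / 2) = complex.Re a / 2.
  have -> : a / 2 = (2^-1)%:C * a by rewrite mulrC fmorphV rmorph_nat.
  by case: a => a b /=; rewrite mul0r subr0 mulrC.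
rewrite Rh cmod_half ler_pM2r ?invr_gt0 ?ltr0n// ReD (le_trans (cmodD _ _))// lerD// IH// => t /andP[t0 t1].
  have -> : t%:C * (q / 2) = (t / 2)%:C * q by rewrite rmorphM fmorphV rmorph_nat; field.
  by apply: h; apply/andP; split; lra.
have -> : z + q / 2 + t%:C * (q / 2) = z + ((1 + t) / 2)%:C * q.
  by rewrite rmorphM fmorphV rmorph_nat rmorphD rmorph1; field.
by apply: h; apply/andP; split; lra.
Qed.

(** Positivity of the mean: a domination by a real-valued function on the
    circle passes to the averages. *)
Lemma cavg_le_Re m phi psi : (forall t, cmod t = 1 -> cmod (phi t) <= complex.Re (psi t)) ->
  cmod (cavg m phi) <= complex.Re (cavg m psi).
Proof. by move=> h; apply: avg_le_Re => t _; rewrite /= add0r; apply: h; exact: cmod_cexp_circle. Qed.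

Lemma cavg_le m phi B : (forall t, cmod t = 1 -> cmod (phi t) <= B) ->
  cmod (cavg m phi) <= B.
Proof. by move=> h; apply: avg_le => t _; rewrite /= add0r; apply: h; exact: cmod_cexp_circle. Qed.

Lemma cavgZ m c phi : cavg m (fun t => c * phi t) = c * cavg m phi.
Proof. exact: avgZ. Qed.

Lemma cavgB m phi psi : cavg m (fun t => phi t - psi t) = cavg m phi - cavg m psi.
Proof. exact: avgB. Qed.

Lemma cavg_cst m c : cavg m (fun=> c) = c.
Proof. exact: avg_cst. Qed.

Lemma cavg_sum I (s : seq I) m (F : I -> C -> C) :
  cavg m (fun t => \sum_(i <- s) F i t) = \sum_(i <- s) cavg m (F i).
Proof.
elim: s => [|i s IH].
  by rewrite big_nil -[RHS](cavg_cst m 0); congr cavg; apply: funext => t; rewrite big_nil.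
rewrite big_cons -IH /cavg -avgD; congr avg; apply: funext => t /=.
by rewrite big_cons.
Qed.

Lemma cexpN z : cexp (- z) = (cexp z)^-1.
Proof.
apply: (mulfI (cexp_neq0 z)); rewrite mulfV ?cexp_neq0// -cexpD subrr.
exact: cexp0.
Qed.

Lemma cexpMn z n : cexp (z *+ n) = cexp z ^+ n.
Proof. by elim: n => [|n IH]; rewrite ?mulr0n ?cexp0 ?expr0// mulrS cexpD IH exprS. Qed.

Lemma cexp_pii : cexp (Complex 0 pi : C) = -1.
Proof.
apply/eqP; rewrite eq_complex /= expR0 cospi sinpi; rewrite !mul0r !mul1r ?subr0 ?addr0 ?oppr0 !eqxx//.
Qed.

Lemma twopiiE : twopii R = Complex 0 pi *+ 2 :> C.
Proof. by apply/eqP; rewrite eq_complex /= mulr2n addr0 !eqxx. Qed.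

(** A nontrivial character of the group of 2^m-th roots of unity has sum 0. In
    the induction either the two halves of the segment cancel, when n is odd,
    or n is halved. *)
Lemma avg_cexp0 m n c q : (0 < n < 2 ^ m)%N -> (c * q = twopii R *+ n \/ c * q = - (twopii R *+ n)) ->
  avg m (fun z => cexp (c * z)) 0 q = 0.
Proof.
elim: m n q => [|m IH] n q; first by rewrite expn0; case: n => [|[|n]].
move=> /andP[n0 nm] hq.
have E w q' : avg m (fun z => cexp (c * z)) (0 + w) q' =
    cexp (c * w) * avg m (fun z => cexp (c * z)) 0 q'.
  rewrite avg_shift -avgZ; congr avg; apply: funext => z.
  by rewrite mulrDr cexpD mulrC.
rewrite /= E.
have -> (a b : C) : (a + b * a) / 2 = a * (1 + b) / 2 by ring.
have [no|ne] := boolP (odd n).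
  suff -> : cexp (c * (q / 2)) = -1 by rewrite subrr mulr0 mul0r.
  have hz : c * (q / 2) = Complex 0 pi *+ n \/ c * (q / 2) = - (Complex 0 pi *+ n).
    rewrite mulrA; case: hq => ->; [left|right]; rewrite twopiiE -mulrnA mulnC mulrnA -[_ *+ n *+ 2]mulr_natr.
      by rewrite mulfK// pnatr_eq0.
    by rewrite mulNr mulfK// pnatr_eq0.
  by case: hz => ->; rewrite ?cexpN cexpMn cexp_pii -signr_odd no expr1 ?invrN1.
rewrite (IH n./2); first by rewrite !mul0r.
  rewrite half_gt0; move: nm; rewrite expnS => nm; apply/andP; split; last by lia.
  by case: n n0 ne {nm hq} => [|[|n]].
have n2 : n = (n./2 * 2)%N by rewrite muln2 even_halfK.
rewrite mulrA; case: hq => ->; [left|right]; rewrite [in LHS]n2 mulrnA -[_ *+ _ *+ 2]mulr_natr.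
  by rewrite mulfK// pnatr_eq0.
by rewrite mulNr mulfK// pnatr_eq0.
Qed.

(** Orthogonality of the characters of the group of 2^m-th roots of unity. *)
Lemma cavg_monomial m j l : (j < 2 ^ m)%N -> (l < 2 ^ m)%N ->
  cavg m (fun t => t ^+ j * t^-1 ^+ l) = (j == l)%:R.
Proof.
move=> jm lm; rewrite /cavg.
have [->|jl] := eqVneq j l.
  rewrite -[RHS](avg_cst m 1 0 (twopii R)); congr avg; apply: funext => z /=.
  by rewrite -exprMn mulfV ?cexp_neq0// expr1n.
have [lj|jl'] := ltnP l j.
  rewrite -[RHS](@avg_cexp0 m (j - l) (j - l)%:R (twopii R)).
  - congr avg; apply: funext => z /=; rewrite mulr_natl cexpMn exprVn.
    by rewrite -{1}(subnK (ltnW lj)) exprD mulfK// expf_neq0// cexp_neq0.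
  - by rewrite subn_gt0 lj (leq_ltn_trans (leq_subr _ _)).
  - by left; rewrite mulr_natl.
have {jl jl'}jl : (j < l)%N by rewrite ltn_neqAle jl.
rewrite -[RHS](@avg_cexp0 m (l - j) (- (l - j)%:R) (twopii R)).
- congr avg; apply: funext => z /=; rewrite mulNr cexpN mulr_natl cexpMn exprVn.
  rewrite -{1}(subnK (ltnW jl)) exprD invfM mulrCA mulrA mulfK ?expf_neq0 ?cexp_neq0//.
- by rewrite subn_gt0 jl (leq_ltn_trans (leq_subr _ _)).
- by right; rewrite mulNr mulr_natl.
Qed.

Lemma is_mean_unique phi L L' : is_mean phi L -> is_mean phi L' -> L = L'.
Proof.
move=> h h'; apply/eqP; rewrite -subr_eq0 -cmod_eq0; apply/eqP/le_anti.
rewrite cmod_ge0 andbT; apply/ler_addgt0Pr => e e0; rewrite add0r.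
have [m1 h1] := h (e / 2) ltac:(by rewrite divr_gt0).
have [m2 h2] := h' (e / 2) ltac:(by rewrite divr_gt0).
have := h1 (m1 + m2)%N (leq_addr _ _); have := h2 (m1 + m2)%N (leq_addl _ _).
set a := cavg _ _ => H2 H1.
have -> : L - L' = (a - L') - (a - L) by ring.
rewrite (le_trans (cmodB _ _))//; lra.
Qed.

Lemma is_mean_ext phi psi L : (forall t, cmod t = 1 -> phi t = psi t) ->
  is_mean phi L -> is_mean psi L.
Proof.
move=> h hL e /hL[m0 H]; exists m0 => m /H.
suff -> : cavg m phi = cavg m psi by [].
apply/eqP; rewrite -subr_eq0 -cavgB -cmod_eq0 eq_le cmod_ge0 andbT.
by apply: cavg_le => t /h ->; rewrite subrr cmod0.
Qed.

Lemma is_mean_cst c : is_mean (fun=> c) c.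
Proof. by move=> e e0; exists 0%N => m _; rewrite cavg_cst subrr cmod0 ltW. Qed.

Lemma is_meanZ c phi L : is_mean phi L -> is_mean (fun t => c * phi t) (c * L).
Proof.
move=> h e e0; have K0 : 0 < cmod c + 1 by rewrite ltr_wpDl ?cmod_ge0.
have [m0 H] := h (e / (cmod c + 1)) ltac:(by rewrite divr_gt0).
exists m0 => m /H; rewrite cavgZ -mulrBr cmodM ler_pdivlMr// => h1.
rewrite (le_trans _ h1)// mulrC ler_wpM2l ?cmod_ge0// lerDl ler01//.
Qed.

Lemma is_mean_le phi L B : is_mean phi L -> (forall t, cmod t = 1 -> cmod (phi t) <= B) ->
  cmod L <= B.
Proof.
move=> h hB; apply/ler_addgt0Pr => e /h[m0 /(_ m0 (leqnn _))].
have := cavg_le m0 hB; set a := cavg _ _ => H1; rewrite cmodBC => H2.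
rewrite -(subrK a L) (le_trans (cmodD _ _))//; lra.
Qed.

Lemma cdiff_comp phi psi z : cdiff psi z -> cdiff phi (psi z) -> cdiff (phi \o psi) z.
Proof.
move=> /derivable_cdiff/derivable1_diffP d1 /derivable_cdiff/derivable1_diffP d2.
by apply/derivable_cdiff/derivable1_diffP; exact: (differentiable_comp d1 d2).
Qed.

(** Cauchy's theorem for an annulus. In the coordinate z with t = exp z, the
    circles of radii 1 and |s| become two opposite sides of a parallelogram
    with sides l and 2 i pi, where s = exp l; the two other sides cancel by
    periodicity, and Goursat's lemma applies to the boundary. *)
Lemma mean_dilate phi L s : (forall t, t != 0 -> cdiff phi t) -> s != 0 ->
  is_mean phi L -> is_mean (fun t => phi (s * t)) L.
Proof.
move=> dphi /cexp_onto[l <-] h.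
pose F := phi \o @cexp R.
have dF z : cdiff F z.
  by apply: cdiff_comp; [exact: cdiff_cexp|apply: dphi; exact: cexp_neq0].
have q0 : 0 < cmod (twopii R).
  rewrite cmod_gt0 eq_complex /= negb_and; apply/orP; right.
  by rewrite gt_eqF// mulr2n addr_gt0// pi_gt0.
move=> e e0.
have [m1 h1] := h (e / 2) ltac:(by rewrite divr_gt0).
have [m2 h2] := @goursat _ F 0 l (twopii R) (cmod (twopii R) * (e / 2)) dF
  ltac:(by rewrite mulr_gt0// divr_gt0).
exists (m1 + m2)%N => m mm.
have {}h1 := h1 m ltac:(lia); have := h2 m ltac:(lia).
have E : bsum m F 0 l (twopii R) = twopii R * (cavg m (fun t => phi (cexp l * t)) - cavg m phi).
  rewrite /bsum !add0r.
  have -> : avg m F (twopii R) l = avg m F 0 l.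
    rewrite -[X in avg m F X l]add0r avg_shift; congr avg.
    by apply: funext => z; rewrite /F /= cexp_period.
  have -> : avg m F l (twopii R) = cavg m (fun t => phi (cexp l * t)).
    rewrite -[X in avg m F X _]add0r avg_shift; congr avg.
    by apply: funext => z; rewrite /F /= cexpD mulrC.
  by rewrite /cavg -/F; ring.
rewrite E cmodM ler_pM2l// => H.
have E2 (a b : C) : a - L = (a - b) + (b - L) by ring.
rewrite (E2 _ (cavg m phi)) (le_trans (cmodD _ _))// (splitr e) lerD//; exact: H.
Qed.

(** Explicit modulus of continuity on the circle: the oscillation at scale d is
    at most e. Stating estimates through it makes them uniform over families of
    functions. *)
Definition cmodulus phi (d e : R) := forall t t', cmod t = 1 -> cmod t' = 1 ->
  cmod (t - t') < d -> cmod (phi t - phi t') <= e.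

Lemma circle_mesh (d : R) : 0 < d -> exists m0, forall m, (m0 <= m)%N ->
  forall s t : R, `|s - t| <= 2 ^- m ->
    cmod (cexp (s%:C * twopii R) - cexp (t%:C * twopii R)) < d.
Proof.
move=> d0.
have [d1 d10 h1] := cdiff_cont (cdiff_cexp (0 : C)) (divr_gt0 d0 (ltr0n R 2)).
have [m0 hm0] := @exp2R_small R (cmod (twopii R)) d1 d10.
exists m0 => m mm s t st.
have -> : s%:C * twopii R = (s - t)%:C * twopii R + t%:C * twopii R.
  by rewrite rmorphB /=; ring.
rewrite cexpD -{2}[cexp (t%:C * _)]mul1r -mulrBl cmodM cmod_cexp_circle mulr1.
rewrite (@le_lt_trans _ _ (d / 2))//; last by rewrite gtr_pMr// invf_lt1// ltr1n.
rewrite -cexp0; apply: h1; rewrite subr0 cmodM cmod_real mulrC.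
rewrite (le_lt_trans _ hm0)// ler_wpM2l ?cmod_ge0// (le_trans st)//.
by rewrite lef_pV2 ?posrE ?exprn_gt0// ler_eXn2l// ltr1n.
Qed.

Lemma cavg_cauchy (d : R) : 0 < d -> exists m0, forall phi e, cmodulus phi d e ->
  forall m k, (m0 <= m)%N -> cmod (cavg (m + k) phi - cavg m phi) <= e.
Proof.
move=> /circle_mesh[m0 h]; exists m0 => phi e hphi m k mm.
apply: avg_cvg => s t s01 t01 st; rewrite /= !add0r; apply: hphi.
- exact: cmod_cexp_circle.
- exact: cmod_cexp_circle.
- exact: h _ mm _ _ st.
Qed.

(** The number of nodes needed to compute a mean up to e depends only on a
    modulus of continuity of phi. *)
Lemma cavg_mean (d : R) : 0 < d -> exists m0, forall phi e L, cmodulus phi d e ->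
  is_mean phi L -> forall m, (m0 <= m)%N -> cmod (cavg m phi - L) <= e.
Proof.
move=> /cavg_cauchy[m0 h]; exists m0 => phi e L hphi hL m mm.
apply/ler_addgt0Pr => e' e'0; have [m1 h1] := hL e' e'0.
have := h _ _ hphi m m1 mm; have := h1 (m + m1)%N (leq_addl _ _).
set a := cavg (_ + _) _; set b := cavg _ _ => H1; rewrite cmodBC => H2.
have -> : b - L = (b - a) + (a - L) by ring.
rewrite (le_trans (cmodD _ _))//; lra.
Qed.

Definition circle_continuous phi := forall e : R, 0 < e ->
  exists2 d : R, 0 < d & cmodulus phi d e.

Lemma mean_exists phi : circle_continuous phi -> exists L, is_mean phi L.
Proof.
move=> h; have [L hL] : exists L : C, forall e : R, 0 < e -> exists n0, forall n, (n0 <= n)%N ->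
    cmod (cavg n phi - L) <= e.
  apply: cauchy_cvgC => e e0.
  have [d d0 hd] := h (e / 2) ltac:(by rewrite divr_gt0).
  have [m0 hm] := cavg_cauchy d0.
  exists m0 => n m nn nm.
  have := hm _ _ hd m0 (n - m0)%N (leqnn _); have := hm _ _ hd m0 (m - m0)%N (leqnn _).
  rewrite !subnKC//; set a := cavg m _; set b := cavg n _; set c := cavg _ _ => h1 h2.
  have -> : b - a = (b - c) - (a - c) by ring.
  rewrite (le_trans (cmodB _ _))//; lra.
by exists L.
Qed.

Lemma cdiff_uniform phi r e : (forall t, cdiff phi t) -> 0 < e -> exists2 d : R, 0 < d &
  forall s t, cmod s <= r -> cmod t <= r -> cmod (s - t) < d -> cmod (phi s - phi t) <= e.
Proof.
move=> dphi e0; pose f (v : 'rV[C]_3) := phi (v 0 0).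
have cf : econt_on setT f.
  move=> p _ e' e'0; have [d d0 hd] := cdiff_cont (dphi (p 0 0)) e'0.
  exists d => // v _ vp; apply: hd; rewrite (le_lt_trans _ vp)//.
  by have := cmod_le_vmod (v - p) 0; rewrite !mxE.
have vc z : vmod (const_mx z : 'rV[C]_3) <= cmod z.
  by apply/le_vmodP => [|i]; rewrite ?cmod_ge0 ?mxE.
have [d d0 hd] := @heine_cantor _ setT f r e (@closedT _) cf e0.
exists d => // s t sr tr st.
have := hd (const_mx s) (const_mx t) I I (le_trans (vc _) sr) (le_trans (vc _) tr).
rewrite /f !mxE; apply; rewrite (le_lt_trans _ st)//.
have -> : const_mx s - const_mx t = const_mx (s - t) :> 'rV[C]_3.
  by apply/rowP => i; rewrite !mxE.
exact: vc.
Qed.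

(** The mean value property: by dilation invariance the mean over the unit
    circle is the mean over an arbitrarily small circle, where psi is close to
    psi 0. *)
Lemma mean_entire psi : (forall t, cdiff psi t) -> is_mean psi (psi 0).
Proof.
move=> dpsi.
have [L hL] : exists L, is_mean psi L.
  apply: mean_exists => e e0; have [d d0 hd] := cdiff_uniform 1 dpsi e0.
  by exists d => // t t' t1 t'1; apply: hd; rewrite ?t1 ?t'1.
suff -> : psi 0 = L by [].
apply/eqP; rewrite -subr_eq0 -cmod_eq0 eq_le cmod_ge0 andbT.
apply/ler_addgt0Pr => e e0; rewrite add0r.
have [d d0 hd] := cdiff_cont (dpsi 0) e0.
pose s : C := (d / 2)%:C.
have s0 : s != 0 by rewrite -cmod_gt0 cmod_real normr_gt0 gt_eqF// divr_gt0.
have hs := mean_dilate (fun t _ => dpsi t) s0 hL.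
rewrite cmodBC; have := @is_mean_le (fun t => 1 * (psi (s * t) - psi 0)) (L - psi 0) e.
apply => [|t t1].
  move=> e' /hs[m0 H]; exists m0 => m /H.
  rewrite cavgZ cavgB cavg_cst mul1r.
  by have -> (a : C) : a - psi 0 - (L - psi 0) = a - L by ring.
rewrite mul1r; apply: hd; rewrite subr0 cmodM t1 mulr1 cmod_real gtr0_norm ?divr_gt0//.
by rewrite gtr_pMr// invf_lt1// ltr1n.
Qed.

End CircleMeans.

(** * Fejer summation and entire functions *)

Section Fejer.
Variable R : realType.
Local Notation C := (complexes R).
Implicit Types (z w : C) (e r : R) (m n : nat) (phi psi : C -> C).

(** Reversing a segment replaces left tags by right tags. *)
Lemma avg_reverse m (F : C -> C) z q :
  avg m F (z + q) (- q) = avg m F z q + (F (z + q) - F z) / 2 ^+ m.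
Proof.
elim: m z q => [|m IH] z q /=; first by rewrite expr0 divr1 [RHS]addrC subrK.
have -> : z + q + - q / 2 = z + q / 2 by field.
have e1 : z + q = z + q / 2 + q / 2 by field.
rewrite mulNr IH {1}e1 IH -e1 exprS.
have h2 : (2 : C) ^+ m != 0 by rewrite expf_neq0// pnatr_eq0.
by field.
Qed.

Lemma cavg_inv m phi : cavg m (fun t => phi t^-1) = cavg m phi.
Proof.
have E z q : avg m (phi \o @cexp R) (- z) (- q) = avg m (fun w => phi (cexp w)^-1) z q.
  elim: m z q => [|m IH] z q /=; first by rewrite cexpN.
  by rewrite -!IH opprD !mulNr.
rewrite /cavg -E oppr0.
have := avg_reverse m (phi \o @cexp R) (- twopii R) (twopii R).
rewrite addNr => ->.
rewrite /= -[cexp (- _)]cexp_period addNr subrr mul0r addr0.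
rewrite -[X in avg m _ X _]add0r avg_shift; congr avg; apply: funext => w /=.
by rewrite -[cexp (w - _)]cexp_period subrK.
Qed.

(** The inversion t -> 1/t permutes the roots of unity. *)
Lemma mean_inv phi L : is_mean phi L -> is_mean (fun t => phi t^-1) L.
Proof. by move=> h e /h[m0 H]; exists m0 => m /H; rewrite cavg_inv. Qed.

Lemma is_meanB phi psi L L' : is_mean phi L -> is_mean psi L' ->
  is_mean (fun t => phi t - psi t) (L - L').
Proof.
move=> h h' e e0.
have [m1 h1] := h (e / 2) ltac:(by rewrite divr_gt0).
have [m2 h2] := h' (e / 2) ltac:(by rewrite divr_gt0).
exists (m1 + m2)%N => m mm; have {}h1 := h1 m ltac:(lia); have {}h2 := h2 m ltac:(lia).
have E (a b c d : C) : a - b - (c - d) = (a - c) - (b - d) by ring.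
rewrite cavgB E (le_trans (cmodB _ _))// (splitr e) lerD//.
Qed.

Lemma is_mean_sum I (s : seq I) (P : pred I) (F : I -> C -> C) (L : I -> C) :
  (forall i, P i -> is_mean (F i) (L i)) ->
  is_mean (fun t => \sum_(i <- s | P i) F i t) (\sum_(i <- s | P i) L i).
Proof.
move=> h; elim: s => [|i s IH].
  rewrite big_nil; apply: is_mean_ext (is_mean_cst 0) => t _; by rewrite big_nil.
rewrite big_cons; case: ifP => Pi; last first.
  by apply: is_mean_ext IH => t _; rewrite big_cons Pi.
have h1 := is_meanB (h i Pi) (is_meanB (is_mean_cst 0) IH).
rewrite sub0r opprK in h1; apply: is_mean_ext h1 => t _.
by rewrite big_cons Pi sub0r opprK.
Qed.

Lemma is_mean_le_eventually phi L B : is_mean phi L ->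
  (exists m0, forall m, (m0 <= m)%N -> cmod (cavg m phi) <= B) -> cmod L <= B.
Proof.
move=> h [m1 hB]; apply/ler_addgt0Pr => e /h[m0 /(_ (m0 + m1)%N (leq_addr _ _))].
have := hB (m0 + m1)%N (leq_addl _ _); set a := cavg _ _ => H1; rewrite cmodBC => H2.
rewrite -(subrK a L) (le_trans (cmodD _ _))//; lra.
Qed.

(** A family of functions on the circle, indexed by the x satisfying P, that is
    uniformly bounded and equicontinuous: the setting in which Fejer sums
    converge uniformly in x. *)
Definition ufam X (P : X -> Prop) (Phi : X -> C -> C) :=
  (exists2 B : R, 0 < B & forall x, P x -> forall t, cmod t = 1 -> cmod (Phi x t) <= B) /\
  (forall e : R, 0 < e -> exists2 d : R, 0 < d & forall x, P x -> cmodulus (Phi x) d e).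

Lemma ufamM X (P : X -> Prop) Phi Psi : ufam P Phi -> ufam P Psi ->
  ufam P (fun x t => Phi x t * Psi x t).
Proof.
move=> [[B B0 hB] h] [[B' B'0 hB'] h']; split.
  exists (B * B'); first by rewrite mulr_gt0.
  by move=> x Px t t1; rewrite cmodM ler_pM ?cmod_ge0 ?hB ?hB'.
move=> e e0.
have [d d0 hd] := h (e / (2 * B')) ltac:(by rewrite divr_gt0// mulr_gt0).
have [d' d'0 hd'] := h' (e / (2 * B)) ltac:(by rewrite divr_gt0// mulr_gt0).
exists (Num.min d d'); first by rewrite lt_min d0.
move=> x Px t t' t1 t'1; rewrite lt_min => /andP[h1 h2].
have {}h1 := hd x Px t t' t1 t'1 h1; have {}h2 := hd' x Px t t' t1 t'1 h2.
have E (x1 x2 x3 x4 : C) : x1 * x2 - x3 * x4 = (x1 - x3) * x2 + x3 * (x2 - x4) by ring.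
rewrite E (le_trans (cmodD _ _))// !cmodM (splitr e) lerD//.
  apply: le_trans (ler_pM (cmod_ge0 _) (cmod_ge0 _) h1 (hB' x Px t t1)) _.
  by rewrite (_ : e / (2 * B') * B' = e / 2)//; field; rewrite gt_eqF.
apply: le_trans (ler_pM (cmod_ge0 _) (cmod_ge0 _) (hB x Px t' t'1) h2) _.
by rewrite (_ : B * (e / (2 * B)) = e / 2)//; field; rewrite gt_eqF.
Qed.

Lemma ufamX X (P : X -> Prop) Phi n : ufam P Phi -> ufam P (fun x t => Phi x t ^+ n).
Proof.
move=> h; elim: n => [|n IH].
  split; first by exists 1 => // x _ t _; rewrite expr0 cmod1.
  by move=> e e0; exists 1 => // x _ t t' _ _ _; rewrite !expr0 subrr cmod0 ltW.
have -> : (fun x t => Phi x t ^+ n.+1) = (fun x t => Phi x t * Phi x t ^+ n).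
  by apply: funext => x; apply: funext => t; rewrite exprS.
exact: ufamM.
Qed.

Lemma cmod_invB (t t' : C) : cmod t = 1 -> cmod t' = 1 -> cmod (t^-1 - t'^-1) = cmod (t - t').
Proof.
move=> t1 t'1.
have t0 : t != 0 by rewrite -cmod_gt0 t1.
have t'0 : t' != 0 by rewrite -cmod_gt0 t'1.
have -> : t^-1 - t'^-1 = (t' - t) * (t^-1 * t'^-1) by field; rewrite t0 t'0.
by rewrite !cmodM !cmodV t1 t'1 invr1 !mulr1 cmodBC.
Qed.

Lemma ufam_inv X (P : X -> Prop) : ufam P (fun _ t => t^-1).
Proof.
split; first by exists 1 => // x _ t t1; rewrite cmodV t1 invr1.
by move=> e e0; exists e => // x _ t t' t1 t'1 /ltW; rewrite cmod_invB.
Qed.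

Lemma ufam_mean X (P : X -> Prop) Phi x : ufam P Phi -> P x -> exists L, is_mean (Phi x) L.
Proof.
move=> [_ h] Px; apply: mean_exists => e /h[d d0 hd]; exists d => //; exact: hd.
Qed.

Definition dirichlet N (t : C) := \sum_(j < N) t ^+ j.
Definition fejer_kernel N (t : C) : C :=
  N%:R^-1 * (dirichlet N t * dirichlet N t^-1).

Lemma fejer_kernelE N (t : C) : cmod t = 1 ->
  fejer_kernel N t = (N%:R^-1 * cmod (dirichlet N t) ^+ 2)%:C.
Proof.
move=> t1; rewrite /fejer_kernel rmorphM fmorphV rmorph_nat; congr (_ * _).
have -> : dirichlet N t^-1 = (dirichlet N t)^*%C.
  rewrite /dirichlet rmorph_sum; apply: eq_bigr => j _; rewrite rmorphXn /=.
  congr (_ ^+ _); rewrite invc_norm cmodE t1 rmorph1 expr1n invr1 mul1r.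
  by [].
by rewrite -sqr_normc cmodE rmorphXn.
Qed.

Lemma cavg_fejer m N : (0 < N)%N -> (N <= 2 ^ m)%N -> cavg m (fejer_kernel N) = 1.
Proof.
move=> N0 Nm; rewrite cavgZ.
have -> : (fun t : C => dirichlet N t * dirichlet N t^-1) =
    (fun t => \sum_(p : 'I_N * 'I_N) t ^+ p.1 * t^-1 ^+ p.2).
  apply: funext => t; rewrite /dirichlet mulr_suml.
  under eq_bigr do rewrite mulr_sumr.
  by rewrite pair_bigA.
rewrite cavg_sum -[X in X * _ = _]invrK.
under eq_bigr => p _ do rewrite cavg_monomial ?(leq_trans (ltn_ord _) Nm)//.
rewrite -(pair_bigA _ (fun (i j : 'I_N) => (i == j :> nat)%:R)) /=.
under eq_bigr => i _.
  rewrite (bigD1 i)//= eqxx big1 ?addr0; last by move=> j /negPf ji; rewrite eq_sym (_ : (j == i :> nat) = false).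
  over.
by rewrite sumr_const card_ord invrK mulVf// pnatr_eq0 -lt0n.
Qed.

(** Fejer's theorem, uniformly over a family: the Cesaro means of the Fourier
    series at t = 1 are the averages of Phi x against a nonnegative kernel of
    mean 1, which is at most 4 / (N d^2) at distance d from 1. *)
Lemma fejer X (P : X -> Prop) Phi (e : R) : ufam P Phi -> 0 < e ->
  exists N, forall x, P x -> forall L : nat -> nat -> C,
    (forall j l, is_mean (fun t => Phi x t * (t ^+ j * t^-1 ^+ l)) (L j l)) ->
    cmod (Phi x 1 - N%:R^-1 * \sum_(j < N) \sum_(l < N) L j l) <= e.
Proof.
move=> [[B B0 hB] h] e0.
have [d d0 hd] := h (e / 2) ltac:(by rewrite divr_gt0).
(* Far from 1 the difference is at most 2 B and the kernel at most 4 / (N d^2);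
   this N makes the product at most e / 2. *)
pose N := (Num.bound (16 * B / (e * d ^+ 2))).+1.
have N0 : (0 < N)%N by [].
have NR : 0 < N%:R :> R by rewrite ltr0n.
have d2 : 0 < d ^+ 2 by rewrite exprn_gt0.
have hN : 2 * B * (N%:R^-1 * (4 / d ^+ 2)) <= e / 2.
  have := archi_boundP (x := 16 * B / (e * d ^+ 2))
    ltac:(by rewrite ltW// divr_gt0 ?mulr_gt0).
  rewrite ltr_pdivrMr ?mulr_gt0// => hb.
  have hb2 : 16 * B <= N%:R * (e * d ^+ 2).
    rewrite (le_trans (ltW hb))// ler_pM2r ?mulr_gt0// ler_nat.
    exact: leqnSn.
  have -> : 2 * B * (N%:R^-1 * (4 / d ^+ 2)) = 8 * B / (N%:R * d ^+ 2).
    by field; rewrite !gt_eqF.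
  rewrite ler_pdivrMr ?mulr_gt0//.
  have -> : e / 2 * (N%:R * d ^+ 2) = N%:R * (e * d ^+ 2) / 2 by field.
  lra.
exists N => x Px L hL.
have := is_meanZ N%:R^-1 (is_mean_sum (index_enum _) (P := predT)
  (fun (j : 'I_N) _ => is_mean_sum (index_enum _) (P := predT)
  (fun (l : 'I_N) _ => hL j l))).
move=> /(is_meanB (is_mean_cst (Phi x 1))) /is_mean_le_eventually; apply.
exists N => m Nm.
have {}Nm : (N <= 2 ^ m)%N by rewrite (leq_trans Nm)// ltnW// ltn_expl.
have -> : cavg m (fun t : C => Phi x 1 - N%:R^-1 *
      (\sum_(j < N) \sum_(l < N) Phi x t * (t ^+ j * t^-1 ^+ l))) =
    cavg m (fun t => (Phi x 1 - Phi x t) * fejer_kernel N t).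
  have -> : (fun t : C => (Phi x 1 - Phi x t) * fejer_kernel N t) =
      (fun t => Phi x 1 * fejer_kernel N t - Phi x t * fejer_kernel N t).
    by apply: funext => t; rewrite mulrBl.
  rewrite !cavgB cavgZ cavg_fejer// mulr1 cavg_cst; congr (_ - cavg _ _).
  apply: funext => t; rewrite /fejer_kernel mulrCA; congr (_ * _).
  rewrite /dirichlet mulr_suml mulr_sumr; apply: eq_bigr => j _.
  by rewrite !mulr_sumr; apply: eq_bigr => l _.
have -> : e = complex.Re (cavg m (fun t => (e / 2)%:C * fejer_kernel N t - (- (e / 2))%:C)).
  by rewrite cavgB cavgZ cavg_fejer// cavg_cst mulr1 /= opprK -splitr.
apply: cavg_le_Re => t t1; rewrite fejer_kernelE// -rmorphM -rmorphB /= opprK.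
rewrite cmodM cmod_real.
have K0 : 0 <= N%:R^-1 * cmod (dirichlet N t) ^+ 2.
  by rewrite mulr_ge0 ?sqr_ge0 ?invr_ge0 ?ler0n.
rewrite ger0_norm//.
have [td|td] := ltP (cmod (1 - t)) d.
  have := hd x Px 1 t (cmod1 R) t1 td => h1.
  rewrite (le_trans (ler_wpM2r K0 h1))// lerDl ltW// divr_gt0//.
have D2 : cmod (dirichlet N t) * d <= 2.
  rewrite (le_trans (ler_wpM2l (cmod_ge0 _) td))// cmodBC -cmodM mulrC -subrX1.
  by rewrite (le_trans (cmodB _ _))// cmodX t1 expr1n cmod1.
have D4 : cmod (dirichlet N t) ^+ 2 <= 4 / d ^+ 2.
  rewrite ler_pdivlMr// -exprMn (_ : 4 = 2 ^+ 2 :> R); last by rewrite -natrX.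
  by rewrite ler_pXn2r ?nnegrE ?mulr_ge0 ?cmod_ge0// ltW.
have h2 : cmod (Phi x 1 - Phi x t) <= 2 * B.
  by rewrite (le_trans (cmodB _ _))// mulr_natl mulr2n lerD// hB// cmod1.
have K1 : N%:R^-1 * cmod (dirichlet N t) ^+ 2 <= N%:R^-1 * (4 / d ^+ 2).
  by rewrite ler_pM2l// invr_gt0.
rewrite (le_trans (ler_pM (cmod_ge0 _) K0 h2 K1))// (le_trans hN)// lerDr mulr_ge0//.
by rewrite ltW// divr_gt0.
Qed.

Lemma ufam_entire (h : C -> C) r : (forall t, cdiff h t) ->
  ufam (fun z => cmod z <= r) (fun z t => h (z * t)).
Proof.
move=> dh; split.
  have cf : econt_on setT (fun v : 'rV[C]_3 => h (v 0 0)).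
    move=> p _ e' e'0; have [d' d'0 hd'] := cdiff_cont (dh (p 0 0)) e'0.
    exists d' => // v _ vp; apply: hd'; rewrite (le_lt_trans _ vp)//.
    by have := cmod_le_vmod (v - p) 0; rewrite !mxE.
  have [B B0 hB] := @bounded_on_vball R setT _ r (@closedT _) cf.
  exists B => // z zr t t1.
  have := hB (const_mx (z * t)) I; rewrite mxE; apply.
  apply/le_vmodP => [|i]; first by rewrite (le_trans _ zr)// cmod_ge0.
  by rewrite mxE cmodM t1 mulr1.
move=> e' e'0; have [d d0 hd] := cdiff_uniform r dh e'0.
have K0 : 0 < `|r| + 1 by rewrite ltr_wpDl.
exists (d / (`|r| + 1)); first by rewrite divr_gt0.
move=> z zr t t' t1 t'1; rewrite ltr_pdivlMr// => tt'.
apply: hd; rewrite ?cmodM ?t1 ?t'1 ?mulr1//.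
rewrite -mulrBr cmodM mulrC (le_lt_trans _ tt')// ler_wpM2l ?cmod_ge0//.
by rewrite (le_trans zr)// (le_trans (ler_norm _))// lerDl.
Qed.

Lemma mulf_invX (t : C) j l : t != 0 ->
  t ^+ j * t^-1 ^+ l = if (l <= j)%N then t ^+ (j - l) else t^-1 ^+ (l - j).
Proof.
move=> t0; case: leqP => lj; rewrite !exprVn.
  by rewrite -{1}(subnK lj) exprD mulfK// expf_neq0.
by rewrite -{1}(subnK (ltnW lj)) exprD invfM mulrCA mulfV ?expf_neq0// mulr1.
Qed.

Lemma cmod1_neq0 (t : C) : cmod t = 1 -> t != 0.
Proof. by move=> t1; rewrite -cmod_gt0 t1. Qed.

(** For fixed z, the function t -> h (z t) has Fourier coefficients d_n z^n for
    n >= 0, by dilation, and 0 for n < 0, by the mean value property: the Fejer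
    sums of h (z t) at t = 1 are polynomials in z. *)
Lemma entire_poly (h : C -> C) r e : (forall t, cdiff h t) -> 0 < e ->
  exists p : {poly C}, forall z, cmod z <= r -> cmod (h z - p.[z]) <= e.
Proof.
move=> dh e0.
have [N hN] := fejer (ufam_entire r dh) e0.
have /choice[dn hdn] : forall n, exists L, is_mean (fun t => h t * t^-1 ^+ n) L.
  move=> n.
  have u1 : ufam (fun z => cmod z <= 1) (fun z t => h (z * t) * t^-1 ^+ n).
    by apply: ufamM; [exact: ufam_entire|apply: ufamX; exact: ufam_inv].
  have [|L hL] := ufam_mean (x := 1) u1; first by rewrite cmod1.
  by exists L; apply: is_mean_ext hL => t _; rewrite mul1r.
pose c j l : {poly C} := if (l <= j)%N then ((j == l)%:R * h 0)%:P
  else (dn (l - j)%N) *: 'X^(l - j).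
exists (N%:R^-1 *: \sum_(j < N) \sum_(l < N) c j l) => z zr.
have := hN z zr (fun j l => (c j l).[z]); rewrite mulr1 hornerZ horner_sum.
under eq_bigr do rewrite -horner_sum.
rewrite -horner_sum; apply => j l; rewrite /c.
have E := mulf_invX j l.
have dz t : cdiff (fun t => h (z * t)) t.
  have := cdiff_comp (phi := h) (cdiffM (cdiff_cst z t) (cdiff_id t)); apply; exact: dh.
case: leqP => lj.
  have : is_mean (fun t => h (z * t) * t ^+ (j - l)) ((j == l)%:R * h 0).
    have -> : (j == l)%:R * h 0 = h (z * 0) * 0 ^+ (j - l).
      by rewrite mulr0 expr0n subn_eq0 mulrC eqn_leq lj andbT.
    apply: (@mean_entire R (fun t => h (z * t) * t ^+ (j - l))) => t.
    by apply: cdiffM => //; apply: cdiffX; exact: cdiff_id.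
  rewrite hornerC; apply: is_mean_ext => t /cmod1_neq0 /E ->.
  by rewrite lj.
rewrite hornerZ hornerXn; set n := (l - j)%N.
have n0 : (0 < n)%N by rewrite subn_gt0.
have : is_mean (fun t => h (z * t) * t^-1 ^+ n) (dn n * z ^+ n).
  have [->|z0] := eqVneq z 0.
    rewrite expr0n gtn_eqF// mulr0.
    have : is_mean (fun t => t ^+ n) ((0 : C) ^+ n).
      by apply: (@mean_entire R (fun t => t ^+ n)) => t; apply: cdiffX; exact: cdiff_id.
    rewrite expr0n gtn_eqF// => /mean_inv/(is_meanZ (h 0)); rewrite mulr0.
    by apply: is_mean_ext => t _; rewrite mul0r.
  have := mean_dilate (phi := fun t => h t * t^-1 ^+ n) _ z0 (hdn n).
  have dphi t : t != 0 -> cdiff (fun t => h t * t^-1 ^+ n) t.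
    by move=> t0; apply: cdiffM => //; apply: cdiffX; apply: cdiffV => //; exact: cdiff_id.
  move=> /(_ dphi) /(is_meanZ (z ^+ n)); rewrite mulrC; apply: is_mean_ext => t t1.
  by rewrite invfM exprMn mulrCA !exprVn mulVKf ?expf_neq0.
apply: is_mean_ext => t /cmod1_neq0 /E ->.
by rewrite leqNgt lj.
Qed.

End Fejer.

(** * Continuity and polynomial approximation on subsets of C^3 *)

Section Continuity.
Variable R : realType.
Local Notation C := (complexes R).
Implicit Types (z w : C) (e r : R) (m n : nat) (v p : 'rV[C]_3) (F G : 'rV[C]_3 -> C) (H : set 'rV[C]_3).

Lemma econt_cst H c : econt_on H (fun=> c).
Proof. by move=> p _ e e0; exists 1 => // v _ _; rewrite subrr cmod0 ltW. Qed.

Lemma econt_coord H i : econt_on H (fun v => v 0 i).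
Proof.
move=> p _ e e0; exists e => // v _ /ltW vp; rewrite (le_trans _ vp)//.
by have := cmod_le_vmod (v - p) i; rewrite !mxE.
Qed.

Lemma econtD H F G : econt_on H F -> econt_on H G -> econt_on H (fun v => F v + G v).
Proof.
move=> hF hG p Hp e e0.
have [d1 d10 h1] := hF p Hp (e / 2) ltac:(by rewrite divr_gt0).
have [d2 d20 h2] := hG p Hp (e / 2) ltac:(by rewrite divr_gt0).
exists (Num.min d1 d2); first by rewrite lt_min d10.
move=> v Hv; rewrite lt_min => /andP[/(h1 v Hv) H1 /(h2 v Hv) H2].
by rewrite opprD addrACA (le_trans (cmodD _ _))// (splitr e) lerD.
Qed.

Lemma econtM H F G : econt_on H F -> econt_on H G -> econt_on H (fun v => F v * G v).
Proof.
move=> hF hG p Hp e e0.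
pose K := cmod (F p) + cmod (G p) + 1.
have Fp := cmod_ge0 (F p); have Gp := cmod_ge0 (G p).
have K0 : 0 < K by rewrite /K; lra.
have K1 : 1 <= K by rewrite /K; lra.
have [d1 d10 h1] := hF p Hp (Num.min 1 (e / (3 * K)))
  ltac:(by rewrite lt_min ltr01 divr_gt0// mulr_gt0).
have [d2 d20 h2] := hG p Hp (Num.min 1 (e / (3 * K)))
  ltac:(by rewrite lt_min ltr01 divr_gt0// mulr_gt0).
exists (Num.min d1 d2); first by rewrite lt_min d10.
move=> v Hv; rewrite lt_min => /andP[/(h1 v Hv) H1 /(h2 v Hv) H2].
move: H1 H2; rewrite !le_min !ler_pdivlMr ?mulr_gt0// => /andP[a1 a2] /andP[b1 b2].
have -> : F v * G v - F p * G p =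
   (F v - F p) * (G v - G p) + (F v - F p) * G p + F p * (G v - G p) by ring.
rewrite (le_trans (cmodD _ _))// (le_trans (lerD (cmodD _ _) (lexx _)))// !cmodM.
move: a1 a2 b1 b2 K1 Fp Gp; rewrite /K.
have := cmod_ge0 (F v - F p); have := cmod_ge0 (G v - G p).
set x := cmod (F v - _); set y := cmod (G v - _); set A := cmod _; set B := cmod _.
nra.
Qed.

Lemma econtX H F n : econt_on H F -> econt_on H (fun v => F v ^+ n).
Proof.
move=> hF; elim: n => [|n IH].
  by have -> : (fun v => F v ^+ 0) = (fun=> 1) by []; exact: econt_cst.
have -> : (fun v => F v ^+ n.+1) = (fun v => F v * F v ^+ n).
  by apply: funext => v; rewrite exprS.
exact: econtM.
Qed.

Lemma econt_sum H I (s : seq I) (F : I -> 'rV[C]_3 -> C) :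
  (forall i, econt_on H (F i)) -> econt_on H (fun v => \sum_(i <- s) F i v).
Proof.
move=> hF; elim: s => [|i s IH].
  have -> : (fun v => \sum_(i <- [::]) F i v) = (fun=> 0) by apply: funext => v; rewrite big_nil.
  exact: econt_cst.
have -> : (fun v => \sum_(i <- i :: s) F i v) = (fun v => F i v + \sum_(i <- s) F i v).
  by apply: funext => v; rewrite big_cons.
exact: econtD.
Qed.

Lemma econt_prod H I (s : seq I) (F : I -> 'rV[C]_3 -> C) :
  (forall i, econt_on H (F i)) -> econt_on H (fun v => \prod_(i <- s) F i v).
Proof.
move=> hF; elim: s => [|i s IH].
  have -> : (fun v => \prod_(i <- [::]) F i v) = (fun=> 1) by apply: funext => v; rewrite big_nil.
  exact: econt_cst.
have -> : (fun v => \prod_(i <- i :: s) F i v) = (fun v => F i v * \prod_(i <- s) F i v).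
  by apply: funext => v; rewrite big_cons.
exact: econtM.
Qed.

Lemma econt_peval H (P : mpoly 3 C) : econt_on H (peval P).
Proof.
have -> : peval P = fun v => \sum_(m <- msupp P) mcoeff m P * \prod_i v 0 i ^+ m i.
  by apply: funext => v; rewrite /peval mevalE.
apply: econt_sum => m; apply: econtM; first exact: econt_cst.
by apply: econt_prod => i; apply: econtX; exact: econt_coord.
Qed.

Lemma closed_level F c : econt_on setT F -> closed [set v | F v = c].
Proof.
move=> cF; rewrite closedE => p /= hp; apply/eqP; rewrite -subr_eq0 -cmod_eq0.
apply/eqP/le_anti; rewrite cmod_ge0 andbT; apply/ler_addgt0Pr => e e0; rewrite add0r.
rewrite leNgt; apply/negP => h; apply: hp.
have [d d0 hd] := cF p I e e0.
apply/nbhs_vmodP; exists d => // v /hd => /(_ I) H1 H2.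
by move: h; rewrite -H2 -cmodBC ltNge H1.
Qed.

Lemma closed_quadric (Q : mpoly 3 C) : closed (quadric Q).
Proof. by apply: closed_level; exact: econt_peval. Qed.

Lemma vdiff_econt H f : (forall p, H p -> vdiff H f p) -> econt_on H f.
Proof.
move=> hf p Hp e e0.
have [d hd] := hf p Hp; have [K K0 hK] := covector_bounded d.
have [eta eta0 he] := hd 1 ltr01.
exists (Num.min eta (e / (1 + K))); first by rewrite lt_min eta0 divr_gt0// addr_gt0.
move=> v Hv; rewrite lt_min => /andP[/(he v Hv) H1].
rewrite ltr_pdivlMr ?addr_gt0// => H2.
rewrite -(subrK (covector d (v - p)) (f v - f p)) (le_trans (cmodD _ _))//.
have := hK (v - p); lra.
Qed.

Lemma holomorphic_vdiff H f : holomorphic_on H f -> forall p, H p -> vdiff H f p.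
Proof.
move=> hf p Hp; have [U [h [oU Up dh fh]]] := hf p Hp.
have /differentiable_vdiff[d hd] := dh p Up.
have /nbhs_vmodP[eta eta0 he] : nbhs p U by exact: open_nbhs_nbhs.
exists d => e e0; have [eta' eta'0 he'] := hd e e0.
exists (Num.min eta eta'); first by rewrite lt_min eta0.
move=> v Hv; rewrite lt_min => /andP[/he Uv /(he' v I)].
by rewrite !fh.
Qed.

(** Polynomial approximability: F belongs to the closure of the polynomials for
    uniform convergence on the bounded parts of H. *)
Definition papprox H F := forall r e : R, 0 < e -> exists P : mpoly 3 C,
  forall v, H v -> vmod v <= r -> cmod (F v - peval P v) <= e.

Lemma papprox_peval H P : papprox H (peval P).
Proof. by move=> r e e0; exists P => v _ _; rewrite subrr cmod0 ltW. Qed.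

Lemma papproxD H F G : papprox H F -> papprox H G -> papprox H (fun v => F v + G v).
Proof.
move=> hF hG r e e0.
have [P hP] := hF r (e / 2) ltac:(by rewrite divr_gt0).
have [P' hP'] := hG r (e / 2) ltac:(by rewrite divr_gt0).
exists (P + P') => v Hv vr; rewrite /peval mevalD opprD addrACA.
by rewrite (le_trans (cmodD _ _))// (splitr e) lerD ?hP ?hP'.
Qed.

Lemma papprox_sum H I (s : seq I) (F : I -> 'rV[C]_3 -> C) :
  (forall i, papprox H (F i)) -> papprox H (fun v => \sum_(i <- s) F i v).
Proof.
move=> hF; elim: s => [|i s IH].
  have -> : (fun v => \sum_(i <- [::]) F i v) = peval 0.
    by apply: funext => v; rewrite big_nil /peval meval0.
  exact: papprox_peval.
have -> : (fun v => \sum_(i <- i :: s) F i v) = (fun v => F i v + \sum_(i <- s) F i v).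
  by apply: funext => v; rewrite big_cons.
exact: papproxD.
Qed.

Lemma papprox_pmul H (P : mpoly 3 C) F : papprox H F -> papprox H (fun v => peval P v * F v).
Proof.
move=> hF r e e0.
have [B B0 hB] := bounded_on_vball r (@closedT _) (econt_peval (H := setT) P).
have [P' hP'] := hF r (e / B) ltac:(by rewrite divr_gt0).
exists (P * P') => v Hv vr; rewrite {2}/peval mevalM -mulrBr cmodM.
rewrite (le_trans (ler_pM (cmod_ge0 _) (cmod_ge0 _) (hB v I vr) (hP' v Hv vr)))//.
by rewrite mulrC divfK// gt_eqF.
Qed.

Lemma papprox_limit H F : (forall r e : R, 0 < e -> exists2 G, papprox H G &
  forall v, H v -> vmod v <= r -> cmod (F v - G v) <= e) -> papprox H F.
Proof.
move=> h r e e0.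
have [G hG FG] := h r (e / 2) ltac:(by rewrite divr_gt0).
have [P hP] := hG r (e / 2) ltac:(by rewrite divr_gt0).
exists P => v Hv vr; rewrite -(subrK (G v) (F v)) -addrA.
by rewrite (le_trans (cmodD _ _))// (splitr e) lerD ?FG ?hP.
Qed.

Lemma papprox_ext H F G : (forall v, H v -> F v = G v) -> papprox H F -> papprox H G.
Proof.
by move=> FG hF r e /(hF r)[P hP]; exists P => v Hv vr; rewrite -FG// hP.
Qed.

Lemma papprox_entire H (h : C -> C) i : (forall t, cdiff h t) ->
  papprox H (fun v => h (v 0 i)).
Proof.
move=> dh r e e0; have [p hp] := entire_poly r dh e0.
exists (\sum_(j < size p) mpolyC 3 p`_j * @mpolyX 3 C (mnm1 i) ^+ j) => v Hv vr.
have -> : peval (\sum_(j < size p) mpolyC 3 p`_j * @mpolyX 3 C (mnm1 i) ^+ j) v = p.[v 0 i].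
  rewrite /peval raddf_sum horner_coef; apply: eq_bigr => j _ /=.
  by rewrite mevalM mevalC rmorphXn /= mevalXU.
by apply: hp; rewrite (le_trans _ vr)// cmod_le_vmod.
Qed.

End Continuity.

(** * Holomorphic functions on the quadric z^2 - x y = 1 *)

Section NormalQuadric.
Variable R : realType.
Local Notation C := (complexes R).
Implicit Types (x y z w s t : C) (e r : R) (m n : nat) (v p : 'rV[C]_3) (f : 'rV[C]_3 -> C).

Definition v3 x y z : 'rV[C]_3 := \row_i [:: x; y; z]`_i.

Lemma v3E v : v = v3 (v 0 o0) (v 0 o1) (v 0 o2).
Proof.
by apply/rowP => -[[|[|[|]]]] //= i; rewrite mxE /=; congr (v _ _); apply: val_inj.
Qed.

Lemma v3_0 x y z : v3 x y z 0 o0 = x. Proof. by rewrite mxE. Qed.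
Lemma v3_1 x y z : v3 x y z 0 o1 = y. Proof. by rewrite mxE. Qed.
Lemma v3_2 x y z : v3 x y z 0 o2 = z. Proof. by rewrite mxE. Qed.

Lemma vmod_v3_le x y z (r : R) : cmod x <= r -> cmod y <= r -> cmod z <= r ->
  vmod (v3 x y z) <= r.
Proof.
move=> hx hy hz; apply/le_vmodP; first by rewrite (le_trans _ hx)// cmod_ge0.
by case=> -[|[|[|]]] //= i; rewrite mxE.
Qed.

(** The quadric to which all quadrics Q = 1, with Q irreducible, are linearly
    equivalent; it carries an action of the multiplicative group by diagonal
    matrices. *)
Definition S0 : set 'rV[C]_3 := [set v | v 0 o2 ^+ 2 - v 0 o0 * v 0 o1 = 1].

Definition torus t v := v3 (t * v 0 o0) (t^-1 * v 0 o1) (v 0 o2).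

Lemma S0_v3 x y z : S0 (v3 x y z) <-> z ^+ 2 - x * y = 1.
Proof. by rewrite /S0 /= v3_0 v3_1 v3_2. Qed.

Lemma S0_torus t v : t != 0 -> S0 v -> S0 (torus t v).
Proof.
move=> t0 hv; apply/S0_v3; rewrite -[RHS]hv; congr (_ - _); by field.
Qed.

Lemma closed_S0 : closed S0.
Proof.
apply: (@closed_level R (fun v => v 0 o2 ^+ 2 - v 0 o0 * v 0 o1)).
have -> : (fun v => v 0 o2 ^+ 2 - v 0 o0 * v 0 o1) =
   (fun v => v 0 o2 ^+ 2 + (-1) * (v 0 o0 * v 0 o1)).
  by apply: funext => v; rewrite mulN1r.
apply: econtD; first by apply: econtX; exact: econt_coord.
by apply: econtM; [exact: econt_cst|apply: econtM; exact: econt_coord].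
Qed.

Lemma vmod_torus t v : cmod t = 1 -> vmod (torus t v) <= vmod v.
Proof.
move=> t1; apply: vmod_v3_le; rewrite ?cmodM ?cmodV ?t1 ?invr1 ?mul1r cmod_le_vmod//.
Qed.

Lemma torus_lip t t' v : cmod t = 1 -> cmod t' = 1 ->
  vmod (torus t v - torus t' v) <= cmod (t - t') * vmod v.
Proof.
move=> t1 t'1.
have -> : torus t v - torus t' v =
    v3 ((t - t') * v 0 o0) ((t^-1 - t'^-1) * v 0 o1) 0.
  by apply/rowP => -[[|[|[|]]]] //= i; rewrite !mxE /= ?mulrBl ?subrr.
have h := mulr_ge0 (cmod_ge0 (t - t')) (vmod_ge0 v).
apply: vmod_v3_le; rewrite ?cmodM ?cmod_invB ?cmod0//.
  by rewrite ler_wpM2l ?cmod_ge0 ?cmod_le_vmod.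
by rewrite ler_wpM2l ?cmod_ge0 ?cmod_le_vmod.
Qed.

Section Approximation.
Variable f : 'rV[C]_3 -> C.
Hypothesis df : forall p, S0 p -> vdiff S0 f p.

Lemma ufam_torus (r : R) : ufam (fun v => S0 v /\ vmod v <= r) (fun v t => f (torus t v)).
Proof.
have cf := vdiff_econt df.
split.
  have [B B0 hB] := bounded_on_vball r closed_S0 cf.
  exists B => // v [Sv vr] t t1; apply: hB; first exact: S0_torus (cmod1_neq0 t1) Sv.
  exact: le_trans (vmod_torus v t1) vr.
move=> e e0; have [d d0 hd] := heine_cantor r closed_S0 cf e0.
have K0 : 0 < `|r| + 1 by rewrite ltr_wpDl.
exists (d / (`|r| + 1)); first by rewrite divr_gt0.
move=> v [Sv vr] t t' t1 t'1; rewrite ltr_pdivlMr// => tt'.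
apply: hd.
- exact: S0_torus (cmod1_neq0 t1) Sv.
- exact: S0_torus (cmod1_neq0 t'1) Sv.
- exact: le_trans (vmod_torus v t1) vr.
- exact: le_trans (vmod_torus v t'1) vr.
rewrite (le_lt_trans (torus_lip v t1 t'1))// (le_lt_trans _ tt')// ler_wpM2l ?cmod_ge0//.
by rewrite (le_trans vr)// (le_trans (ler_norm _))// lerDl.
Qed.

(** A section of the torus action over the points where x does not vanish. *)
Definition slice z := v3 1 (z ^+ 2 - 1) z.

Lemma S0_slice z : S0 (slice z).
Proof. by apply/S0_v3; rewrite mul1r; ring. Qed.

Lemma slice_le (r : R) z : cmod z <= r -> vmod (slice z) <= 1 + r + r ^+ 2.
Proof.
move=> zr; have r0 := le_trans (cmod_ge0 _) zr.
have r2 := sqr_ge0 r.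
apply: vmod_v3_le; rewrite ?cmod1; try lra.
rewrite (le_trans (cmodB _ _))// cmodX cmod1.
have : cmod z ^+ 2 <= r ^+ 2 by rewrite ler_pXn2r ?nnegrE ?cmod_ge0.
lra.
Qed.

Lemma cdiff_f_v3 (x y z : C -> C) t : cdiff x t -> cdiff y t -> cdiff z t ->
  (exists2 d : R, 0 < d & forall w, cmod (w - t) < d -> S0 (v3 (x w) (y w) (z w))) ->
  cdiff (fun w => f (v3 (x w) (y w) (z w))) t.
Proof.
move=> dx dy dz hS.
apply: (cdiff_curve (g := fun w => v3 (x w) (y w) (z w)) (X := S0)) => //.
  case=> -[|[|[|]]] //= i; under eq_fun do rewrite mxE //=; by [].
apply: df; case: hS => d d0; apply; by rewrite subrr cmod0.
Qed.

(** The coefficient of t^n in the Laurent expansion of t -> f (t.v). It has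
    weight n under the torus; as v = x.(slice z) when x does not vanish, it is
    x^n times its value at slice z. When x = 0, the orbit closure adds the
    point (0, 0, z) and the mean value property gives the result. The function
    g is a limit of averages of the holomorphic functions z -> f (t.slice z),
    hence of entire functions, uniformly on compacts. *)
Lemma coef_negative n : exists g : C -> C,
  (forall v, S0 v -> is_mean (fun t => f (torus t v) * t^-1 ^+ n) (v 0 o0 ^+ n * g (v 0 o2))) /\
  (forall r e : R, 0 < e -> exists2 h : C -> C, (forall z, cdiff h z) &
     forall z, cmod z <= r -> cmod (g z - h z) <= e).
Proof.
have U (r : R) : ufam (fun z => cmod z <= r) (fun z t => f (torus t (slice z)) * t^-1 ^+ n).
  apply: ufamM; last by apply: ufamX; exact: ufam_inv.
  have [[B B0 hB] h] := ufam_torus (1 + r + r ^+ 2).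
  split; first by exists B => // z zr; apply: hB; split; [exact: S0_slice|exact: slice_le].
  move=> e /h[d d0 hd]; exists d => // z zr; apply: hd.
  by split; [exact: S0_slice|exact: slice_le].
have /choice[g hg] : forall z, exists L, is_mean (fun t => f (torus t (slice z)) * t^-1 ^+ n) L.
  by move=> z; apply: (ufam_mean (U (cmod z))) => /=.
exists g; split; last first.
  move=> r e e0; have [_ /(_ e e0)[d d0 hd]] := U r.
  have [m0 hm] := cavg_mean d0.
  exists (fun z => cavg m0 (fun t => f (torus t (slice z)) * t^-1 ^+ n)); last first.
    by move=> z zr; rewrite cmodBC; exact: hm (hd z zr) (hg z) _ (leqnn _).
  move=> z; apply: (@cdiff_avg R m0 (fun z w => f (torus (cexp w) (slice z)) * (cexp w)^-1 ^+ n)).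
  move=> w; apply: cdiffM; last exact: cdiff_cst.
  apply: (@cdiff_f_v3 (fun z => cexp w * slice z 0 o0) (fun z => (cexp w)^-1 * slice z 0 o1)
    (fun z => slice z 0 o2)).
  - by under eq_fun do rewrite v3_0; exact: cdiff_cst.
  - under eq_fun do rewrite v3_1; apply: cdiffM; first exact: cdiff_cst.
    by apply: cdiffD; [apply: cdiffX; exact: cdiff_id|exact: cdiff_cst].
  - by under eq_fun do rewrite v3_2; exact: cdiff_id.
  exists 1 => // z' _; apply: S0_torus (S0_slice _); exact: cexp_neq0.
move=> v Sv; rewrite [v]v3E; set x := v 0 o0; set y := v 0 o1; set z := v 0 o2.
have xyz : z ^+ 2 - x * y = 1 by exact: Sv.
rewrite v3_0 v3_2.
(* Off x = 0, replacing t by x t moves the orbit of slice z to the orbit of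
   v. *)
have [x0|x0] := eqVneq x 0; last first.
  have dphi t : t != 0 -> cdiff (fun t => f (torus t (slice z)) * t^-1 ^+ n) t.
    move=> t0; apply: cdiffM; last by apply: cdiffX; apply: cdiffV => //; exact: cdiff_id.
    apply: cdiff_f_v3.
    - by apply: cdiffM; [exact: cdiff_id|exact: cdiff_cst].
    - by apply: cdiffM; [apply: cdiffV => //; exact: cdiff_id|exact: cdiff_cst].
    - exact: cdiff_cst.
    exists (cmod t); first by rewrite cmod_gt0.
    move=> w wt; apply: S0_torus (S0_slice _).
    by apply: contraTneq wt => ->; rewrite sub0r cmodN ltxx.
  have := is_meanZ (x ^+ n) (mean_dilate dphi x0 (hg z)).
  apply: is_mean_ext => t t1; have t0 := cmod1_neq0 t1.
  have -> : torus (x * t) (slice z) = torus t (v3 x y z).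
    rewrite /torus /slice !v3_0 !v3_1 !v3_2; congr v3; first by rewrite mulr1 mulrC.
    have -> : z ^+ 2 - 1 = x * y by rewrite -xyz; ring.
    by field; rewrite t0 x0.
  by rewrite invfM exprMn mulrCA !exprVn mulVKf ?expf_neq0.
have z2 : z ^+ 2 = 1 by move: xyz; rewrite x0 mul0r subr0.
have hc (y0 : C) (b : bool) : S0 (if b then v3 y0 0 z else v3 0 y0 z).
  by case: b; apply/S0_v3; rewrite ?mulr0 ?mul0r subr0.
have dA t : cdiff (fun t => f (v3 t 0 z)) t.
  apply: cdiff_f_v3; [exact: cdiff_id|exact: cdiff_cst|exact: cdiff_cst|].
  by exists 1 => // w _; exact: (hc w true).
have dB t : cdiff (fun t => f (v3 0 (t * y) z) * t ^+ n) t.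
  apply: cdiffM; last by apply: cdiffX; exact: cdiff_id.
  apply: cdiff_f_v3; [exact: cdiff_cst| |exact: cdiff_cst|].
    by apply: cdiffM; [exact: cdiff_id|exact: cdiff_cst].
  by exists 1 => // w _; exact: (hc (w * y) false).
have hB := mean_inv (mean_entire dB).
have -> : x ^+ n * g z = f (v3 0 (0 * y) z) * 0 ^+ n.
  rewrite x0 mul0r; case: n {U dB hB} hg => [|n'] hg; last by rewrite !expr0n mul0r mulr0.
  rewrite !expr0 mulr1 mul1r.
  apply: is_mean_unique (hg z) _; apply: is_mean_ext (mean_entire dA) => t t1.
  by rewrite expr0 mulr1 /torus /slice v3_0 v3_1 v3_2 z2 subrr mulr0 mulr1.
apply: is_mean_ext hB => t t1.
by rewrite /torus v3_0 v3_1 v3_2 x0 mulr0.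
Qed.

End Approximation.

Lemma vdiff_mulmx (A : 'M[C]_3) X Y f p : (forall v, X v -> Y (v *m A)) ->
  vdiff Y f (p *m A) -> vdiff X (fun v => f (v *m A)) p.
Proof.
move=> XY [d hd].
exists (fun i => \sum_j A i j * d j) => e e0.
have [K K0 hK] := mulmx_bounded A.
have [eta eta0 he] := hd (e / K) ltac:(by rewrite divr_gt0).
exists (eta / K); first by rewrite divr_gt0.
move=> v Xv; rewrite ltr_pdivlMr// mulrC => vp.
have := he (v *m A) (XY v Xv); rewrite -mulmxBl => /(_ (le_lt_trans (hK _) vp)).
have -> : covector (fun i => \sum_j A i j * d j) (v - p) = covector d ((v - p) *m A).
  rewrite /covector; under [RHS]eq_bigr do rewrite mxE mulr_sumr.
  rewrite exchange_big /=; apply: eq_bigr => i _; rewrite mulr_suml.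
  by apply: eq_bigr => j _; ring.
move=> /le_trans; apply; rewrite mulrAC ler_pdivrMr// -mulrA ler_pM2l// mulrC.
exact: hK.
Qed.

Definition swap_mx : 'M[C]_3 := tperm_mx o0 o1.

Lemma mul_swap v : v *m swap_mx = v3 (v 0 o1) (v 0 o0) (v 0 o2).
Proof.
rewrite -xcolE; apply/rowP => j; rewrite !mxE.
case: j => -[|[|[|]]] //= i; congr (v _ _).
- by rewrite (_ : Ordinal i = o0) ?tpermL//; apply: val_inj.
- by rewrite (_ : Ordinal i = o1) ?tpermR//; apply: val_inj.
- by rewrite tpermD//; apply: val_inj.
Qed.

Lemma S0_swap v : S0 v -> S0 (v *m swap_mx).
Proof. by move=> Sv; rewrite mul_swap; apply/S0_v3; rewrite mulrC. Qed.

(** The symmetry exchanging x and y inverts the torus action. *)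
Lemma coef_positive f n : (forall p, S0 p -> vdiff S0 f p) -> exists g : C -> C,
  (forall v, S0 v -> is_mean (fun t => f (torus t v) * t ^+ n) (v 0 o1 ^+ n * g (v 0 o2))) /\
  (forall r e : R, 0 < e -> exists2 h : C -> C, (forall z, cdiff h z) &
     forall z, cmod z <= r -> cmod (g z - h z) <= e).
Proof.
move=> df.
have [g [hg ag]] := @coef_negative (fun v => f (v *m swap_mx))
  (fun p Sp => vdiff_mulmx S0_swap (df _ (S0_swap Sp))) n.
exists g; split=> // v Sv; have := mean_inv (hg _ (S0_swap Sv)).
rewrite mul_swap v3_0 v3_2; apply: is_mean_ext => t t1; rewrite invrK; congr (f _ * _).
by rewrite /torus mul_swap !v3_0 !v3_1 !v3_2 invrK.
Qed.

(** The Fejer sums of t -> f (t.v) at t = 1 converge to f v uniformly on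
    bounded parts of the quadric. Each Fourier coefficient is a power of x or y
    times a limit of entire functions of z, which are in turn limits of
    polynomials. *)
Theorem S0_papprox f : (forall p, S0 p -> vdiff S0 f p) -> papprox S0 f.
Proof.
move=> df; apply: papprox_limit => r e e0.
have [N hN] := fejer (ufam_torus df r) e0.
have /choice[gn hgn] := coef_negative df.
have /choice[gp hgp] := fun n => coef_positive n df.
pose c j l v := if (l <= j)%N then v 0 o1 ^+ (j - l) * gp (j - l)%N (v 0 o2)
  else v 0 o0 ^+ (l - j) * gn (l - j)%N (v 0 o2).
exists (fun v => N%:R^-1 * \sum_(j < N) \sum_(l < N) c j l v); last first.
  move=> v Sv vr; have := hN v (conj Sv vr) (fun j l => c j l v).
  have -> : torus 1 v = v by rewrite [RHS]v3E /torus invr1 !mul1r.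
  apply=> j l; rewrite /c.
  have E (t : C) (t1 : cmod t = 1) := @mulf_invX R t j l (cmod1_neq0 t1).
  case: leqP => lj.
    by apply: is_mean_ext ((hgp (j - l)%N).1 v Sv) => t /E ->; rewrite lj.
  by apply: is_mean_ext ((hgn (l - j)%N).1 v Sv) => t /E ->; rewrite leqNgt lj.
have papp g i n : (forall r e : R, 0 < e -> exists2 h : C -> C, (forall z, cdiff h z) &
     forall z, cmod z <= r -> cmod (g z - h z) <= e) ->
     papprox S0 (fun v => v 0 i ^+ n * g (v 0 o2)).
  move=> hg.
  have -> : (fun v : 'rV[C]_3 => v 0 i ^+ n * g (v 0 o2)) =
     (fun v => peval (@mpolyX 3 C (mnm1 i) ^+ n) v * g (v 0 o2)).
    by apply: funext => v; rewrite /peval rmorphXn /= mevalXU.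
  apply: papprox_pmul; apply: papprox_limit => r' e' e'0.
  have [h dh gh] := hg r' e' e'0.
  exists (fun v => h (v 0 o2)); first exact: papprox_entire.
  by move=> v _ vr; apply: gh; rewrite (le_trans _ vr)// cmod_le_vmod.
have -> : (fun v => N%:R^-1 * \sum_(j < N) \sum_(l < N) c j l v) =
   (fun v => peval (mpolyC 3 (N%:R^-1)) v * \sum_(j < N) \sum_(l < N) c j l v).
  by apply: funext => v; rewrite /peval mevalC.
apply: papprox_pmul; apply: papprox_sum => j; apply: papprox_sum => l.
rewrite /c; case: leqP => lj; apply: papp; first exact: (hgp _).2.
exact: (hgn _).2.
Qed.

End NormalQuadric.

(** * Normal form of an irreducible quadratic form *)

Section QuadraticForms.
Variable R : realType.
Local Notation C := (complexes R).
Local Notation X_ i := (@mpolyX 3 C (mnm1 i)).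

Lemma mpolyX_split (m : multinom 3) d : mdeg m = d.+1 ->
  exists i m', mdeg m' = d /\ @mpolyX 3 C m = X_ i * @mpolyX 3 C m'.
Proof.
move=> md; have [i mi] : exists i, (0 < m i)%N.
  apply: contrapT => h; suff /eqP : mdeg m == 0%N by rewrite md.
  rewrite mdegE big1// => i _; apply/eqP; rewrite eqn0Ngt; apply/negP => mi.
  by apply: h; exists i.
exists i, (mnm_sub m (mnm1 i)).
have E : mnm_add (mnm_sub m (mnm1 i)) (mnm1 i) = m.
  by apply: submK; rewrite lep1mP -lt0n.
split; last by rewrite -mpolyXD addmC E.
by move: md; rewrite -{1}E mdegD mdeg1 addn1 => -[].
Qed.

Lemma dhomog_split (p : mpoly 3 C) d : p \is ishomog1 d.+1 mdeg ->
  exists q : 'I_3 -> mpoly 3 C, (forall i, q i \is ishomog1 d mdeg) /\ p = \sum_i X_ i * q i.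
Proof.
move=> /dhomogP hp; rewrite [p]mpolyE big_seq.
elim/big_ind : _ => [|a b [qa [ha ->]] [qb [hb ->]]|m /hp /mpolyX_split[i [m' [md ->]]]].
- exists (fun=> 0); split=> [i|]; first exact: dhomog0.
  by rewrite big1// => i _; rewrite mulr0.
- exists (fun i => qa i + qb i); split=> [i|]; first exact: dhomogD.
  by rewrite -big_split; apply: eq_bigr => i _; rewrite mulrDr.
exists (fun j => if j == i then mcoeff m p *: @mpolyX 3 C m' else 0); split=> [j|].
  case: ifP => _; last exact: dhomog0.
  by apply: dhomogZ; rewrite dhomogX; apply/eqP.
rewrite (bigD1 i)//= eqxx big1 ?addr0; first by rewrite scalerAr.
by move=> j /negPf ->; rewrite mulr0.
Qed.

(** Removing one factor from each nonconstant monomial. *)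
Lemma mpoly_split (p : mpoly 3 C) n : (msize p <= n.+1)%N ->
  exists (c : C) (q : 'I_3 -> mpoly 3 C),
    (forall i, (msize (q i) <= n)%N) /\ p = mpolyC 3 c + \sum_i X_ i * q i.
Proof.
move=> hp; rewrite [p]mpolyE big_seq.
elim/big_ind : _ => [|a b [ca [qa [ha ->]]] [cb [qb [hb ->]]]|m mp].
- exists 0, (fun=> 0); split=> [i|]; first by rewrite msize0.
  by rewrite mpolyC0 big1 ?addr0// => i _; rewrite mulr0.
- exists (ca + cb), (fun i => qa i + qb i); split=> [i|].
    by rewrite (leq_trans (msizeD_le _ _))// geq_max ha hb.
  rewrite mpolyCD addrACA -big_split; congr (_ + _).
  by apply: eq_bigr => i _; rewrite mulrDr.
case md: (mdeg m) => [|d].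
  exists (mcoeff m p), (fun=> 0); split=> [i|]; first by rewrite msize0.
  have /eqP -> : m == (@mnm0 3) by rewrite -mdeg_eq0 md.
  by rewrite mpolyX0 big1 ?addr0 ?alg_mpolyC// => i _; rewrite mulr0.
have [i [m' [md' ->]]] := mpolyX_split md.
exists 0, (fun j => if j == i then mcoeff m p *: @mpolyX 3 C m' else 0); split=> [j|].
  case: ifP => _; last by rewrite msize0.
  rewrite (leq_trans (msizeZ_le _ _))// msizeX md' -ltnS.
  by have := leq_trans (msize_mdeg_lt mp) hp; rewrite md.
rewrite mpolyC0 add0r (bigD1 i)//= eqxx big1 ?addr0; first by rewrite scalerAr.
by move=> j /negPf ->; rewrite mulr0.
Qed.

Lemma dhomog0_const (p : mpoly 3 C) : p \is ishomog1 0 mdeg -> exists c, p = mpolyC 3 c.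
Proof.
move=> /dhomogP hp; exists (mcoeff (@mnm0 3) p); apply: msize1_polyC.
rewrite msizeE; apply/bigmax_leqP_seq => m mp _.
by rewrite (hp _ mp).
Qed.

Definition lform (a : 'I_3 -> C) : mpoly 3 C := \sum_i mpolyC 3 (a i) * X_ i.

Lemma lform_homog a : lform a \is ishomog1 1 mdeg.
Proof.
apply: rpred_sum => i _; rewrite mul_mpolyC; apply: dhomogZ.
by rewrite dhomogX; apply/eqP; exact: mdeg1.
Qed.

Lemma peval_lform a v : peval (lform a) v = covector a v.
Proof.
rewrite /peval /lform raddf_sum; apply: eq_bigr => i _ /=.
by rewrite mevalM mevalC mevalXU.
Qed.

Definition f3 (a b c : C) (i : 'I_3) : C := [:: a; b; c]`_i.

Lemma sum3 (V : nmodType) (F : 'I_3 -> V) : \sum_i F i = F o0 + F o1 + F o2.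
Proof.
rewrite !big_ord_recl big_ord0 addr0 addrA.
by congr (F _ + F _ + F _); apply: val_inj.
Qed.

Lemma lform3 a b c : lform (f3 a b c) =
  mpolyC 3 a * X_ o0 + mpolyC 3 b * X_ o1 + mpolyC 3 c * X_ o2.
Proof. by rewrite /lform sum3. Qed.

(** A binary quadratic form is a product of two linear forms, by the quadratic
    formula. *)
Lemma binary_split (b c d : C) : exists x2 x3 y2 y3,
  [/\ b = - (x2 * y2), c = - (x3 * y3) & d = - (x2 * y3 + x3 * y2)].
Proof.
have [->|b0] := eqVneq b 0.
  by exists 0, (-1), d, c; split; ring.
pose r : C := sqrtc (d ^+ 2 - 4 * b * c).
have hr : r ^+ 2 = d ^+ 2 - 4 * b * c by exact: sqr_sqrtc.
exists (- b), (- (d - r) / 2), 1, ((d + r) / (2 * b)); split; first by ring.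
  have -> : - (- (d - r) / 2 * ((d + r) / (2 * b))) = (d ^+ 2 - r ^+ 2) / (4 * b).
    by field.
  by rewrite hr; field.
by field.
Qed.

(** A ternary quadratic form is z^2 - x y for some linear forms x, y, z: if a
    diagonal coefficient is nonzero, complete the square and split the
    remaining binary form. The last cases are those of forms without
    squares. *)
Lemma ternary_split (a b c d e f : C) : exists x1 x2 x3 y1 y2 y3 z1 z2 z3,
  [/\ a = z1 ^+ 2 - x1 * y1, b = z2 ^+ 2 - x2 * y2 & c = z3 ^+ 2 - x3 * y3] /\
  [/\ d = 2 * z2 * z3 - (x2 * y3 + x3 * y2), e = 2 * z1 * z3 - (x1 * y3 + x3 * y1) &
      f = 2 * z1 * z2 - (x1 * y2 + x2 * y1)].
Proof.
have core a' b' c' d' e' f' : a' != 0 -> exists x1 x2 x3 y1 y2 y3 z1 z2 z3 : C,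
  [/\ a' = z1 ^+ 2 - x1 * y1, b' = z2 ^+ 2 - x2 * y2 & c' = z3 ^+ 2 - x3 * y3] /\
  [/\ d' = 2 * z2 * z3 - (x2 * y3 + x3 * y2), e' = 2 * z1 * z3 - (x1 * y3 + x3 * y1) &
      f' = 2 * z1 * z2 - (x1 * y2 + x2 * y1)].
  move=> a0; pose s : C := sqrtc a'.
  have hs : s ^+ 2 = a' by exact: sqr_sqrtc.
  have s0 : s != 0 by apply: contraNneq a0 => s0; rewrite -hs s0 expr0n.
  have [x2 [x3 [y2 [y3 [h1 h2 h3]]]]] :=
    binary_split (b' - (f' / (2 * s)) ^+ 2) (c' - (e' / (2 * s)) ^+ 2)
      (d' - 2 * (f' / (2 * s)) * (e' / (2 * s))).
  exists 0, x2, x3, 0, y2, y3, s, (f' / (2 * s)), (e' / (2 * s)).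
  split; split.
  - by rewrite mul0r subr0 hs.
  - by rewrite -h1; ring.
  - by rewrite -h2; ring.
  - by rewrite -h3; ring.
  - by rewrite mul0r mulr0 addr0 subr0; field.
  - by rewrite mul0r mulr0 addr0 subr0; field.
have [a0|a0] := eqVneq a 0; last exact: core.
have [b0|b0] := eqVneq b 0; last first.
  have [x1 [x2 [x3 [y1 [y2 [y3 [z1 [z2 [z3 [[h1 h2 h3] [h4 h5 h6]]]]]]]]]]] :=
    core b a c e d f b0.
  exists x2, x1, x3, y2, y1, y3, z2, z1, z3; split; split=> //; rewrite h6; ring.
have [c0|c0] := eqVneq c 0; last first.
  have [x1 [x2 [x3 [y1 [y2 [y3 [z1 [z2 [z3 [[h1 h2 h3] [h4 h5 h6]]]]]]]]]]] :=
    core c b a f e d c0.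
  exists x3, x2, x1, y3, y2, y1, z3, z2, z1; split; split=> //.
  - by rewrite h6; ring.
  - by rewrite h5; ring.
  - by rewrite h4; ring.
have [d0|d0] := eqVneq d 0.
  exists 1, 0, 0, 0, (- f), (- e), 0, 0, 0; split; split; rewrite ?a0 ?b0 ?c0 ?d0; ring.
pose s : C := sqrtc (- (e * f / d)).
have hs : s ^+ 2 = - (e * f / d) by exact: sqr_sqrtc.
exists (- (e / d)), (-1), 0, f, 0, d, s, 0, 0; split; split; rewrite ?a0 ?b0 ?c0 ?hs.
- by field.
- by ring.
- by ring.
- by ring.
- by field.
- by ring.
Qed.

Lemma quadratic_split (Q : mpoly 3 C) : quadratic_form Q ->
  exists x y z, Q = lform z ^+ 2 - lform x * lform y.
Proof.
move=> /dhomog_split[q [hq ->]].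
have /choice[q' hq'] := fun i => dhomog_split (hq i).
have /choice[cf hcf] : forall ij : 'I_3 * 'I_3, exists c, q' ij.1 ij.2 = mpolyC 3 c.
  by move=> [i j]; apply: dhomog0_const; exact: (hq' i).1.
have -> : \sum_i X_ i * q i = \sum_i X_ i * \sum_j X_ j * mpolyC 3 (cf (i, j)).
  apply: eq_bigr => i _; rewrite (hq' i).2; congr (_ * _).
  by apply: eq_bigr => j _; rewrite -(hcf (i, j)).
have [x1 [x2 [x3 [y1 [y2 [y3 [z1 [z2 [z3 [[h1 h2 h3] [h4 h5 h6]]]]]]]]]]] :=
  ternary_split (cf (o0, o0)) (cf (o1, o1)) (cf (o2, o2))
    (cf (o1, o2) + cf (o2, o1)) (cf (o0, o2) + cf (o2, o0)) (cf (o0, o1) + cf (o1, o0)).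
exists (f3 x1 x2 x3), (f3 y1 y2 y3), (f3 z1 z2 z3).
rewrite !lform3 !sum3 h1 h2 h3.
have {}h4 : cf (o1, o2) = 2 * z2 * z3 - (x2 * y3 + x3 * y2) - cf (o2, o1) by rewrite -h4 addrK.
have {}h5 : cf (o0, o2) = 2 * z1 * z3 - (x1 * y3 + x3 * y1) - cf (o2, o0) by rewrite -h5 addrK.
have {}h6 : cf (o0, o1) = 2 * z1 * z2 - (x1 * y2 + x2 * y1) - cf (o1, o0) by rewrite -h6 addrK.
rewrite h4 h5 h6; ring.
Qed.

Lemma solve_linear (A : comNzRingType) (d c u z : A) : d * c = 1 -> u + c * z = 0 -> z = - (d * u).
Proof.
by move=> dc /eqP; rewrite addr_eq0 => /eqP ->; rewrite mulrN opprK mulrA dc mul1r.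
Qed.

Lemma mpolyCVl (c : C) : c != 0 -> mpolyC 3 c^-1 * mpolyC 3 c = 1.
Proof. by move=> c0; rewrite -mpolyCM mulVf// mpolyC1. Qed.

Lemma homog1_nonunit (p : mpoly 3 C) : p \is ishomog1 1 mdeg -> p \isn't a GRing.unit.
Proof.
move=> hp; apply/negP => /andP[_]; rewrite (dhomog_nemf_coeff hp) ?unitr0//.
by rewrite /= mdeg0.
Qed.

Lemma homog1_comb (a b : C) (p q : mpoly 3 C) : p \is ishomog1 1 mdeg ->
  q \is ishomog1 1 mdeg -> mpolyC 3 a * p + mpolyC 3 b * q \is ishomog1 1 mdeg.
Proof. by move=> hp hq; rewrite !mul_mpolyC; apply: dhomogD; apply: dhomogZ. Qed.

(** Linear forms are not invertible, so a product of two of them is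
    reducible. *)
Lemma irreducible_no_product (Q p q : mpoly 3 C) : irreducible_mpoly Q ->
  p \is ishomog1 1 mdeg -> q \is ishomog1 1 mdeg -> Q <> p * q.
Proof.
move=> [_ _ h] /homog1_nonunit hp /homog1_nonunit hq /h[] H.
  by rewrite H in hp.
by rewrite H in hq.
Qed.

Definition coords (x y z : 'I_3 -> C) : 'M[C]_3 := \matrix_(i, j) (f3 (x i) (y i) (z i)) j.

Lemma coordsE x y z (v : 'rV[C]_3) :
  v *m coords x y z = v3 (covector x v) (covector y v) (covector z v).
Proof.
apply/rowP => -[[|[|[|]]]] //= i; rewrite !mxE /=; apply: eq_bigr => k _;
  by rewrite !mxE /= mulrC.
Qed.

Definition normal_form (Q : mpoly 3 C) (M : 'M[C]_3) := M \in unitmx /\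
  forall v, peval Q v = (v *m M) 0 o2 ^+ 2 - (v *m M) 0 o0 * (v *m M) 0 o1.

(** Write Q = z^2 - x y with linear forms x, y, z. If these were linearly
    dependent, Q would be a quadratic form in two linear forms, hence a product
    of two linear forms. *)
Theorem irreducible_normal_form (Q : mpoly 3 C) : quadratic_form Q -> irreducible_mpoly Q ->
  exists M, normal_form Q M.
Proof.
move=> qQ iQ; have [x [y [z hQ]]] := quadratic_split qQ.
exists (coords x y z); split; last first.
  move=> v; rewrite coordsE v3_0 v3_1 v3_2 hQ.
  by rewrite /peval mevalB expr2 !mevalM -!/(peval _ v) !peval_lform -expr2.
rewrite unitmxE unitfE -det_tr; apply/det0P => -[w w0 hw].
have hc i : w 0 o0 * x i + w 0 o1 * y i + w 0 o2 * z i = 0.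
  by have := congr1 (fun m : 'rV[C]_3 => m 0 i) hw; rewrite !mxE sum3 !mxE.
have hl : mpolyC 3 (w 0 o0) * lform x + mpolyC 3 (w 0 o1) * lform y
    + mpolyC 3 (w 0 o2) * lform z = 0.
  rewrite /lform !mulr_sumr -!big_split /= big1// => i _.
  have -> : mpolyC 3 (w 0 o0) * (mpolyC 3 (x i) * X_ i)
     + mpolyC 3 (w 0 o1) * (mpolyC 3 (y i) * X_ i)
     + mpolyC 3 (w 0 o2) * (mpolyC 3 (z i) * X_ i)
     = mpolyC 3 (w 0 o0 * x i + w 0 o1 * y i + w 0 o2 * z i) * X_ i by ring.
  by rewrite hc mpolyC0 mul0r.
have hx := lform_homog x; have hy := lform_homog y; have hz := lform_homog z.
have noP p q := irreducible_no_product (p := p) (q := q) iQ.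
set a := w 0 o0 in hl hc; set b := w 0 o1 in hl hc; set c := w 0 o2 in hl hc.
have [c0|c0] := eqVneq c 0; last first.
  (* z is a combination of x and y, so that Q is a binary form in x and y. *)
  pose s := - (a / c); pose t := - (b / c).
  have zE : lform z = mpolyC 3 s * lform x + mpolyC 3 t * lform y.
    by rewrite [LHS](solve_linear (mpolyCVl c0) hl) /s /t; ring.
  have [x2 [x3 [y2 [y3 [h1 h2 h3]]]]] := binary_split (s ^+ 2) (t ^+ 2) (2 * s * t - 1).
  apply: (noP _ _ (homog1_comb (- x2) (- x3) hx hy) (homog1_comb y2 y3 hx hy)).
  rewrite hQ zE.
  have -> : (mpolyC 3 s * lform x + mpolyC 3 t * lform y) ^+ 2 - lform x * lform y =
     mpolyC 3 (s ^+ 2) * lform x ^+ 2 + mpolyC 3 (2 * s * t - 1) * (lform x * lform y)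
     + mpolyC 3 (t ^+ 2) * lform y ^+ 2 by ring.
  by rewrite h1 h2 h3; ring.
have sq k (p : mpoly 3 C) : p \is ishomog1 1 mdeg -> Q <> lform z ^+ 2 - mpolyC 3 k * p ^+ 2.
  move=> hp hQ'; pose s : C := sqrtc k.
  have hs : s ^+ 2 = k by exact: sqr_sqrtc.
  apply: (noP _ _ (homog1_comb 1 (- s) hz hp) (homog1_comb 1 s hz hp)).
  by rewrite hQ' -hs; ring.
rewrite c0 mpolyC0 mul0r addr0 in hl.
have [a0|a0] := eqVneq a 0; last first.
  have xE : lform x = mpolyC 3 (- (b / a)) * lform y.
    by rewrite addrC in hl; rewrite [LHS](solve_linear (mpolyCVl a0) hl); ring.
  by apply: (sq (- (b / a)) _ hy); rewrite hQ xE; ring.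
have b0 : b != 0.
  apply: contraNneq w0 => b0; apply/eqP; rewrite [w]v3E -/a -/b -/c a0 b0 c0.
  by apply/rowP => -[[|[|[|]]]] //= i; rewrite !mxE.
have yE : lform y = 0.
  by rewrite a0 mpolyC0 mul0r in hl; rewrite (solve_linear (mpolyCVl b0) hl) mulr0 oppr0.
by apply: (sq 0 _ hy); rewrite hQ yE; ring.
Qed.

End QuadraticForms.

(** * Polynomials on a quadric as sums of products of linear forms *)

Section Multipoles.
Variable R : realType.
Local Notation C := (complexes R).
Variables (Q : mpoly 3 C) (M : 'M[C]_3).
Hypothesis hQM : normal_form Q M.
Implicit Types (v : 'rV[C]_3) (F G : 'rV[C]_3 -> C) (p q : {poly C}).
Local Notation S := (quadric Q).
Local Notation cx v := ((v *m M) 0 o0).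
Local Notation cy v := ((v *m M) 0 o1).
Local Notation cz v := ((v *m M) 0 o2).

Lemma quadric_coords v : S v -> cz v ^+ 2 = 1 + cx v * cy v.
Proof. by case: hQM => _ h; rewrite /quadric /= h => <-; rewrite subrK. Qed.

(** Restrictions to the quadric of polynomials of degree less than n: the size
    of a polynomial is one more than its degree. *)
Definition degree_lt n F := exists P : mpoly 3 C,
  (msize P <= n)%N /\ forall v, S v -> F v = peval P v.

Lemma degree_lt_ext n F G : (forall v, S v -> F v = G v) -> degree_lt n F -> degree_lt n G.
Proof. by move=> FG [P [sP hP]]; exists P; split=> // v Sv; rewrite -FG ?hP. Qed.

Lemma degree_ltW n m F : (n <= m)%N -> degree_lt n F -> degree_lt m F.
Proof. by move=> nm [P [sP hP]]; exists P; split=> //; exact: leq_trans sP nm. Qed.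

Lemma degree_lt0 n : degree_lt n (fun=> 0).
Proof. by exists 0; split=> [|v _]; rewrite ?msize0// /peval meval0. Qed.

Lemma degree_lt_cst n c : degree_lt n.+1 (fun=> c).
Proof.
exists (mpolyC 3 c); split=> [|v _]; last by rewrite /peval mevalC.
by rewrite msizeC; case: (c == 0).
Qed.

Lemma degree_ltD n F G : degree_lt n F -> degree_lt n G -> degree_lt n (fun v => F v + G v).
Proof.
move=> [P [sP hP]] [P' [sP' hP']]; exists (P + P'); split=> [|v Sv].
  by rewrite (leq_trans (msizeD_le _ _))// geq_max sP sP'.
by rewrite /peval mevalD hP ?hP'.
Qed.

Lemma degree_ltZ n c F : degree_lt n F -> degree_lt n (fun v => c * F v).
Proof.
move=> [P [sP hP]]; exists (c *: P); split=> [|v Sv].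
  exact: leq_trans (msizeZ_le _ _) sP.
by rewrite /peval mevalZ hP.
Qed.

Lemma degree_lt_sum n I (s : seq I) (F : I -> 'rV[C]_3 -> C) :
  (forall i, degree_lt n (F i)) -> degree_lt n (fun v => \sum_(i <- s) F i v).
Proof.
move=> hF; elim: s => [|i s IH].
  by apply: degree_lt_ext (degree_lt0 n) => v _; rewrite big_nil.
by apply: degree_lt_ext (degree_ltD (hF i) IH) => v _; rewrite big_cons.
Qed.

Lemma msize_lform (a : 'I_3 -> C) : (msize (lform a) <= 2)%N.
Proof.
apply: (leq_trans (msize_sum _ _ _)); apply/bigmax_leqP => i _.
by rewrite mul_mpolyC (leq_trans (msizeZ_le _ _))// msizeX; have -> : mdeg (mnm1 i) = 1%N by exact: mdeg1.
Qed.

Lemma degree_lt_coord n j F : degree_lt n F -> degree_lt n.+1 (fun v => (v *m M) 0 j * F v).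
Proof.
move=> [P [sP hP]]; exists (lform (M ^~ j) * P); split=> [|v Sv].
  have [->|P0] := eqVneq P 0; first by rewrite mulr0 msize0.
  have [->|l0] := eqVneq (lform (M ^~ j)) 0; first by rewrite mul0r msize0.
  by rewrite msizeM// -subn1 leq_subLR add1n; exact: (leq_add (msize_lform _) sP).
rewrite /peval mevalM -/(peval _ v) -/(peval _ v) peval_lform hP//; congr (_ * _).
by rewrite mxE /covector; apply: eq_bigr => i _; rewrite mulrC.
Qed.

Lemma degree_lt_monomial a b : degree_lt (a + b).+1 (fun v => cx v ^+ a * cy v ^+ b).
Proof.
elim: a => [|a IH].
  elim: b => [|b IH].
    by apply: degree_lt_ext (degree_lt_cst 0 1) => v _; rewrite !expr0 mulr1.
  apply: degree_lt_ext (degree_lt_coord o1 IH) => v _.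
  by rewrite exprS mulrCA.
by apply: degree_lt_ext (degree_lt_coord o0 IH) => v _; rewrite exprS mulrA.
Qed.

(** On the cone z^2 = x y, parametrized by (s^2, t^2, s t), these monomials of
    degree k restrict to s^i t^(2k - i): modulo the equation they form a basis
    in degree k. Since z^2 = x y + 1 on the quadric, the quadric and the cone
    agree up to terms of lower degree. *)
Definition cone_monomial k i v := cx v ^+ i./2 * cy v ^+ (k.*2 - i)./2 * cz v ^+ odd i.

(** The combination of the monomials above that restricts to the binary form of
    degree 2k associated with p. The coefficients of p beyond degree 2k are
    ignored. *)
Definition cone_poly k p v := \sum_(i < k.*2.+1) p`_i * cone_monomial k i v.

Lemma cone_polyD k p q v : cone_poly k (p + q) v = cone_poly k p v + cone_poly k q v.
Proof. by rewrite -big_split; apply: eq_bigr => i _; rewrite coefD mulrDl. Qed.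

Lemma cone_polyZ k a p v : cone_poly k (a *: p) v = a * cone_poly k p v.
Proof. by rewrite /cone_poly mulr_sumr; apply: eq_bigr => i _; rewrite coefZ mulrA. Qed.

(** In the affine coordinate s, with t = 1, multiplication by y, x and z is
    multiplication by 1, X^2 and X; only multiplication by z uses the equation
    of the quadric and creates terms of lower degree. *)
Lemma cone_poly_y k p v : (size p <= k.*2.+1)%N -> cone_poly k.+1 p v = cy v * cone_poly k p v.
Proof.
move=> sp; rewrite /cone_poly doubleS 2!big_ord_recr /=.
rewrite (nth_default _ sp) mul0r addr0 (nth_default 0 (leq_trans sp (leqnSn _))) mul0r addr0.
rewrite mulr_sumr; apply: eq_bigr => i _; rewrite /cone_monomial doubleS.
have ik : (i <= k.*2)%N by rewrite -ltnS.
by rewrite (subSn (leq_trans ik (leqnSn _))) (subSn ik) /= exprS; ring.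
Qed.

Lemma cone_poly_x k p v : cone_poly k.+1 ('X^2 * p) v = cx v * cone_poly k p v.
Proof.
rewrite /cone_poly doubleS 2!big_ord_recl !coefXnM /= !mul0r !add0r.
rewrite mulr_sumr; apply: eq_bigr => i _; rewrite /cone_monomial coefXnM /= /bump /=.
by rewrite !add1n /= negbK !subSS subn0 exprS; ring.
Qed.

Lemma cone_poly_z k p : (size p <= k.*2.+1)%N -> exists2 G, degree_lt k.+1 G &
  forall v, S v -> cz v * cone_poly k p v = cone_poly k.+1 ('X * p) v + G v.
Proof.
move=> sp.
exists (fun v => \sum_(i < k.*2.+1) (if odd i then p`_i *
   (cx v ^+ i./2 * cy v ^+ (k.*2 - i)./2) else 0)).
  apply: degree_lt_sum => i; case io : (odd i); last exact: degree_lt0.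
  apply: degree_ltZ; apply: degree_ltW (degree_lt_monomial _ _).
  have := ltn_ord i; rewrite ltnS; lia.
move=> v Sv.
have -> : cone_poly k.+1 ('X * p) v = \sum_(i < k.*2.+1) p`_i * cone_monomial k.+1 i.+1 v.
  rewrite /cone_poly doubleS big_ord_recl coefXM /= mul0r add0r big_ord_recr /=.
  rewrite coefXM /= (nth_default _ sp) mul0r addr0.
  by apply: eq_bigr => i _; rewrite coefXM /bump /= add1n.
rewrite /cone_poly mulr_sumr -big_split /=; apply: eq_bigr => i _.
rewrite /cone_monomial doubleS /=.
have ik : (i <= k.*2)%N by rewrite -ltnS.
rewrite subSS.
case: ifP => io /=; last first.
  rewrite expr0 expr1 mulr1 uphalf_half io add0n.
  have -> : ((k.*2.+1 - i)./2 = (k.*2 - i)./2)%N by lia.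
  by ring.
rewrite expr0 mulr1 uphalf_half io add1n expr1.
have -> : ((k.*2.+1 - i)./2 = ((k.*2 - i)./2).+1)%N by lia.
rewrite !exprS.
have -> : cz v * (p`_i * (cx v ^+ i./2 * cy v ^+ (k.*2 - i)./2 * cz v)) =
  cz v ^+ 2 * (p`_i * (cx v ^+ i./2 * cy v ^+ (k.*2 - i)./2)) by ring.
by rewrite (quadric_coords Sv); ring.
Qed.

(** The leading part of a polynomial function on the quadric, computed on the
    cone. *)
Lemma cone_poly_top k F : degree_lt k.+1 F -> exists p, exists2 G, degree_lt k G &
  (size p <= k.*2.+1)%N /\ forall v, S v -> F v = cone_poly k p v + G v.
Proof.
elim: k F => [|k IH] F [P [sP hP]].
  exists (mcoeff (@mnm0 3) P)%:P, (fun=> 0); first exact: degree_lt0.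
  split=> [|v Sv]; first by rewrite size_polyC; case: (_ == _).
  rewrite hP// /cone_poly big_ord1 coefC eqxx /cone_monomial /= !expr0 !mulr1 addr0.
  by rewrite {1}(msize1_polyC sP) /peval mevalC.
have [c [q [sq hq]]] := mpoly_split sP.
have [uM _] := hQM.
pose Fj j v := \sum_i invmx M j i * peval (q i) v.
have hF v : S v -> F v = c + \sum_j (v *m M) 0 j * Fj j v.
  move=> Sv; rewrite hP// hq /peval mevalD mevalC raddf_sum; congr (_ + _).
  under [RHS]eq_bigr do rewrite mulr_sumr.
  rewrite exchange_big; apply: eq_bigr => i _ /=.
  rewrite mevalM mevalXU -/(peval _ v).
  have -> : v 0 i = ((v *m M) *m invmx M) 0 i by rewrite mulmxK.
  by rewrite mxE mulr_suml; apply: eq_bigr => j _; rewrite mulrA.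
have dF j : degree_lt k.+1 (Fj j).
  apply: degree_lt_sum => i; apply: degree_ltZ.
  by exists (q i).
have [p0 [G0 dG0 [sp0 h0]]] := IH _ (dF o0).
have [p1 [G1 dG1 [sp1 h1]]] := IH _ (dF o1).
have [p2 [G2 dG2 [sp2 h2]]] := IH _ (dF o2).
have [G dG hG] := cone_poly_z sp2.
exists ('X^2 * p0 + p1 + 'X * p2), (fun v => c + (cx v * G0 v + (cy v * G1 v + (cz v * G2 v + G v)))).
  apply: degree_ltD; first exact: degree_lt_cst.
  apply: degree_ltD; first exact: degree_lt_coord.
  apply: degree_ltD; first exact: degree_lt_coord.
  by apply: degree_ltD => //; exact: degree_lt_coord.
split=> [|v Sv].
  have s0 : (size ('X^2 * p0)%R <= k.+1.*2.+1)%N.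
    by rewrite (leq_trans (size_polyMleq _ _))// size_polyXn doubleS /= !ltnS.
  have s2 : (size ('X * p2)%R <= k.+1.*2.+1)%N.
    rewrite (leq_trans (size_polyMleq _ _))// size_polyX doubleS /=.
    exact: leq_trans (_ : _ <= k.*2.+2)%N _.
  have s1 : (size p1 <= k.+1.*2.+1)%N by rewrite (leq_trans sp1)// doubleS !ltnS leqW// leqW.
  rewrite (leq_trans (size_polyD _ _))// geq_max s2 andbT.
  by rewrite (leq_trans (size_polyD _ _))// geq_max s0 s1.
rewrite hF// sum3 h0// h1// h2// !cone_polyD cone_poly_x cone_poly_y//.
rewrite mulrDr mulrDr [cz v * (_ + _)]mulrDr hG//.
ring.
Qed.

(** A binary form of degree 2k is a product of 2k linear factors. Grouped in
    pairs they become k quadratic binary forms, and c + b s + a s^2 is the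
    restriction to the cone of the linear form a x + c y + b z. *)
Lemma cone_poly_product k p : (size p <= k.+1.*2.+1)%N ->
  exists (a : nat -> 'I_3 -> C), exists2 G, degree_lt k.+1 G &
  forall v, S v -> \prod_(j < k.+1) covector (a j) (v *m M) = cone_poly k.+1 p v + G v.
Proof.
elim: k p => [|k IH] p sp.
  exists (fun _ => f3 p`_2 p`_0 p`_1), (fun=> 0); first exact: degree_lt0.
  move=> v Sv; rewrite big_ord1 addr0 /covector sum3 /f3 /=.
  by rewrite /cone_poly !big_ord_recl big_ord0 /cone_monomial /= !expr0 !expr1; ring.
(* If p has small enough degree for the induction hypothesis, two of its roots
   are at infinity and q = 1, which stands for the linear form y. *)
have [q [r [sq sr ->]]] : exists q r : {poly C}, [/\ (size q <= 3)%N, (size r <= k.+1.*2.+1)%N & p = q * r].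
  have [sp'|sp'] := leqP (size p) k.+1.*2.+1.
    by exists 1, p; rewrite size_poly1 mul1r.
  have rt (u : {poly C}) : (1 < size u)%N -> exists b (u' : {poly C}), u = ('X - b%:P) * u' /\ size u' = (size u).-1.
    move=> su; have /closed_rootP[b /factor_theorem[u' hu]] : size u != 1%N by rewrite gtn_eqF.
    exists b, u'; split; first by rewrite mulrC.
    by rewrite hu size_Mmonic ?monicXsubC ?size_XsubC ?addn2//; apply: contraTneq su => u0;
      rewrite hu u0 mul0r size_poly0.
  have [b1 [u1 [hp s1]]] := rt p (leq_ltn_trans (ltn0Sn _) sp').
  have [|b2 [u2 [hu s2]]] := rt u1.
    rewrite s1; move: (size p) sp' => n; rewrite doubleS; lia.
  exists (('X - b1%:P) * ('X - b2%:P)), u2; rewrite hp {1}hu mulrA; split=> //.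
    by rewrite size_Mmonic ?monicXsubC ?size_XsubC// polyXsubC_eq0.
  rewrite s2 s1; move: (size p) sp => n; rewrite !doubleS; lia.
have [a [G dG hG]] := IH r sr.
exists (fun j => if j == k.+1 then f3 q`_2 q`_0 q`_1 else a j).
have [G' dG' hG'] := cone_poly_z sr.
exists (fun v => covector (f3 q`_2 q`_0 q`_1) (v *m M) * G v + q`_1 * G' v).
  apply: degree_ltD; last exact: degree_ltZ.
  apply: degree_lt_ext (_ : degree_lt _ (fun v => \sum_i f3 q`_2 q`_0 q`_1 i * ((v *m M) 0 i * G v))).
    by move=> v _; rewrite mulr_suml; apply: eq_bigr => i _; rewrite mulrA.
  by apply: degree_lt_sum => i; apply: degree_ltZ; exact: degree_lt_coord.
move=> v Sv; rewrite big_ord_recr /= eqxx.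
under eq_bigr => j _ do rewrite ltn_eqF//.
rewrite hG//.
have qE : q = (q`_0)%:P + q`_1 *: 'X + q`_2 *: 'X^2.
  apply/polyP => i; rewrite !coefD coefC !coefZ coefX coefXn.
  case: i => [|[|[|i]]] /=; rewrite ?mulr1 ?mulr0 ?addr0 ?add0r//.
  by rewrite nth_default// (leq_trans sq).
have -> : cone_poly k.+2 (q * r) v =
   q`_0 * cone_poly k.+2 r v + q`_1 * cone_poly k.+2 ('X * r) v + q`_2 * cone_poly k.+2 ('X^2 * r) v.
  by rewrite {1}qE !mulrDl mul_polyC -!scalerAl !cone_polyD !cone_polyZ.
rewrite (cone_poly_y _ sr) cone_poly_x /covector sum3 /f3 /=.
have -> : cone_poly k.+2 ('X * r) v = cz v * cone_poly k.+1 r v - G' v.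
  by rewrite hG'// addrK.
ring.
Qed.

Definition pullback_linear_form (a : 'I_3 -> C) : linear_form C :=
  DHomog (lform_homog (fun i => \sum_j M i j * a j)).

Lemma peval_pullback_linear_form a v :
  peval (mpoly_of_dhomog (pullback_linear_form a)) v = covector a (v *m M).
Proof.
rewrite /= peval_lform /covector.
under [RHS]eq_bigr do rewrite mxE mulr_sumr.
rewrite exchange_big /=; apply: eq_bigr => i _; rewrite mulr_suml.
by apply: eq_bigr => j _; ring.
Qed.

(** Induction on the degree: the leading part is the leading part of a product
    of linear forms, and what is left has smaller degree. *)
Lemma degree_lt_multipoles n F : degree_lt n.+1 F ->
  exists (c : C) (L : forall k : nat, 'I_k -> linear_form C), forall v, S v ->
    F v = c + \sum_(1 <= k < n.+1) \prod_(j < k) peval (mpoly_of_dhomog (L k j)) v.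
Proof.
elim: n F => [|n IH] F dF.
  have [P [sP hP]] := dF.
  exists (mcoeff (@mnm0 3) P), (fun _ _ => 0) => v Sv.
  by rewrite big_geq// addr0 hP// {1}(msize1_polyC sP) /peval mevalC.
have [p [G dG [sp hp]]] := cone_poly_top dF.
have [a [G' dG' hG']] := cone_poly_product sp.
have [c [L hL]] := IH (fun v => G v + (-1) * G' v) (degree_ltD dG (degree_ltZ (-1) dG')).
exists c, (fun (k : nat) (j : 'I_k) => if k == n.+1 then pullback_linear_form (a j) else L k j) => v Sv.
rewrite big_nat_recr//= eqxx addrA.
under eq_big_nat => k /andP[_ kn].
  under eq_bigr => j _ do rewrite (ltn_eqF kn).
  over.
rewrite -hL// hp//; under eq_bigr do rewrite peval_pullback_linear_form.
rewrite hG'//; ring.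
Qed.

Lemma quadric_multipoles (P : mpoly 3 C) n : (msize P <= n.+1)%N ->
  exists (c : C) (L : forall k : nat, 'I_k -> linear_form C), forall v, S v ->
    peval P v = c + \sum_(1 <= k < n.+1) \prod_(j < k) peval (mpoly_of_dhomog (L k j)) v.
Proof. by move=> sP; apply: degree_lt_multipoles; exists P. Qed.

End Multipoles.

Section MultipoleSets.
Local Open Scope quotient_scope.
Variable R : realType.
Local Notation C := (complexes R).

(** A product with a zero factor is represented by the added point. *)
Lemma multipole_bar_of k (L : 'I_k.+1 -> linear_form C) : exists w : multipole_bar C k.+1,
  multipole_bar_prod w = \prod_(j < k.+1) mpoly_of_dhomog (L j).
Proof.
have [[j Lj]|hL] := pselect (exists j, L j = 0).
  exists None => /=; rewrite (bigD1 j)//= Lj.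
  by rewrite (_ : mpoly_of_dhomog 0 = 0) ?mul0r.
have nz j : L j != 0 by apply/eqP => Lj; apply: hL; exists j.
pose t : {ffun 'I_k.+1 -> nonzero_form C} := [ffun j => exist _ (L j) (nz j)].
exists (Some (\pi_({eq_quot @multipole_rel C k.+1}) t)) => /=.
by rewrite multipole_prod_pi; apply: eq_bigr => j _; rewrite ffunE.
Qed.

Lemma multipoles_poly_of n c (L : forall k : nat, 'I_k -> linear_form C) :
  exists w : forall j : 'I_n.+1, multipole_bar C j, forall v,
  peval (multipoles_poly w) v =
    c + \sum_(1 <= k < n.+1) \prod_(j < k) peval (mpoly_of_dhomog (L k j)) v.
Proof.
have hw k : exists w : multipole_bar C k,
   multipole_bar_prod w = if k is 0 then mpolyC 3 c else \prod_(j < k) mpoly_of_dhomog (L k j).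
  by case: k => [|k]; [exists c|exact: multipole_bar_of].
pose w k := projT1 (cid (hw k)).
have wE k := projT2 (cid (hw k)).
exists (fun j => w j) => v.
rewrite /multipoles_poly big_ord_recl (wE 0%N) /peval mevalD mevalC; congr (_ + _).
rewrite raddf_sum big_add1 big_mkord; apply: eq_bigr => i _.
by rewrite (wE _) /= rmorph_prod.
Qed.

End MultipoleSets.

(** * Power series expansion of normally convergent series *)

Section PowerSeries.
Variable R : realType.
Local Notation C := (complexes R).
Implicit Types (p q : mpoly 3 C) (v h : 'rV[C]_3) (m : multinom 3) (e r : R) (k n N : nat).

Lemma big_bmultinom (V : nmodType) N (f : multinom 3 -> V) (s : seq (multinom 3)) :
  uniq s -> (forall m, (m \in s) = (mdeg m < N)%N) ->
  \sum_(m : bmultinom 3 N) f m = \sum_(m <- s) f m.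
Proof.
move=> us hs.
have -> : \sum_(m : bmultinom 3 N) f m = \sum_(m <- map val (index_enum (bmultinom 3 N))) f m.
  by rewrite big_map.
apply: perm_big; apply: uniq_perm => //.
  by rewrite map_inj_uniq ?index_enum_uniq//; exact: val_inj.
move=> m; rewrite hs; apply/mapP/idP => [[m' _ ->]|mN]; first exact: bmdeg.
by exists (BMultinom mN) => //; rewrite mem_index_enum.
Qed.

Lemma big_bmultinom_le (V : nmodType) N K (f : multinom 3 -> V) : (N <= K)%N ->
  \sum_(m : bmultinom 3 N) f m = \sum_(m : bmultinom 3 K | (mdeg m < N)%N) f m.
Proof.
move=> NK.
rewrite (@big_bmultinom _ _ _ [seq m <- map val (index_enum (bmultinom 3 K)) | (mdeg m < N)%N]).
- by rewrite big_filter big_map.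
- by rewrite filter_uniq// map_inj_uniq ?index_enum_uniq//; exact: val_inj.
move=> m; rewrite mem_filter; apply/andb_idr => mN.
by apply/mapP; exists (BMultinom (leq_trans mN NK)); rewrite // mem_index_enum.
Qed.

Lemma big_bmultinom2 (V : nmodType) (f : multinom 3 -> V) :
  \sum_(m : bmultinom 3 2) f m = f (@mnm0 3) + \sum_i f (mnm1 i).
Proof.
rewrite (@big_bmultinom _ _ _ (@mnm0 3 :: [seq mnm1 i | i <- index_enum 'I_3])).
- by rewrite big_cons big_map.
- rewrite /= map_inj_uniq ?index_enum_uniq ?andbT.
    apply/mapP => -[i _ h]; have := congr1 mdeg h.
    by have -> : mdeg (mnm1 i) = 1%N by [exact: mdeg1]; rewrite mdeg0.
  by move=> i j /eqP; rewrite eq_mnm1 => /eqP.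
move=> m; rewrite inE; apply/orP/idP => [[/eqP ->|/mapP[i _ ->]]|].
- by rewrite mdeg0.
- by have -> : mdeg (mnm1 i) = 1%N by exact: mdeg1.
case md : (mdeg m) => [|[|//]] _.
  by left; rewrite -mdeg_eq0 md.
right; have /mdeg1P[i /eqP ->] : mdeg m == 1%N by rewrite md.
by apply/mapP; exists i => //; rewrite mem_index_enum.
Qed.

Definition vmon h m : C := \prod_(i < 3) h 0 i ^+ m i.

Lemma peval_bmultinom p K v : (msize p <= K)%N ->
  peval p v = \sum_(m : bmultinom 3 K) mcoeff m p * vmon v m.
Proof.
move=> sp; rewrite {1}(mpolywE sp) /peval raddf_sum; apply: eq_bigr => m _ /=.
by rewrite mevalZ mevalX.
Qed.

Lemma geometric_half_le K : \sum_(j < K) 2^-1 ^+ j <= 2 :> R.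
Proof.
have h : (2^-1 - 1) * \sum_(j < K) 2^-1 ^+ j = 2^-1 ^+ K - 1 :> R by rewrite -subrX1.
have : 0 < 2^-1 ^+ K :> R by rewrite exprn_gt0// invr_gt0.
move: h; set a := \sum_(_ < _) _; set b := 2^-1 ^+ K; lra.
Qed.

(** The sum over all multi-indices factors as the cube of a geometric
    series. *)
Lemma sum_half_le K : \sum_(m : bmultinom 3 K) 2^-1 ^+ mdeg m <= 8 :> R.
Proof.
case: K => [|K].
  by rewrite big1// => m _; have := bmdeg m; rewrite ltn0.
pose phi (m : bmultinom 3 K.+1) : {ffun 'I_3 -> 'I_K.+1} := [ffun i => inord (m i)].
have mK (m : bmultinom 3 K.+1) i : (m i < K.+1)%N.
  by rewrite (leq_ltn_trans _ (bmdeg m))// mdegE (bigD1 i)//= leq_addr.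
have inj : injective phi.
  move=> m m' /ffunP hm; apply: val_inj; apply/mnmP => i.
  by have := hm i; rewrite !ffunE => /(congr1 val); rewrite /= !inordK.
pose g (f : {ffun 'I_3 -> 'I_K.+1}) : R := \prod_i 2^-1 ^+ f i.
have g0 f : 0 <= g f by apply: prodr_ge0 => i _; rewrite exprn_ge0// invr_ge0.
have -> : \sum_(m : bmultinom 3 K.+1) 2^-1 ^+ mdeg m = \sum_(f in phi @: [set: bmultinom 3 K.+1]%SET) g f.
  rewrite big_imset /=; last by move=> ? ? _ _; exact: inj.
  apply: eq_big => [m|m _]; first by rewrite finset.inE.
  rewrite /g mdegE -prodrXr; apply: eq_bigr => i _.
  by rewrite ffunE inordK.
apply: (@le_trans _ _ (\sum_f g f)).
  rewrite [leRHS](bigID (mem (phi @: [set: bmultinom 3 K.+1]%SET))) /= lerDl.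
  by apply: sumr_ge0.
rewrite -(bigA_distr_bigA (fun _ (j : 'I_K.+1) => 2^-1 ^+ j)) /=.
rewrite prodr_const card_ord (_ : 8 = 2 ^+ 3); last by rewrite -natrX.
by rewrite ler_pXn2r ?nnegrE ?geometric_half_le// sumr_ge0// => j _; rewrite exprn_ge0// invr_ge0.
Qed.

(** Averaging over roots of unity in each variable isolates a coefficient; an
    average is bounded by the supremum on the polycircle. *)
Lemma cauchy_estimate p r B m : 0 < r ->
  (forall v, vmod v <= r -> cmod (peval p v) <= B) ->
  cmod (mcoeff m p) * r ^+ mdeg m <= B.
Proof.
move=> r0 hB.
pose K := (msize p + mdeg m)%N.
have small (m' : multinom 3) i : (mdeg m' <= K)%N -> (m' i < 2 ^ K)%N.
  move=> mK; rewrite (leq_ltn_trans _ (ltn_expl K (ltnSn 1)))//.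
  by rewrite (leq_trans _ mK)// mdegE (bigD1 i)//= leq_addr.
have mK i : (m i < 2 ^ K)%N by apply: small; exact: leq_addl.
pose e (i : 'I_3) (m' : multinom 3) (t : C) := t ^+ m' i * t^-1 ^+ m i.
have cavg_e i m' : m' \in msupp p -> cavg K (e i m') = (m' i == m i)%:R.
  move=> mp; apply: cavg_monomial => //; apply: small.
  by rewrite (leq_trans (ltnW (msize_mdeg_lt mp)))// leq_addr.
have reassoc (x y z t : C) : x * (y * (z * t)) = x * (y * z) * t by ring.
pose W t0 t1 t2 := peval p (v3 (r%:C * t0) (r%:C * t1) (r%:C * t2)) *
  (t0^-1 ^+ m o0 * t1^-1 ^+ m o1 * t2^-1 ^+ m o2).
have WE t0 t1 t2 : W t0 t1 t2 = \sum_(m' <- msupp p)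
   (mcoeff m' p * r%:C ^+ mdeg m') * (e o0 m' t0 * (e o1 m' t1 * e o2 m' t2)).
  rewrite /W /peval mevalE mulr_suml; apply: eq_bigr => m' _.
  rewrite -!mulrA; congr (_ * _).
  have -> : \prod_(i < 3) v3 (r%:C * t0) (r%:C * t1) (r%:C * t2) 0 i ^+ m' i =
     (r%:C * t0) ^+ m' o0 * (r%:C * t1) ^+ m' o1 * (r%:C * t2) ^+ m' o2.
    rewrite !big_ord_recl big_ord0 mulr1 mulrA !mxE /=.
    by congr (_ ^+ m' _ * _ ^+ m' _ * _ ^+ m' _); apply: val_inj.
  by rewrite mdegE sum3 !exprD !exprMn /e; ring.
have mean : cavg K (fun t0 => cavg K (fun t1 => cavg K (fun t2 => W t0 t1 t2))) =
    mcoeff m p * r%:C ^+ mdeg m.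
  have E2 t0 t1 : cavg K (fun t2 => W t0 t1 t2) = \sum_(m' <- msupp p)
     (mcoeff m' p * r%:C ^+ mdeg m' * (m' o2 == m o2)%:R) * (e o0 m' t0 * e o1 m' t1).
    under [in LHS]eq_fun do rewrite WE.
    rewrite cavg_sum big_seq [RHS]big_seq; apply: eq_bigr => m' mp.
    have -> : (fun t : C => mcoeff m' p * r%:C ^+ mdeg m' * (e o0 m' t0 * (e o1 m' t1 * e o2 m' t))) =
      (fun t => (mcoeff m' p * r%:C ^+ mdeg m' * (e o0 m' t0 * e o1 m' t1)) * e o2 m' t).
      by apply: funext => t; exact: reassoc.
    by rewrite cavgZ cavg_e//; ring.
  have E1 t0 : cavg K (fun t1 => cavg K (fun t2 => W t0 t1 t2)) = \sum_(m' <- msupp p)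
     (mcoeff m' p * r%:C ^+ mdeg m' * (m' o2 == m o2)%:R * (m' o1 == m o1)%:R) * e o0 m' t0.
    under [in LHS]eq_fun do rewrite E2.
    rewrite cavg_sum big_seq [RHS]big_seq; apply: eq_bigr => m' mp.
    have -> : (fun t : C => mcoeff m' p * r%:C ^+ mdeg m' * (m' o2 == m o2)%:R * (e o0 m' t0 * e o1 m' t)) =
      (fun t => (mcoeff m' p * r%:C ^+ mdeg m' * (m' o2 == m o2)%:R * e o0 m' t0) * e o1 m' t).
      by apply: funext => t; rewrite [LHS]mulrA.
    by rewrite cavgZ cavg_e//; ring.
  under [in LHS]eq_fun do rewrite E1.
  rewrite cavg_sum.
  have -> : mcoeff m p * r%:C ^+ mdeg m = \sum_(m' <- msupp p) (if m' == m then mcoeff m p * r%:C ^+ mdeg m else 0).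
    have [mp|mp] := boolP (m \in msupp p).
      rewrite (bigD1_seq m) ?msupp_uniq//= eqxx big1 ?addr0// => m' /negPf -> //.
    rewrite big_seq big1 => [|m' mp']; first by rewrite memN_msupp_eq0// mul0r.
    by case: eqP mp => // <-; rewrite mp'.
  rewrite big_seq [RHS]big_seq; apply: eq_bigr => m' mp.
  rewrite cavgZ cavg_e//.
  have [->|/eqP mm] := eqVneq m' m; first by rewrite !eqxx !mulr1.
  have [h2|] := eqVneq (m' o2) (m o2); last by rewrite !(mulr0, mul0r).
  have [h1|] := eqVneq (m' o1) (m o1); last by rewrite !(mulr0, mul0r).
  have [h0|] := eqVneq (m' o0) (m o0); last by rewrite !(mulr0, mul0r).
  exfalso; apply: mm; apply/mnmP => -[[|[|[|]]]] //= i.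
  - by rewrite (_ : Ordinal i = o0)//; exact: val_inj.
  - by rewrite (_ : Ordinal i = o1)//; exact: val_inj.
  - by rewrite (_ : Ordinal i = o2)//; exact: val_inj.
have -> : cmod (mcoeff m p) * r ^+ mdeg m = cmod (mcoeff m p * r%:C ^+ mdeg m).
  by rewrite cmodM cmodX cmod_real gtr0_norm.
rewrite -mean; apply: cavg_le => t0 h0; apply: cavg_le => t1 h1; apply: cavg_le => t2 h2.
rewrite /W cmodM [X in _ * X]cmodM [X in _ * (X * _)]cmodM !cmodX !cmodV h0 h1 h2.
rewrite invr1 !expr1n !mulr1; apply: hB; apply: vmod_v3_le;
  by rewrite cmodM cmod_real ?h0 ?h1 ?h2 mulr1 gtr0_norm.
Qed.

Definition mshift (a : 'rV[C]_3) p : mpoly 3 C :=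
  comp_mpoly [tuple @mpolyX 3 C (mnm1 i) + mpolyC 3 (a 0 i) | i < 3] p.

Lemma peval_mshift a p v : peval (mshift a p) v = peval p (a + v).
Proof.
rewrite /peval /mshift comp_mpoly_meval; apply: meval_eq => i.
by rewrite tnth_mktuple mevalD mevalXU mevalC mxE addrC.
Qed.

Lemma bounded_series_cvg (x : nat -> C) (Mk : nat -> R) B :
  (forall n, \sum_(0 <= k < n) Mk k <= B) -> (forall k, cmod (x k) <= Mk k) ->
  exists l, forall e : R, 0 < e -> exists n0, forall n, (n0 <= n)%N ->
    cmod (\sum_(0 <= k < n) x k - l) <= e.
Proof.
move=> hB hx; apply: cauchy_cvgC => e e0.
have M0 k : 0 <= Mk k := le_trans (cmod_ge0 _) (hx k).
pose u n := \sum_(0 <= k < n) Mk k.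
have ndu : nondecreasing_seq u.
  apply/nondecreasing_seqP => n; by rewrite /u big_nat_recr//= lerDl.
have cu : cvgn u.
  by apply: nondecreasing_is_cvgn => //; exists B => _ [n _ <-]; exact: hB.
have /cvg_ex[l /cvgrPdistC_le hl] := cu.
have e2 : 0 < e / 2 by rewrite divr_gt0.
have [n0 _ h0] := hl _ e2.
have key (n m : nat) : (n0 <= n)%N -> (n <= m)%N ->
    cmod (\sum_(0 <= k < m) x k - \sum_(0 <= k < n) x k) <= e.
  move=> nn nm; rewrite (@big_cat_nat _ _ _ n 0 m)//= addrAC subrr add0r.
  rewrite (le_trans (cmod_sum _ _ _))//.
  have : \sum_(n <= k < m) Mk k = u m - u n.
    by rewrite /u (@big_cat_nat _ _ _ n 0 m)//= addrAC subrr add0r.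
  have h1 := h0 n nn; have h2 := h0 m (leq_trans nn nm).
  move=> h; apply: (@le_trans _ _ (u m - u n)); first by rewrite -h; apply: ler_sum.
  by move: h1 h2; rewrite /= !ler_norml => /andP[? ?] /andP[? ?]; lra.
exists n0 => n m nn nm; have [mn|/ltnW nm'] := leqP m n; first exact: key.
by rewrite cmodBC; exact: key.
Qed.

(** Cauchy's estimates bound the coefficients of all partial sums by B / r^|m|,
    and each coefficient converges, being itself a dominated series. The
    remainder of order N of each partial sum at h, with |h| at most r th, is at
    most B times the sum of th^|m| over |m| >= N; both facts pass to the
    limit. *)
Theorem normal_series_expansion (P : nat -> mpoly 3 C) (Mk : nat -> R) B r a F :
  0 < r -> (forall n, \sum_(0 <= k < n) Mk k <= B) ->
  (forall k h, vmod h <= r -> cmod (peval (P k) (a + h)) <= Mk k) ->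
  (forall h, vmod h <= r -> forall e : R, 0 < e -> exists n0, forall n, (n0 <= n)%N ->
    cmod (\sum_(0 <= k < n) peval (P k) (a + h) - F (a + h)) <= e) ->
  exists c : multinom 3 -> C, (forall m, cmod (c m) * r ^+ mdeg m <= B) /\
    forall th h N, 0 <= th <= 4^-1 -> vmod h <= r * th ->
      cmod (F (a + h) - \sum_(m : bmultinom 3 N) c m * vmon h m) <= 8 * B * (2 * th) ^+ N.
Proof.
move=> r0 hB hP hF.
pose p n := \sum_(0 <= k < n) mshift a (P k).
have pE n h : peval (p n) h = \sum_(0 <= k < n) peval (P k) (a + h).
  by rewrite /p /peval raddf_sum; apply: eq_bigr => k _ /=; rewrite -/(peval _ h) peval_mshift.
have pB n h : vmod h <= r -> cmod (peval (p n) h) <= B.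
  move=> hr; rewrite pE (le_trans (cmod_sum _ _ _))// (le_trans _ (hB n))//.
  by apply: ler_sum => k _; exact: hP.
have cp n m : cmod (mcoeff m (p n)) * r ^+ mdeg m <= B.
  by apply: cauchy_estimate => // v; exact: pB.
have rm m : 0 < r ^+ mdeg m by rewrite exprn_gt0.
have /choice[c hc] : forall m, exists l, forall e : R, 0 < e -> exists n0, forall n,
    (n0 <= n)%N -> cmod (mcoeff m (p n) - l) <= e.
  move=> m.
  have [l hl] : exists l, forall e : R, 0 < e -> exists n0, forall n, (n0 <= n)%N ->
      cmod (\sum_(0 <= k < n) mcoeff m (mshift a (P k)) - l) <= e.
    apply: (@bounded_series_cvg _ (fun k => Mk k / r ^+ mdeg m) (B / r ^+ mdeg m)).
      by move=> n; rewrite -mulr_suml ler_pM2r ?invr_gt0.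
    move=> k; rewrite ler_pdivlMr//; apply: cauchy_estimate => // v vr.
    by rewrite peval_mshift; exact: hP.
  by exists l => e /hl[n0 h0]; exists n0 => n /h0; rewrite /p raddf_sum.
exists c; split=> [m|].
  apply/ler_addgt0Pr => e e0.
  have [n0 /(_ _ (leqnn _)) h0] := hc m (e / r ^+ mdeg m) ltac:(by rewrite divr_gt0).
  rewrite -ler_pdivlMr// mulrDl.
  rewrite -(subrK (mcoeff m (p n0)) (c m)) (le_trans (cmodD _ _))// addrC lerD//.
    by rewrite ler_pdivlMr.
  by rewrite cmodBC.
move=> th h N /andP[th0 th4] hr.
have hr' : vmod h <= r by rewrite (le_trans hr)// ler_piMr ?(ltW r0)//; lra.
have B0 : 0 <= B by have := hB 0%N; rewrite big_geq.
have part n : cmod (peval (p n) h - \sum_(m : bmultinom 3 N) mcoeff m (p n) * vmon h m)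
    <= 8 * B * (2 * th) ^+ N.
  pose K := (N + msize (p n))%N.
  rewrite (@peval_bmultinom _ K) ?leq_addl//.
  rewrite (@big_bmultinom_le _ N K (fun m => mcoeff m (p n) * vmon h m)) ?leq_addr//.
  rewrite (bigID (fun m : bmultinom 3 K => (mdeg m < N)%N)) /= addrAC subrr add0r.
  rewrite (le_trans (cmod_sum _ _ _))//.
  apply: (@le_trans _ _ (\sum_(m : bmultinom 3 K) B * (2 * th) ^+ N * 2^-1 ^+ mdeg m)).
    rewrite [leRHS](bigID (fun m : bmultinom 3 K => ~~ (mdeg m < N)%N)) /=.
    have t0 : 0 <= (2 * th) ^+ N by rewrite exprn_ge0// mulr_ge0.
    rewrite ler_wpDr//.
      by apply: sumr_ge0 => m _; rewrite !mulr_ge0// exprn_ge0// invr_ge0.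
    apply: ler_sum => m; rewrite -leqNgt => Nm.
    have mon : cmod (vmon h m) <= r ^+ mdeg m * th ^+ mdeg m.
      rewrite cmod_prod -exprMn mdegE -prodrXr.
      apply: ler_prod => i _; rewrite cmodX exprn_ge0 ?cmod_ge0//=.
      apply: lerXn2r; rewrite ?nnegrE ?cmod_ge0 ?mulr_ge0 ?(ltW r0)//.
      exact: le_trans (cmod_le_vmod h i) hr.
    rewrite cmodM (le_trans (ler_wpM2l (cmod_ge0 _) mon))// mulrA.
    rewrite (le_trans (ler_wpM2r (exprn_ge0 _ th0) (cp n m)))// -mulrA ler_wpM2l//.
    (* Half of the decay is kept for the summation over m. *)
    have -> : th ^+ mdeg m = (2 * th) ^+ mdeg m * 2^-1 ^+ mdeg m.
      by rewrite -exprMn mulrAC mulfV ?mul1r// pnatr_eq0.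
    rewrite ler_wpM2r ?exprn_ge0 ?invr_ge0//.
    rewrite -(subnK Nm) exprD ler_piMl// exprn_ile1 ?mulr_ge0//; lra.
  rewrite -mulr_sumr (_ : 8 * B * _ = B * (2 * th) ^+ N * 8); last by ring.
  by rewrite ler_wpM2l ?sum_half_le// mulr_ge0// exprn_ge0// mulr_ge0.
apply/ler_addgt0Pr => e e0.
have e2 : 0 < e / 2 by rewrite divr_gt0.
have [n1 h1] := hF h hr' _ e2.
pose T n := \sum_(m : bmultinom 3 N) mcoeff m (p n) * vmon h m.
have [n2 h2] : exists n2, forall n, (n2 <= n)%N ->
    cmod (T n - \sum_(m : bmultinom 3 N) c m * vmon h m) <= e / 2.
  have finite_cvg (s : seq (bmultinom 3 N)) d : 0 < d -> exists n2, forall n, (n2 <= n)%N ->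
      cmod (\sum_(m <- s) mcoeff m (p n) * vmon h m - \sum_(m <- s) c m * vmon h m) <= d.
    elim: s d => [|m s IH] d d0.
      by exists 0%N => n _; rewrite !big_nil subrr cmod0 ltW.
    have [n2 H2] := IH (d / 2) ltac:(by rewrite divr_gt0).
    have K0 : 0 < cmod (vmon h m) + 1 by rewrite ltr_wpDl ?cmod_ge0.
    have [n3 H3] := hc m (d / 2 / (cmod (vmon h m) + 1)) ltac:(by rewrite !divr_gt0).
    exists (n2 + n3)%N => n nn; rewrite !big_cons opprD addrACA (le_trans (cmodD _ _))//.
    rewrite (splitr d) lerD//; last exact: H2 n (leq_trans (leq_addr _ _) nn).
    rewrite -mulrBl cmodM; have := H3 n (leq_trans (leq_addl _ _) nn); rewrite ler_pdivlMr// => H3'.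
    by rewrite (le_trans _ H3')// ler_wpM2l ?cmod_ge0// lerDl.
  exact: finite_cvg.
have := h1 (n1 + n2)%N (leq_addr _ _); have := h2 (n1 + n2)%N (leq_addl _ _).
have := part (n1 + n2)%N; rewrite /T -pE.
set A := peval _ _; set D := \sum_(m : _) mcoeff _ _ * _; set E := \sum_(m : _) _.
move=> H1 H2; rewrite cmodBC => H3.
have -> : F (a + h) - E = (F (a + h) - A) + (A - D) + (D - E) by ring.
rewrite (le_trans (cmodD _ _))// (le_trans (lerD (cmodD _ _) (lexx _)))//.
by move: H1; lra.
Qed.

End PowerSeries.

(** * Sums of normally convergent series *)

Section NormalSeries.
Variable R : realType.
Local Notation C := (complexes R).
Implicit Types (p : mpoly 3 C) (u v h a : 'rV[C]_3) (e r : R) (k n N : nat) (P : nat -> mpoly 3 C).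

Definition csum (x : nat -> C) (l : C) := forall e : R, 0 < e -> exists n0,
  forall n, (n0 <= n)%N -> cmod (\sum_(0 <= k < n) x k - l) <= e.

Lemma csum_unique x l l' : csum x l -> csum x l' -> l = l'.
Proof.
move=> h h'; apply/eqP; rewrite -subr_eq0 -cmod_eq0; apply/eqP/le_anti.
rewrite cmod_ge0 andbT; apply/ler_addgt0Pr => e e0; rewrite add0r.
have [m1 h1] := h (e / 2) ltac:(by rewrite divr_gt0).
have [m2 h2] := h' (e / 2) ltac:(by rewrite divr_gt0).
have := h1 (m1 + m2)%N (leq_addr _ _); have := h2 (m1 + m2)%N (leq_addl _ _).
set b := \sum_(_ <= _ < _) _ => H2 H1.
have -> : l - l' = (b - l') - (b - l) by ring.
rewrite (le_trans (cmodB _ _))//; lra.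
Qed.

(** The sum of a series of polynomials, with the value 0 where it diverges:
    this total function serves as the extension in both the holomorphic and the
    real case. *)
Definition psum P u : C := xget 0 [set l | csum (fun k => peval (P k) u) l].

Lemma psumE P u l : csum (fun k => peval (P k) u) l -> psum P u = l.
Proof.
move=> h; have H : csum (fun k => peval (P k) u) (psum P u).
  by rewrite /psum; case: xgetP => [x _ //|/(_ l)].
exact: csum_unique H h.
Qed.

(** Normal convergence on the ball with centre a and radius r: the terms are
    dominated by those of a convergent series of constants. *)
Definition normal_on P a r (Mk : nat -> R) B :=
  (forall n, \sum_(0 <= k < n) Mk k <= B) /\
  (forall k h, vmod h <= r -> cmod (peval (P k) (a + h)) <= Mk k).

Definition normal_at P a := exists r, exists2 Mk, 0 < r & exists B, normal_on P a r Mk B.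

Lemma normal_on_csum P a r Mk B h : normal_on P a r Mk B -> vmod h <= r ->
  csum (fun k => peval (P k) (a + h)) (psum P (a + h)).
Proof.
move=> [hB hP] hr; have [l hl] := bounded_series_cvg hB (hP ^~ h ^~ hr).
by rewrite (psumE hl).
Qed.

Lemma normal_at_near P a r Mk B u : normal_on P a r Mk B -> 0 < r -> vmod (u - a) < r ->
  normal_at P u.
Proof.
move=> [hB hP] r0 ua; exists (r - vmod (u - a)), Mk; first by rewrite subr_gt0.
exists B; split=> // k h hr.
have -> : u + h = a + (u - a + h) by rewrite addrA addrCA subrr addr0.
by apply: hP; rewrite (le_trans (vmodD _ _))// addrC -lerBrDr.
Qed.

(** The expansion with N = 2 is the definition of differentiability. *)
Lemma expansion_vdiff (F : 'rV[C]_3 -> C) a (c : multinom 3 -> C) r B : 0 < r -> 0 <= B ->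
  (forall th h N, 0 <= th <= 4^-1 -> vmod h <= r * th ->
    cmod (F (a + h) - \sum_(m : bmultinom 3 N) c m * vmon h m) <= 8 * B * (2 * th) ^+ N) ->
  vdiff setT F a.
Proof.
move=> r0 B0 hF.
have S2 h : \sum_(m : bmultinom 3 2) c m * vmon h m = c (@mnm0 3) + covector (fun i => c (mnm1 i)) h.
  rewrite (@big_bmultinom2 _ (fun m => c m * vmon h m)); congr (_ + _).
    by rewrite /vmon big1 ?mulr1// => i _; rewrite mnm0E expr0.
  apply: eq_bigr => i _; congr (_ * _).
  rewrite /vmon (bigD1 i)//= mnm1E eqxx expr1 big1 ?mulr1// => j ji.
  by rewrite mnm1E eq_sym (negPf ji) expr0.
have Fa : F a = c (@mnm0 3).
  have := hF 0 0 2 ltac:(by rewrite lexx invr_ge0 ler0n) ltac:(by rewrite vmod0 mulr0).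
  rewrite S2 addr0 linear0 addr0 mulr0 expr0n mulr0.
  by move=> h; apply/eqP; rewrite -subr_eq0 -cmod_eq0 eq_le h cmod_ge0.
exists (fun i => c (mnm1 i)) => e e0.
have K0 : 0 < 32 * B + 1 by rewrite ltr_wpDl// mulr_ge0.
exists (Num.min (r / 4) (e * r ^+ 2 / (32 * B + 1))).
  by rewrite lt_min !divr_gt0// mulr_gt0// exprn_gt0.
move=> v _; rewrite lt_min ltr_pdivlMr// ltr_pdivlMr// => /andP[h1 h2].
set h := v - a in h1 h2 *.
have -> : v = a + h by rewrite /h addrC subrK.
have h0 := vmod_ge0 h.
have := hF (vmod h / r) h 2 _ _.
rewrite S2 opprD addrA -Fa => /(_ _ _)/le_trans; apply.
- apply/andP; split; first by rewrite divr_ge0// ltW.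
  by rewrite ler_pdivrMr//; lra.
- by rewrite mulrC divfK// gt_eqF.
have -> : 8 * B * (2 * (vmod h / r)) ^+ 2 = 32 * B * vmod h / r ^+ 2 * vmod h.
  by field; rewrite gt_eqF.
rewrite ler_wpM2r// ler_pdivrMr ?exprn_gt0//; lra.
Qed.

Lemma normal_at_expansion P a : normal_at P a -> exists (c : multinom 3 -> C) (r B : R),
  [/\ 0 < r, 0 <= B, (forall m, cmod (c m) * r ^+ mdeg m <= B) &
  forall th h N, 0 <= th <= 4^-1 -> vmod h <= r * th ->
    cmod (psum P (a + h) - \sum_(m : bmultinom 3 N) c m * vmon h m) <= 8 * B * (2 * th) ^+ N].
Proof.
move=> [r [Mk r0 [B hN]]].
have [hB hP] := hN.
have [c [hc hF]] := normal_series_expansion r0 hB hP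
  (fun h hr => normal_on_csum hN hr).
exists c, r, B; split=> //.
by have := hB 0%N; rewrite big_geq.
Qed.

(** The sum has a power series expansion at each point of a neighbourhood,
    because normal convergence is an open condition. *)
Lemma normal_holomorphic (X : set 'rV[C]_3) P : (forall a, X a -> normal_at P a) ->
  holomorphic_on X (psum P).
Proof.
move=> hX a /hX[r [Mk r0 [B hN]]].
exists [set u | vmod (u - a) < r], (psum P); split=> //.
- exact: open_vball.
- by rewrite /= subrr vmod0.
move=> u /= /(normal_at_near hN r0) /normal_at_expansion[c [r' [B' [r'0 B'0 _ hF]]]].
by apply/differentiable_vdiff; exact: expansion_vdiff r'0 B'0 hF.
Qed.

(** The expansion at a, on a quarter of the radius, where the coefficients are
    dominated by those of a geometric series. *)
Lemma normal_analytic (X : set 'rV[C]_3) P : (forall a, X a -> normal_at P a) ->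
  analytic_on X (psum P).
Proof.
move=> hX a /hX /normal_at_expansion[c [r [B [r0 B0 hc hF]]]].
have r4 : 0 < r / 4 by rewrite divr_gt0.
exists c, (r / 4)%:C; split; first by rewrite ltcR.
  exists (B * 8)%:C => N.
  have -> : \sum_(m : bmultinom 3 N) `|c m| * (r / 4)%:C ^+ mdeg m =
     (\sum_(m : bmultinom 3 N) cmod (c m) * (r / 4) ^+ mdeg m)%:C.
    by rewrite rmorph_sum; apply: eq_bigr => m _; rewrite cmodE [RHS]rmorphM [in RHS]rmorphXn.
  rewrite lecR (le_trans _ (ler_wpM2l B0 (sum_half_le R N)))// mulr_sumr.
  apply: ler_sum => m _.
  rewrite exprMn mulrA ler_pM ?mulr_ge0 ?cmod_ge0 ?exprn_ge0 ?invr_ge0 ?(ltW r0)//.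
  by apply: lerXn2r; rewrite ?nnegrE ?invr_ge0// lef_pV2 ?posrE// ler_nat.
move=> u Xu; rewrite vmodE ltcR => ur.
apply/cvgC_P => e e0.
pose th := vmod (u - a) / r.
have th0 : 0 <= th by rewrite divr_ge0 ?vmod_ge0 ?ltW.
have th4 : th <= 4^-1 by rewrite ler_pdivrMr//; move: ur; lra.
have [n0 hn0] := @exp2R_small R (8 * B) e e0.
exists n0 => N nN.
have := hF th (u - a) N ltac:(by rewrite th0) ltac:(by rewrite mulrC divfK ?gt_eqF).
rewrite [a + _]addrC subrK cmodBC => /le_trans; apply.
rewrite (le_trans _ (ltW hn0))// ler_wpM2l ?mulr_ge0//.
have t2 : 0 <= 2 * th <= 2^-1 by lra.
apply: (@le_trans _ _ (2^-1 ^+ N)).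
  by apply: lerXn2r; rewrite ?nnegrE ?invr_ge0//; lra.
by rewrite exprVn lef_pV2 ?posrE ?exprn_gt0// ler_eXn2l// ltr1n.
Qed.

Lemma geometric_sum_le (rho : R) n : 0 <= rho < 1 ->
  \sum_(0 <= k < n) rho ^+ k <= (1 - rho)^-1.
Proof.
move=> /andP[r0 r1]; rewrite big_mkord.
have h : (rho - 1) * \sum_(k < n) rho ^+ k = rho ^+ n - 1 by rewrite -subrX1.
rewrite -[leRHS]mul1r ler_pdivlMr ?subr_gt0//.
have := exprn_ge0 n r0; lra.
Qed.

(** The form in which normal convergence is established: the k-th term is
    homogeneous of degree k, which yields geometric bounds. *)
Lemma normal_geometric P a r B rho : 0 < r -> 0 <= B -> 0 <= rho < 1 ->
  (forall k h, vmod h <= r -> cmod (peval (P k) (a + h)) <= B * rho ^+ k) -> normal_at P a.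
Proof.
move=> r0 B0 hrho hP; exists r, (fun k => B * rho ^+ k) => //.
exists (B * (1 - rho)^-1); split=> // n.
by rewrite -mulr_sumr ler_wpM2l// geometric_sum_le.
Qed.

End NormalSeries.

(** * Series of products of linear forms *)

Section SeriesTerms.
Variable R : realType.
Local Notation C := (complexes R).
Implicit Types (p : mpoly 3 C) (u v h a : 'rV[C]_3) (e r : R) (k n N : nat).

Lemma linear_form_covector (L : linear_form C) : exists d, forall v,
  peval (mpoly_of_dhomog L) v = covector d v.
Proof.
case: L => p hp /=; have [q [hq ->]] := dhomog_split hp.
have /choice[d hd] := fun i => dhomog0_const (hq i).
exists d => v; rewrite /peval raddf_sum; apply: eq_bigr => i _ /=.
by rewrite mevalM mevalXU hd mevalC mulrC.
Qed.

Variables (c : C) (L : forall k : nat, 'I_k -> linear_form C).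

Lemma series_term_covector k : exists d : 'I_k -> 'I_3 -> C, exists c', forall v,
  peval (series_term c L k) v = c' * \prod_(j < k) covector (d j) v.
Proof.
have /choice[d hd] := fun j => linear_form_covector (@L k j).
exists d; case: k d hd => [|k] d hd.
  by exists c => v; rewrite big_ord0 mulr1 /peval mevalC.
exists 1 => v; rewrite mul1r /peval rmorph_prod; apply: eq_bigr => j _.
exact: hd.
Qed.

Lemma series_term_homog k (l : C) v :
  peval (series_term c L k) (l *: v) = l ^+ k * peval (series_term c L k) v.
Proof.
have [d [c' hd]] := series_term_covector k; rewrite !hd mulrCA; congr (_ * _).
under eq_bigr do rewrite linearZ /=.
by rewrite big_split /= prodr_const card_ord.
Qed.

(** Each term is the difference of two consecutive partial sums, and these
    converge uniformly on the bounded parts of H; finitely many terms remain,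
    which are continuous. *)
Lemma terms_bounded H f r : closed H -> represents H c L f ->
  exists2 B : R, 0 <= B & forall k v, H v -> vmod v <= r ->
    cmod (peval (series_term c L k) v) <= B.
Proof.
move=> cH /(cvg_on_compactsP _ _ cH) /(_ r 1 ltr01)[n0 h0].
have /choice[b hb] : forall k, exists B, 0 <= B /\ forall v, setT v -> vmod v <= r ->
    cmod (peval (series_term c L k) v) <= B.
  move=> k; have [B B0 hB] := bounded_on_vball r (@closedT _) (econt_peval (H := setT) (series_term c L k)).
  by exists B; split=> //; exact: ltW.
exists (2 + \sum_(k < n0) b k).
  by rewrite addr_ge0// sumr_ge0// => k _; exact: (hb k).1.
move=> k v Hv vr; have [kn|nk] := ltnP k n0.
  rewrite (le_trans ((hb k).2 v I vr))// (bigD1 (Ordinal kn))//= addrCA lerDl addr_ge0//.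
  by rewrite sumr_ge0// => j _; exact: (hb j).1.
rewrite ler_wpDr ?sumr_ge0//; first by move=> j _; exact: (hb j).1.
have := h0 k.+1 (leq_trans nk (leqnSn _)) v Hv vr; have := h0 k nk v Hv vr.
rewrite big_nat_recr//=; set s := \sum_(_ <= _ < _) _; set x := peval _ v => h1 h2.
have -> : x = (s + x - f v) - (s - f v) by ring.
by rewrite (le_trans (cmodB _ _))//; lra.
Qed.

Lemma represents_csum H f v : represents H c L f -> closed H -> H v ->
  csum (fun k => peval (series_term c L k) v) (f v).
Proof.
move=> + cH Hv => /(cvg_on_compactsP _ _ cH) h e e0.
by have [n0 h0] := h (vmod v) e e0; exists n0 => n nn; exact: h0.
Qed.

End SeriesTerms.

(** * Extension to the round hull *)

Section Holomorphy.
Variable R : realType.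
Local Notation C := (complexes R).
Implicit Types (p : mpoly 3 C) (u v w h a : 'rV[C]_3) (e r : R) (k n N : nat) (P : nat -> mpoly 3 C).
Variables (Q : mpoly 3 C) (M : 'M[C]_3).
Hypothesis hQM : normal_form Q M.
Local Notation S := (quadric Q).

(** Homogeneity of degree 2, read off from the normal form. *)
Lemma quadratic_scale (l : C) v : peval Q (l *: v) = l ^+ 2 * peval Q v.
Proof. by case: hQM => _ h; rewrite !h -scalemxAl !mxE; ring. Qed.

Lemma quadric_ray u : peval Q u != 0 -> exists (mu : C) w,
  [/\ mu ^+ 2 = peval Q u, S w, u = mu *: w & cmod mu * vmod w = vmod u].
Proof.
move=> u0; pose mu : C := sqrtc (peval Q u).
have hmu : mu ^+ 2 = peval Q u by exact: sqr_sqrtc.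
have mu0 : mu != 0 by apply: contraNneq u0 => m0; rewrite -hmu m0 expr0n.
exists mu, (mu^-1 *: u); split=> //.
- by rewrite /quadric /= quadratic_scale -hmu -exprMn mulVf// expr1n.
- by rewrite scalerA mulfV// scale1r.
- by rewrite vmodZ cmodV mulrA mulfV ?mul1r// cmod_eq0.
Qed.

Lemma quadric_point : exists w, S w.
Proof.
have [uM h] := hQM; exists (v3 0 0 1 *m invmx M).
by rewrite /quadric /= h mulmxKV// v3_0 v3_1 v3_2 mul0r subr0 expr1n.
Qed.

Lemma cdiff_peval p (g : C -> 'rV[C]_3) z : (forall i, cdiff (fun t => g t 0 i) z) ->
  cdiff (fun t => peval p (g t)) z.
Proof.
move=> hg.
have -> : (fun t => peval p (g t)) =
   (fun t => \sum_(m <- msupp p) mcoeff m p * \prod_i g t 0 i ^+ m i).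
  by apply: funext => t; rewrite /peval mevalE.
elim: (msupp p) => [|m s IH].
  have -> : (fun t => \sum_(m <- [::]) mcoeff m p * \prod_i g t 0 i ^+ m i) = (fun=> 0).
    by apply: funext => t; rewrite big_nil.
  exact: cdiff_cst.
have -> : (fun t => \sum_(m <- m :: s) mcoeff m p * \prod_i g t 0 i ^+ m i) =
   (fun t => mcoeff m p * (g t 0 o0 ^+ m o0 * g t 0 o1 ^+ m o1 * g t 0 o2 ^+ m o2)
     + \sum_(m <- s) mcoeff m p * \prod_i g t 0 i ^+ m i).
  apply: funext => t; rewrite big_cons; congr (_ * _ + _).
  rewrite !big_ord_recl big_ord0 mulr1 mulrA.
  by congr (g t _ _ ^+ m _ * g t _ _ ^+ m _ * g t _ _ ^+ m _); apply: val_inj.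
apply: cdiffD => //; apply: cdiffM; first exact: cdiff_cst.
by apply: cdiffM; [apply: cdiffM|]; apply: cdiffX.
Qed.

Lemma cmod_dist (x y : C) e : cmod (x - y) <= e -> cmod y - e <= cmod x <= cmod y + e.
Proof.
move=> h; have := cmodD (x - y) y; rewrite subrK => h1.
have h2 : cmod y <= cmod x + cmod (x - y).
  by rewrite -{1}(subKr x y) cmodB.
by apply/andP; split; lra.
Qed.

Lemma hull_ratio (q : R) : 0 < q < 1 ->
  [/\ q + (1 - q) / 2 <= ((3 + q) / 4) ^+ 2, 0 <= (3 + q) / 4 < 1 & 0 <= (3 + q) / 4 <= 2].
Proof. by move=> /andP[q0 q1]; split; [nra|lra|lra]. Qed.

Section Extension.
Variables (c : C) (L : forall k : nat, 'I_k -> linear_form C) (f : 'rV[C]_3 -> C).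
Hypothesis hf : represents S c L f.
Local Notation P := (series_term c L).

(** Homogeneity along the rays through the quadric. The bound s from below on
    |Q u| keeps the point of the quadric under u in a bounded set. *)
Lemma terms_ray_bounded (D s rho : R) : 0 < s -> exists2 B : R, 0 <= B &
  forall k u, vmod u <= D -> s <= cmod (peval Q u) -> cmod (peval Q u) <= rho ^+ 2 -> 0 <= rho <= 2 ->
    cmod (peval (P k) u) <= B * rho ^+ k.
Proof.
move=> s0.
have [B B0 hB] := terms_bounded (D * (2 / s)) (@closed_quadric R Q) hf.
exists B => // k u uD su urho /andP[rho0 rho2].
have [|mu [w [hmu Sw uw muw]]] := @quadric_ray u.
  by rewrite -cmod_gt0 (lt_le_trans s0).
have mu_rho : cmod mu <= rho.
  by rewrite -(ler_pXn2r (n := 2)) ?nnegrE ?cmod_ge0// -cmodX hmu.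
have mu_s : s / 2 <= cmod mu.
  rewrite ler_pdivrMr// (le_trans su)// -hmu cmodX expr2 ler_wpM2l ?cmod_ge0//.
  exact: le_trans rho2.
rewrite uw series_term_homog cmodM cmodX mulrC.
apply: ler_pM; rewrite ?cmod_ge0 ?exprn_ge0 ?cmod_ge0//.
  apply: (hB k w Sw).
  have m0 : 0 < cmod mu by rewrite (lt_le_trans _ mu_s)// divr_gt0.
  have -> : vmod w = vmod u / cmod mu by rewrite -muw mulrAC mulfV ?mul1r// gt_eqF.
  apply: ler_pM => //; rewrite ?vmod_ge0 ?invr_ge0 ?cmod_ge0//.
  by rewrite -invf_div lef_pV2 ?posrE// divr_gt0.
by apply: lerXn2r; rewrite ?nnegrE ?cmod_ge0.
Qed.

(** Near l v with l nonzero, |Q| stays between a positive number and the square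
    of some rho < 1, and the terms are bounded by multiples of rho^k. Near the
    origin there is no ray to use: with Q w = 1, the k-th term at h is the mean
    over the unit circle of its values at h + t w = t (w + h / t), which are
    bounded by multiples of 2^k for small h; scaling h by 1/4 brings the ratio
    down to 1/2. *)
Lemma hull_normal u : round_hull S u -> normal_at P u.
Proof.
move=> [v Sv [l l1 ->]].
have {}l1 : cmod l < 1 by rewrite -ltcR -cmodE rmorph1.
have [l0|l0] := eqVneq l 0; last first.
  set a := l *: v; pose q := cmod (peval Q a).
  have qE : q = cmod l ^+ 2 by rewrite /q quadratic_scale Sv mulr1 cmodX.
  have q0 : 0 < q by rewrite qE exprn_gt0// cmod_gt0.
  have q1 : q < 1 by rewrite qE exprn_ilt1// cmod_ge0.
  have [d1 d10 hd1] := econt_peval (H := setT) Q (p := a) I (ltac:(by rewrite divr_gt0) : 0 < q / 2).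
  have [d2 d20 hd2] := econt_peval (H := setT) Q (p := a) I
    (ltac:(by rewrite divr_gt0// subr_gt0) : 0 < (1 - q) / 2).
  have [r1 r2 r3] := @hull_ratio q ltac:(by rewrite q0).
  set rho := (3 + q) / 4 in r1 r2 r3.
  have [B B0 hB] := @terms_ray_bounded (vmod a + d1) (q / 2) rho ltac:(by rewrite divr_gt0).
  apply: (@normal_geometric R P a (Num.min d1 d2 / 2) B rho) => //.
  - by rewrite divr_gt0// lt_min d10.
  move=> k h hh.
  have [h1 h2] : vmod h < d1 /\ vmod h < d2.
    apply/andP; rewrite -lt_min (le_lt_trans hh)// gtr_pMr ?invf_lt1 ?ltr1n//.
    by rewrite lt_min d10.
  have /cmod_dist/andP[t1 _] := hd1 (a + h) I ltac:(by rewrite addrC addKr).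
  have /cmod_dist/andP[_ t2] := hd2 (a + h) I ltac:(by rewrite addrC addKr).
  apply: hB => //.
  - by rewrite (le_trans (vmodD _ _))// lerD2l ltW.
  - by rewrite (le_trans _ t1)// -/q {2}(splitr q) addrK.
  - exact: le_trans t2 r1.
rewrite l0 scale0r.
have [w Sw] := quadric_point.
have [d d0 hd] := econt_peval (H := setT) Q (p := w) I (ltac:(by rewrite divr_gt0) : 0 < 1 / 2 :> R).
have [B B0 hB] := @terms_ray_bounded (vmod w + d) (1 / 2) 2 ltac:(by rewrite divr_gt0).
have hw k h : vmod h < d -> cmod (peval (P k) (w + h)) <= B * 2 ^+ k.
  move=> hh; have Qw : peval Q w = 1 by exact: Sw.
  have := hd (w + h) I ltac:(by rewrite addrC addKr).
  move=> /cmod_dist; rewrite Qw cmod1 => /andP[t1 t2].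
  apply: hB.
  - by rewrite (le_trans (vmodD _ _))// lerD2l ltW.
  - by rewrite (le_trans _ t1)//; lra.
  - by rewrite (le_trans t2)//; lra.
  - lra.
have h0 k h : vmod h < d -> cmod (peval (P k) h) <= B * 2 ^+ k.
  move=> hh.
  have dpsi t : cdiff (fun t => peval (P k) (h + t *: w)) t.
    apply: cdiff_peval => i.
    have -> : (fun t => (h + t *: w) 0 i) = (fun t => h 0 i + t * w 0 i).
      by apply: funext => s; rewrite !mxE.
    apply: cdiffD; first exact: cdiff_cst.
    by apply: cdiffM; [exact: cdiff_id|exact: cdiff_cst].
  have := mean_entire dpsi; rewrite scale0r addr0 => /is_mean_le; apply => t t1.
  have t0 := cmod1_neq0 t1.
  have -> : h + t *: w = t *: (w + t^-1 *: h).
    by rewrite scalerDr scalerA mulfV// scale1r addrC.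
  rewrite series_term_homog cmodM cmodX t1 expr1n mul1r; apply: hw.
  by rewrite vmodZ cmodV t1 invr1 mul1r.
apply: (@normal_geometric R P 0 (d / 8) B (1 / 2)) => //.
- by rewrite divr_gt0.
- lra.
move=> k h hh; rewrite add0r.
have -> : h = (4^-1 : C) *: ((4 : C) *: h) by rewrite scalerA mulVf ?scale1r// pnatr_eq0.
rewrite series_term_homog cmodM cmodX cmodV cmod_nat.
have h4 : vmod ((4 : C) *: h) < d by rewrite vmodZ cmod_nat; lra.
rewrite (le_trans (ler_wpM2l _ (h0 k _ h4))) ?exprn_ge0 ?invr_ge0//.
rewrite mulrCA -exprMn ler_wpM2l//; apply: lerXn2r; rewrite ?nnegrE; lra.
Qed.

(** The sum of the series, which converges normally near each point of the
    round hull, and by hypothesis on the quadric. *)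
Lemma round_hull_extension : exists F : 'rV[C]_3 -> C,
  [/\ forall v, S v -> F v = f v, holomorphic_on (round_hull S) F
    & forall v (l : C), S v -> `|l| < 1 ->
      (fun n => \sum_(0 <= k < n) l ^+ k * peval (P k) v) @ \oo --> F (l *: v)].
Proof.
exists (psum P); split.
- by move=> v Sv; apply: psumE; exact: represents_csum hf (@closed_quadric R Q) Sv.
- by apply: normal_holomorphic; exact: hull_normal.
move=> v l Sv l1.
have [r [Mk r0 [B hN]]] : normal_at P (l *: v) by apply: hull_normal; exists v => //; exists l.
have := normal_on_csum hN (h := 0); rewrite vmod0 addr0 => /(_ (ltW r0)) h.
apply/cvgC_P => e /h[n0 H]; exists n0 => n /H.
by under eq_bigr do rewrite series_term_homog.
Qed.

End Extension.

End Holomorphy.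

(** * Limits of polynomials are holomorphic on a quadric *)

Section Limits.
Variable R : realType.
Local Notation C := (complexes R).
Implicit Types (u v w h a : 'rV[C]_3) (e r : R) (k n N : nat).

(** A locally uniform limit of polynomials is the sum of a normally convergent
    series, namely the differences along a fast converging subsequence. *)
Lemma entire_limit_vdiff (p : nat -> mpoly 3 C) (F : 'rV[C]_3 -> C) a :
  (forall r e : R, 0 < e -> exists n0, forall n, (n0 <= n)%N -> forall v, vmod v <= r ->
     cmod (peval (p n) v - F v) <= e) -> vdiff setT F a.
Proof.
move=> hp; pose r := vmod a + 1.
have /choice[N hN] : forall j : nat, exists n0, forall n, (n0 <= n)%N -> forall v, vmod v <= r ->
    cmod (peval (p n) v - F v) <= 2^-1 ^+ j.
  by move=> j; apply: hp; rewrite exprn_gt0// invr_gt0.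
have [B0 B00 hB0] := bounded_on_vball r (@closedT _) (econt_peval (H := setT) (p (N 0%N))).
pose P j := if j is j'.+1 then p (N j'.+1) - p (N j') else p (N 0%N).
pose Mk j : R := if j is j'.+1 then 2 * 2^-1 ^+ j' else B0.
have PS n v : \sum_(0 <= k < n.+1) peval (P k) v = peval (p (N n)) v.
  elim: n => [|n IH]; first by rewrite big_nat1.
  by rewrite big_nat_recr//= IH /peval mevalB addrC subrK.
have MS n : \sum_(0 <= k < n) Mk k <= B0 + 4.
  case: n => [|n]; first by rewrite big_geq// addr_ge0// ltW.
  rewrite big_nat_recl//= lerD2l -mulr_sumr.
  have := @geometric_sum_le R 2^-1 n ltac:(by apply/andP; split; lra).
  set s := \sum_(_ <= _ < _) _ => hs.
  have e2 : (1 - 2^-1)^-1 = 2 :> R by field.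
  by move: hs; rewrite e2; lra.
have ar h : vmod h <= 1 -> vmod (a + h) <= r.
  by move=> h1; rewrite (le_trans (vmodD _ _))// lerD2l.
have PM k h : vmod h <= 1 -> cmod (peval (P k) (a + h)) <= Mk k.
  move=> h1; case: k => [|k] /=; first by apply: hB0 => //; exact: ar.
  have H1 := hN k.+1 _ (leqnn _) _ (ar _ h1); have H2 := hN k _ (leqnn _) _ (ar _ h1).
  rewrite /peval mevalB -!/(peval _ (a + h)).
  move: H1 H2; set x := peval _ _; set y := peval _ _; set z := F _ => H1 H2.
  have -> : x - y = (x - z) - (y - z) by ring.
  rewrite (le_trans (cmodB _ _))// mulr_natl mulr2n; apply: lerD => //.
  apply: (le_trans H1); rewrite exprS ler_piMl ?exprn_ge0 ?invr_ge0// invf_le1//; lra.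
have Fs h : vmod h <= 1 -> csum (fun k => peval (P k) (a + h)) (F (a + h)).
  move=> h1 e e0; have [n0 hn0] := @exp2R_small R 1 e e0.
  exists n0.+1 => -[//|n]; rewrite ltnS => nn; rewrite PS.
  rewrite (le_trans (hN n _ (leqnn _) _ (ar _ h1)))// (le_trans _ (ltW hn0))// mul1r exprVn.
  by rewrite lef_pV2 ?posrE ?exprn_gt0// ler_eXn2l// ltr1n.
have [c [_ hF]] := normal_series_expansion ltr01 MS PM Fs.
apply: expansion_vdiff ltr01 _ hF; rewrite addr_ge0// ltW//.
Qed.

Variables (Q : mpoly 3 C) (M : 'M[C]_3).
Hypothesis hQM : normal_form Q M.
Local Notation S := (quadric Q).

Lemma linear_differentiable (d : 'I_3 -> C) u : differentiable (covector d : 'rV[C]_3 -> C) u.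
Proof.
apply/differentiable_vdiff; exists d => e e0; exists 1 => // v _ _.
by rewrite -linearB subrr cmod0 mulr_ge0 ?vmod_ge0// ltW.
Qed.

Lemma coord_covector j v : (v *m M) 0 j = covector (M ^~ j) v.
Proof. by rewrite mxE /covector; apply: eq_bigr => i _; rewrite mulrC. Qed.

(** For ep = 1 and ep = -1, a polynomial map from the plane of the first two
    coordinates to the quadric, whose image contains all points where the
    coordinate z differs from -ep. The two images cover the quadric. *)
Definition param (ep : C) (w : 'rV[C]_3) : 'rV[C]_3 :=
  (ep *: v3 (2 * w 0 o0) (2 * w 0 o1 + 2 * w 0 o0 * w 0 o1 ^+ 2) (1 + 2 * w 0 o0 * w 0 o1))
    *m invmx M.

(** A rational section of the map above, holomorphic where the coordinate z
    differs from -ep. *)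
Definition chart (ep : C) (u : 'rV[C]_3) : 'rV[C]_3 :=
  (covector (M ^~ o0) u * (ep / 2)) *: v3 1 0 0
  + (covector (M ^~ o1) u * ep * (1 + ep * covector (M ^~ o2) u)^-1) *: v3 0 1 0.

Lemma param_quadric ep w : ep ^+ 2 = 1 -> S (param ep w).
Proof.
move=> ep2; have [uM h] := hQM; rewrite /quadric /= h /param mulmxKV// !mxE /=.
set s := w 0 o0; set t := w 0 o1.
have -> : (ep * (1 + 2 * s * t)) ^+ 2 - ep * (2 * s) * (ep * (2 * t + 2 * s * t ^+ 2)) = ep ^+ 2.
  by ring.
by [].
Qed.

Lemma chart_param ep u : ep ^+ 2 = 1 -> S u -> 1 + ep * covector (M ^~ o2) u != 0 ->
  param ep (chart ep u) = u.
Proof.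
move=> ep2 Su hz; have [uM h] := hQM.
rewrite -[RHS](mulmxK uM); congr (_ *m _).
move: Su; rewrite /quadric /= h !coord_covector => Su.
rewrite [RHS]v3E !coord_covector /chart.
set x := covector (M ^~ o0) u in Su hz *; set y := covector (M ^~ o1) u in Su hz *.
set z := covector (M ^~ o2) u in Su hz *.
have -> : x * (ep / 2) *: v3 1 0 0 + y * ep / (1 + ep * z) *: v3 0 1 0 =
   v3 (x * ep / 2) (y * ep / (1 + ep * z)) 0.
  by apply/rowP => -[[|[|[|]]]] //= i; rewrite !mxE /= ?mulr0 ?mulr1 ?addr0 ?add0r// mulrA.
rewrite v3_0 v3_1.
have xy : x * y = z ^+ 2 - 1 by rewrite -Su; ring.
have st : x * ep / 2 * (y * ep / (1 + ep * z)) = (ep * z - 1) / 2.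
  have -> : x * ep / 2 * (y * ep / (1 + ep * z)) = ep ^+ 2 * (x * y) / (2 * (1 + ep * z)).
    by field.
  have -> : ep ^+ 2 * (x * y) = (ep * z - 1) * (1 + ep * z).
    rewrite xy ep2 mul1r.
    have -> : (ep * z - 1) * (1 + ep * z) = ep ^+ 2 * z ^+ 2 - 1 by ring.
    by rewrite ep2 mul1r.
  by field.
set s := x * ep / 2 in st *; set t := y * ep / (1 + ep * z) in st *.
have ee : ep * ep = 1 by rewrite -expr2.
have -> : 2 * t + 2 * s * t ^+ 2 = 2 * t * (1 + s * t) by ring.
have -> : 2 * s * t = 2 * (s * t) by ring.
rewrite st; apply/rowP => -[[|[|[|]]]] //= i; rewrite !mxE /=.
- have -> : ep * (2 * s) = ep * ep * x by rewrite /s; field.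
  by rewrite ee mul1r.
- have -> : ep * (2 * t * (1 + (ep * z - 1) / 2)) = ep * ep * y by rewrite /t; field.
  by rewrite ee mul1r.
- have -> : ep * (1 + 2 * ((ep * z - 1) / 2)) = ep * ep * z by field.
  by rewrite ee mul1r.
Qed.

Lemma chart_differentiable ep u : 1 + ep * covector (M ^~ o2) u != 0 ->
  differentiable (chart ep) u.
Proof.
move=> hz.
have d0 := linear_differentiable (M ^~ o0) u.
have d1 := linear_differentiable (M ^~ o1) u.
have d2 := linear_differentiable (M ^~ o2) u.
have dcst (c : C) : differentiable (cst c : 'rV[C]_3 -> C) u by exact: differentiable_cst.
have dz : differentiable (cst 1 + cst ep * (covector (M ^~ o2) : 'rV[C]_3 -> C)) u.
  exact: (differentiableD (dcst 1) (differentiableM (dcst ep) d2)).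
have dv := differentiableV dz hz.
apply: differentiableD; apply: differentiableZl.
  exact: (differentiableM d0 (dcst (ep / 2))).
exact: (differentiableM (differentiableM d1 (dcst ep)) dv).
Qed.

(** Through a parametrization by C^2, realized inside C^3, the limit of
    polynomials on the quadric becomes a limit of polynomials on C^3, which is
    differentiable; composing with a section of the parametrization gives a
    local extension of f. *)
Lemma limit_holomorphic (p : nat -> mpoly 3 C) f :
  cvg_on_compacts S (fun n => peval (p n)) f -> holomorphic_on S f.
Proof.
move=> /(cvg_on_compactsP _ _ (@closed_quadric R Q)) hp a Sa.
have [ep [ep2 hz]] : exists ep : C, ep ^+ 2 = 1 /\ 1 + ep * covector (M ^~ o2) a != 0.
  have [h|h] := eqVneq (1 + covector (M ^~ o2) a) 0; last first.
    by exists 1; rewrite expr1n mul1r.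
  exists (-1); rewrite sqrrN expr1n mulN1r; split=> //.
  apply/eqP => h'; have /eqP := h; rewrite -(addr0 (1 + _)) -{1}h'.
  by rewrite addrACA subrr addr0 -mulr2n pnatr_eq0.
pose Z (i : 'I_3) := @mpolyX 3 C (mnm1 i).
pose g (j : 'I_3) : mpoly 3 C := [:: 2 * Z o0; 2 * Z o1 + 2 * Z o0 * (Z o1 * Z o1); 1 + 2 * Z o0 * Z o1]`_j.
pose G (i : 'I_3) : mpoly 3 C := \sum_j mpolyC 3 (ep * invmx M j i) * g j.
have GE w i : peval (G i) w = param ep w 0 i.
  rewrite /param mxE /peval raddf_sum; apply: eq_bigr => j _ /=.
  rewrite mevalM mevalC mxE mulrAC; congr (_ * _ * _).
  have hZ (k : 'I_3) : meval (fun i => w 0 i) (Z k) = w 0 k by rewrite mevalXU.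
  rewrite mxE /g; case: j => -[|[|[|]]] //= hj.
  - by rewrite mevalM rmorph_nat hZ.
  - by rewrite mevalD !mevalM !rmorph_nat !hZ expr2.
  - by rewrite mevalD rmorph1 !mevalM rmorph_nat !hZ.
pose q n := comp_mpoly [tuple G i | i < 3] (p n).
have qE n w : peval (q n) w = peval (p n) (param ep w).
  rewrite /peval /q comp_mpoly_meval; apply: meval_eq => i.
  by rewrite tnth_mktuple; exact: GE.
have bnd r : exists r', forall w, vmod w <= r -> vmod (param ep w) <= r'.
  have /choice[b hb] : forall i, exists B : R, 0 <= B /\ forall w, vmod w <= r -> cmod (param ep w 0 i) <= B.
    move=> i; have [B B0 hB] := bounded_on_vball r (@closedT _) (econt_peval (H := setT) (G i)).
    by exists B; split=> [|w wr]; [exact: ltW|rewrite -GE hB].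
  exists (\sum_i b i) => w wr; apply/le_vmodP => [|i].
    by rewrite sumr_ge0// => i _; exact: (hb i).1.
  rewrite (le_trans ((hb i).2 w wr))// (bigD1 i)//= lerDl sumr_ge0// => j _.
  exact: (hb j).1.
have dF w : vdiff setT (fun w => f (param ep w)) w.
  apply: (@entire_limit_vdiff q) => r e e0.
  have [r' hr'] := bnd r; have [n0 h0] := hp r' e e0.
  exists n0 => n nn v vr; rewrite qE; apply: h0 => //; first exact: param_quadric.
  exact: hr'.
have hU : open [set u | 1 + ep * covector (M ^~ o2) u != 0].
  have -> : [set u | 1 + ep * covector (M ^~ o2) u != 0] =
     ~` [set u | 1 + ep * covector (M ^~ o2) u = 0].
    by apply/seteqP; split=> u /= /eqP.
  rewrite openC; apply: (@closed_level R (fun u => 1 + ep * covector (M ^~ o2) u)).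
  apply: econtD; first exact: econt_cst.
  apply: econtM; first exact: econt_cst.
  have -> : (covector (M ^~ o2) : 'rV[C]_3 -> C) = peval (lform (M ^~ o2)).
    by apply: funext => v; rewrite peval_lform.
  exact: econt_peval.
exists [set u | 1 + ep * covector (M ^~ o2) u != 0], ((fun w => f (param ep w)) \o chart ep); split=> //.
  move=> u hu; have /differentiable_vdiff d1 := dF (chart ep u).
  exact: (differentiable_comp (chart_differentiable hu) d1).
by move=> u hu Su /=; rewrite chart_param.
Qed.

End Limits.

(** * Bernstein's inequality and complexification of real bounds *)

Section Bernstein.
Variable R : realType.
Local Notation C := (complexes R).
Implicit Types (p q : {poly C}) (e r A B Y : R) (k n N : nat).

(** Cauchy's estimate in one variable: a coefficient is an average of p over
    the unit circle. *)
Lemma cauchy_estimate1 p B j : (forall t, cmod t = 1 -> cmod p.[t] <= B) -> cmod p`_j <= B.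
Proof.
move=> hB; pose K := (size p + j)%N.
have jK : (j < 2 ^ K)%N by rewrite (leq_ltn_trans _ (ltn_expl K (ltnSn 1)))// leq_addl.
have E : cavg K (fun t => p.[t] * t^-1 ^+ j) = p`_j.
  have -> : (fun t => p.[t] * t^-1 ^+ j) = (fun t => \sum_(i < size p) p`_i * (t ^+ i * t^-1 ^+ j)).
    by apply: funext => t; rewrite horner_coef mulr_suml; apply: eq_bigr => i _; rewrite mulrA.
  rewrite cavg_sum.
  under eq_bigr => i _.
    rewrite cavgZ cavg_monomial//; last first.
      by rewrite (ltn_trans (ltn_ord i))// (leq_ltn_trans _ (ltn_expl K (ltnSn 1)))// leq_addr.
    over.
  have [js|sj] := ltnP j (size p).
    rewrite (bigD1 (Ordinal js))//= eqxx mulr1 big1 ?addr0// => i ij.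
    by rewrite (_ : (i == j :> nat) = false) ?mulr0//; apply/negbTE.
  rewrite nth_default// big1// => i _.
  by rewrite ltn_eqF ?mulr0// (leq_trans (ltn_ord i)).
rewrite -E; apply: cavg_le => t t1; rewrite cmodM cmodX cmodV t1 invr1 expr1n mulr1.
exact: hB.
Qed.

(** The sum of the geometric series of ratio 1/Y. *)
Definition growth Y : R := (1 - Y^-1)^-1.

Lemma growth_ge0 Y : 1 < Y -> 0 <= growth Y.
Proof. by move=> Y1; rewrite invr_ge0 subr_ge0 invf_le1 ?ltW// (lt_trans _ Y1). Qed.

(** Write x = A (w + 1/w) / 2. Then w^k q(x) is a polynomial of degree 2k in w,
    and the unit circle of the w-plane is mapped onto [-A, A], where q is
    bounded by B. Cauchy's estimate bounds its 2k + 1 coefficients by B, hence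
    its value at w. *)
Lemma bernstein q k A B (w : C) : (size q <= k.+1)%N ->
  (forall x : R, `|x| <= A -> cmod q.[x%:C] <= B) -> 0 <= A -> 1 < cmod w ->
  cmod q.[A%:C * (w + w^-1) / 2] <= B * growth (cmod w) * cmod w ^+ k.
Proof.
move=> sq hB A0 w1; set Y := cmod w in w1 *.
have Y0 : 0 < Y by rewrite (lt_trans _ w1).
pose P : {poly C} := \sum_(i < k.+1) (q`_i * (A%:C / 2) ^+ i) *: (('X^2 + 1) ^+ i * 'X^(k - i)).
have reorder (x y z b s : C) : s * b * (x * z) * y = y * x * s * (b * z) by ring.
have PE t : t != 0 -> P.[t] = t ^+ k * q.[A%:C * (t + t^-1) / 2].
  move=> t0; rewrite /P horner_sum (horner_coef_wide _ sq) mulr_sumr.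
  apply: eq_bigr => i _; have ik : (i <= k)%N by rewrite -ltnS.
  rewrite hornerZ hornerM horner_exp !hornerE.
  have -> : t ^+ 2 + 1 = t * (t + t^-1) by rewrite mulrDr mulfV// expr2.
  have -> : t ^+ k = t ^+ (k - i) * t ^+ i by rewrite -exprD subnK.
  rewrite (exprMn _ t).
  have -> : (A%:C * (t + t^-1) / 2) ^+ i = (A%:C / 2) ^+ i * (t + t^-1) ^+ i.
    by rewrite -exprMn mulrAC.
  exact: reorder.
have circ t : cmod t = 1 -> cmod P.[t] <= B.
  move=> t1; rewrite PE ?cmod1_neq0// cmodM cmodX t1 expr1n mul1r.
  have -> : A%:C * (t + t^-1) / 2 = (A * complex.Re t)%:C.
    have -> : t^-1 = (t^*)%C by rewrite invc_norm cmodE t1 rmorph1 expr1n invr1 mul1r.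
    by rewrite addcJ rmorphM /= mulrA mulrAC mulfK ?pnatr_eq0// mulrC mulrA.
  apply: hB; rewrite normrM ger0_norm// ler_piMr//.
  by rewrite -t1 Re_le_cmod.
have B0 : 0 <= B by apply: le_trans (circ 1 (cmod1 R)); exact: cmod_ge0.
have sP : (size P <= k.*2.+1)%N.
  apply: (leq_trans (size_sum _ _ _)); apply/bigmax_leqP => i _.
  have ik : (i <= k)%N by rewrite -ltnS.
  rewrite (leq_trans (size_scale_leq _ _))// (leq_trans (size_polyMleq _ _))//.
  rewrite size_polyXn addnS /=.
  set X1 : {poly C} := 'X^2 + 1.
  have s2 : (size X1 <= 3)%N.
    by rewrite (leq_trans (size_polyD _ _))// size_polyXn size_poly1.
  have := size_poly_exp_leq X1 i.
  have : ((size X1).-1 * i <= 2 * i)%N by rewrite leq_mul2r -subn1 leq_subLR s2 orbT.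
  move: (size (X1 ^+ i)) ((size X1).-1 * i)%N => a b.
  lia.
have w0 : w != 0 by rewrite -cmod_gt0.
have -> : cmod q.[A%:C * (w + w^-1) / 2] = cmod P.[w] / Y ^+ k.
  by rewrite PE// cmodM cmodX [RHS]mulrAC mulfV ?mul1r// expf_neq0// gt_eqF.
rewrite ler_pdivrMr ?exprn_gt0// (horner_coef_wide _ sP).
rewrite (le_trans (cmod_sum _ _ _))//.
apply: (@le_trans _ _ (B * \sum_(i < k.*2.+1) Y ^+ i)).
  rewrite mulr_sumr; apply: ler_sum => i _; rewrite cmodM cmodX ler_pM ?cmod_ge0 ?exprn_ge0//.
    exact: ltW.
  exact: cauchy_estimate1.
rewrite -!mulrA ler_wpM2l// -exprD addnn.
(* The sum of Y^i for i up to 2k is at most growth Y times Y^(2k), and dividing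
   by Y^k leaves Y^k. *)
have h : (Y - 1) * \sum_(i < k.*2.+1) Y ^+ i = Y ^+ k.*2.+1 - 1 by rewrite -subrX1.
have Y1 : 0 < Y - 1 by rewrite subr_gt0.
rewrite -(ler_pM2l Y1) h.
have -> : (Y - 1) * (growth Y * Y ^+ k.*2) = Y ^+ k.*2.+1.
  by rewrite /growth exprS; field; rewrite !gt_eqF.
by rewrite gerBl.
Qed.

End Bernstein.

Section ConeExtension.
Variable R : realType.
Local Notation C := (complexes R).
Implicit Types (p : mpoly 3 C) (u v w h a x y : 'rV[C]_3) (e r : R) (k n N : nat).
Variables (c : C) (L : forall k : nat, 'I_k -> linear_form C).
Local Notation P := (series_term c L).

Lemma line_poly k a y : exists2 q : {poly C}, (size q <= k.+1)%N &
  forall s, q.[s] = peval (P k) (a + s *: y).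
Proof.
have [d [c' hd]] := series_term_covector c L k.
exists (c'%:P * \prod_(j < k) ((covector (d j) a)%:P + covector (d j) y *: 'X)).
  rewrite mul_polyC (leq_trans (size_scale_leq _ _))//.
  elim: k d {hd} => [|k IH] d; first by rewrite big_ord0 size_poly1.
  rewrite big_ord_recr /= (leq_trans (size_polyMleq _ _))//.
  have s2 : (size ((covector (d ord_max) a)%:P + covector (d ord_max) y *: 'X)%R <= 2)%N.
    rewrite (leq_trans (size_polyD _ _))// geq_max (leq_trans (size_polyC_leq1 _))//=.
    by rewrite (leq_trans (size_scale_leq _ _))// size_polyX.
  have := IH (fun j => d (widen_ord (leqnSn k) j)).
  move: (size _) (size _) s2 => i j; lia.
move=> s; rewrite hd hornerM hornerC horner_prod; congr (_ * _).
apply: eq_bigr => j _; rewrite hornerD hornerC hornerZ hornerX.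
by rewrite linearD linearZ /= mulrC.
Qed.

Variable A : 'M[C]_3.
Hypothesis uA : A \in unitmx.

(** Vectors with real coordinates with respect to A: a totally real subspace of
    C^3, with A the identity for R^3 itself. *)
Definition real_vec v := forall i, (v *m A) 0 i \is Num.real.

Lemma real_vecD v w : real_vec v -> real_vec w -> real_vec (v + w).
Proof. by move=> hv hw i; rewrite mulmxDl mxE rpredD. Qed.

Lemma real_vecZ (s : R) v : real_vec v -> real_vec (s%:C *: v).
Proof.
move=> hv i; rewrite -scalemxAl mxE rpredM//.
by apply/complex_realP; exists s.
Qed.

Lemma real_vecN v : real_vec v -> real_vec (- v).
Proof. by move=> hv i; rewrite mulNmx mxE rpredN. Qed.

(** The decomposition into real and imaginary parts relative to A, with control
    of both. *)
Lemma real_imaginary : exists2 K : R, 0 < K & forall h, exists x y,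
  [/\ real_vec x, real_vec y, h = x + (Complex 0 1 : C) *: y, vmod x <= K * vmod h & vmod y <= K * vmod h].
Proof.
have [K1 K10 h1] := mulmx_bounded A; have [K2 K20 h2] := mulmx_bounded (invmx A).
exists (K2 * K1); first by rewrite mulr_gt0.
move=> h; pose g := h *m A.
pose x : 'rV[C]_3 := \row_i (complex.Re (g 0 i))%:C.
pose y : 'rV[C]_3 := \row_i (complex.Im (g 0 i))%:C.
have hg (z : 'rV[C]_3) : (forall i, cmod (z 0 i) <= cmod (g 0 i)) -> vmod (z *m invmx A) <= K2 * K1 * vmod h.
  move=> hz; rewrite (le_trans (h2 _))// -mulrA ler_pM2l// (le_trans _ (h1 h))//.
  apply/le_vmodP => [|i]; first exact: vmod_ge0.
  by rewrite (le_trans (hz i))// cmod_le_vmod.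
exists (x *m invmx A), (y *m invmx A); split.
- by move=> i; rewrite mulmxKV// mxE; apply/complex_realP; eexists.
- by move=> i; rewrite mulmxKV// mxE; apply/complex_realP; eexists.
- rewrite scalemxAl -mulmxDl -[LHS](mulmxK uA); congr (_ *m _).
  apply/rowP => i; rewrite !mxE -/(g 0 i); case: (g 0 i) => s t /=.
  by apply/eqP; rewrite eq_complex /= !mul0r !mul1r subr0 !addr0 !add0r !eqxx.
- by apply: hg => i; rewrite mxE cmod_real Re_le_cmod.
- by apply: hg => i; rewrite mxE cmod_real Im_le_cmod.
Qed.

(** Each h is x + i y with x, y real with respect to A. On the real line
    through a + x directed by y, Bernstein's inequality extrapolates from the
    segment [-A0, A0] to the point i, where A0 is chosen so that i = A0 (w +
    1/w) / 2 with w = i Y. The price is Y^k for any Y > 1, at the cost of a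
    small radius r. *)
Lemma complex_extension a (d Y : R) (b : nat -> R) : 0 < d -> 1 < Y ->
  (forall k x, real_vec x -> vmod x <= d -> cmod (peval (P k) (a + x)) <= b k) ->
  exists2 r : R, 0 < r & forall k h, vmod h <= r ->
    cmod (peval (P k) (a + h)) <= b k * growth Y * Y ^+ k.
Proof.
move=> d0 Y1 hb; have [K K0 hK] := real_imaginary.
have Y0 : 0 < Y by rewrite (lt_trans _ Y1).
have Y2 : 0 < Y ^+ 2 - 1 by rewrite subr_gt0 exprn_egt1.
pose A0 := 2 * Y / (Y ^+ 2 - 1).
have A00 : 0 < A0 by rewrite divr_gt0// mulr_gt0.
exists (d / (K * (1 + A0))); first by rewrite divr_gt0// mulr_gt0// addr_gt0.
move=> k h; rewrite ler_pdivlMr ?mulr_gt0 ?addr_gt0// => hd.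
have [x [y [rx ry hE hx hy]]] := hK h.
have [q sq hq] := line_poly k (a + x) y.
rewrite hE addrA -hq.
pose w : C := Complex 0 Y.
have wY : cmod w = Y by rewrite /cmod normc_def /= expr0n add0r sqrtr_sqr gtr0_norm.
have iE : Complex 0 1 = A0%:C * (w + w^-1) / 2 :> C.
  have wE : w = Y%:C * Complex 0 1.
    by apply/eqP; rewrite eq_complex /= !mul0r mulr0 subr0 mulr1 addr0 !eqxx.
  have i2 : (Complex 0 1 : C) ^+ 2 = -1 by exact: sqr_i.
  have i0 : (Complex 0 1 : C) != 0 by apply/eqP => z; have /eqP := i2; rewrite z expr0n /= eq_sym oppr_eq0 oner_eq0.
  have YC0 : Y%:C != 0 :> C by rewrite -cmod_gt0 cmod_real normr_gt0 gt_eqF.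
  have YC1 : (Y%:C ^+ 2 - 1 : C) != 0.
    by rewrite -rmorphXn -(rmorph1 (real_complex R)) -rmorphB -cmod_gt0 cmod_real normr_gt0 gt_eqF.
  have -> : A0%:C = 2 * Y%:C / (Y%:C ^+ 2 - 1) :> C.
    by rewrite /A0 rmorphM fmorphV rmorphB rmorphXn rmorph1 rmorphM rmorph_nat.
  rewrite wE; have -> : (Y%:C * Complex 0 1)^-1 = - (Complex 0 1) / Y%:C :> C.
    apply: (mulfI (mulf_neq0 YC0 i0)); rewrite mulfV ?mulf_neq0//.
    have -> : Y%:C * Complex 0 1 * (- Complex 0 1 / Y%:C) = - (Complex 0 1) ^+ 2 :> C by field.
    by rewrite i2 opprK.
  by field; rewrite YC0 YC1.
rewrite iE -wY; apply: bernstein => //; rewrite ?wY//; last exact: ltW.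
move=> s sA; rewrite hq -addrA; apply: hb.
  by apply: real_vecD => //; exact: real_vecZ.
rewrite (le_trans (vmodD _ _))// vmodZ cmod_real.
apply: (le_trans _ hd).
have -> : vmod h * (K * (1 + A0)) = K * vmod h + A0 * (K * vmod h) by ring.
by apply: lerD => //; apply: ler_pM; rewrite ?vmod_ge0.
Qed.

End ConeExtension.

(** * Extension to the real cone *)

Section RealForm.
Variable R : realType.
Local Notation C := (complexes R).
Implicit Types (p : mpoly 3 C) (u v w h a x y : 'rV[C]_3) (e r q : R) (k n N : nat).
Variables (A : 'M[C]_3) (Q : mpoly 3 C).

(** The common form of the two totally real surfaces. *)
Definition real_form_quadric : set 'rV[C]_3 := [set v | real_vec A v /\ peval Q v = 1].
Local Notation H := real_form_quadric.

Lemma Im_le_cmodB (x y : C) : `|complex.Im x - complex.Im y| <= cmod (x - y).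
Proof. by case: x y => [x1 x2] [y1 y2]; exact: (Im_le_cmod (Complex (x1 - y1) (x2 - y2))). Qed.

Lemma real_vec_closed : closed [set v | real_vec A v].
Proof.
pose F i v : C := (complex.Im ((v *m A) 0 i))%:C.
have -> : [set v | real_vec A v] = \bigcap_(i in setT) [set v | F i v = 0].
  apply/seteqP; split=> v /=.
    move=> hv i _ /=; have /complex_realP[s hs] := hv i.
    by rewrite /F hs.
  move=> hv i; have /= := hv i I; rewrite /F.
  by case: (_ 0 i) => s t /= [->]; apply/complex_realP; exists s.
apply: closed_bigI => i _; apply: closed_level => p _ e e0.
have [K K0 hK] := mulmx_bounded A.
exists (e / K) => [|v _]; first by rewrite divr_gt0.
rewrite ltr_pdivlMr// mulrC => hv.
rewrite -rmorphB cmod_real (le_trans (Im_le_cmodB _ _))//.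
have -> : (v *m A) 0 i - (p *m A) 0 i = ((v - p) *m A) 0 i by rewrite mulmxBl !mxE.
by rewrite (le_trans (cmod_le_vmod _ _))// (le_trans (hK _))// ltW.
Qed.

Lemma closed_real_form_quadric : closed H.
Proof.
have -> : H = [set v | real_vec A v] `&` quadric Q by [].
by apply: closedI; [exact: real_vec_closed|exact: closed_quadric].
Qed.

Hypothesis uA : A \in unitmx.
Hypothesis scaleQ : forall (l : C) v, peval Q (l *: v) = l ^+ 2 * peval Q v.
Hypothesis realQ : forall v, real_vec A v -> peval Q v \is Num.real.

Lemma real_form_value v : real_vec A v -> exists q, peval Q v = q%:C.
Proof. by move=> /realQ/complex_realP. Qed.

Section Extension.
Variables (c : C) (L : forall k : nat, 'I_k -> linear_form C) (f : 'rV[C]_3 -> C).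
Hypothesis hf : represents H c L f.
Local Notation P := (series_term c L).

(** As Q is real on real vectors, a real u with Q u > 0 is the square root of Q
    u times a point of the real surface. *)
Lemma real_ray_bounded (D s rho : R) : 0 < s -> 0 <= rho -> exists2 B : R, 0 <= B &
  forall k u q, real_vec A u -> vmod u <= D -> peval Q u = q%:C -> s <= q -> q <= rho ^+ 2 ->
    cmod (peval (P k) u) <= B * rho ^+ k.
Proof.
move=> s0 rho0.
have [B B0 hB] := terms_bounded (D / Num.sqrt s) closed_real_form_quadric hf.
exists B => // k u q ru uD uq sq qrho.
have q0 : 0 < q by rewrite (lt_le_trans s0).
pose mu := Num.sqrt q; have mu0 : 0 < mu by rewrite sqrtr_gt0.
have mu2 : mu ^+ 2 = q by rewrite sqr_sqrtr// ltW.
have mu_rho : mu <= rho by rewrite -(ler_pXn2r (n := 2)) ?nnegrE ?(ltW mu0)// mu2.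
have muC : mu%:C != 0 :> C by rewrite -cmod_gt0 cmod_real normr_gt0 gt_eqF.
have -> : u = mu%:C *: (mu^-1%:C *: u).
  by rewrite scalerA fmorphV mulfV ?scale1r.
rewrite series_term_homog cmodM cmodX cmod_real gtr0_norm// mulrC.
apply: ler_pM; rewrite ?cmod_ge0 ?exprn_ge0 ?(ltW mu0)//; last first.
  by apply: lerXn2r; rewrite ?nnegrE ?(ltW mu0).
apply: hB.
  split; first exact: real_vecZ.
  by rewrite scaleQ uq -rmorphXn -rmorphM exprVn mu2 mulVf ?gt_eqF// rmorph1.
rewrite vmodZ cmod_real ger0_norm ?invr_ge0 ?(ltW mu0)// mulrC.
apply: ler_pM; rewrite ?vmod_ge0 ?invr_ge0 ?(ltW mu0)//.
by rewrite lef_pV2 ?posrE ?sqrtr_gt0// ler_wsqrtr.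
Qed.

Lemma real_value_near a q e : real_vec A a -> peval Q a = q%:C -> 0 < e ->
  exists2 d : R, 0 < d & forall x, real_vec A x -> vmod x < d ->
    exists2 q', peval Q (a + x) = q'%:C & q - e <= q' <= q + e.
Proof.
move=> ra aq e0; have [d d0 hd] := econt_peval (H := setT) Q (p := a) I e0.
exists d => // x rx xd; have [q' hq'] := real_form_value (real_vecD ra rx).
exists q' => //; have := hd (a + x) I ltac:(by rewrite addrC addKr).
by rewrite hq' aq -rmorphB cmod_real ler_distl.
Qed.

(** Near a point of the open cone other than the origin, the terms are bounded
    by multiples of rho^k at real points, for some rho < 1. Bernstein's
    inequality extends this to complex points with a loss Y^k, where rho Y <
    1. *)
Lemma cone_normal_radial a q : real_vec A a -> peval Q a = q%:C -> 0 < q < 1 -> normal_at P a.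
Proof.
move=> ra aq q01; have /andP[q0 q1] := q01.
have [d1 d10 hd1] := @real_value_near a q (q / 2) ra aq ltac:(by rewrite divr_gt0).
have [d2 d20 hd2] := @real_value_near a q ((1 - q) / 2) ra aq ltac:(by rewrite divr_gt0// subr_gt0).
have [r1 /andP[r2 r3] _] := hull_ratio q01.
have rho0 : 0 < (3 + q) / 4 by lra.
set rho := (3 + q) / 4 in r1 r2 r3 rho0.
have [B B0 hB] := @real_ray_bounded (vmod a + d1) (q / 2) rho ltac:(by rewrite divr_gt0) r2.
pose Y := (1 + rho) / (2 * rho).
have Y1 : 1 < Y by rewrite ltr_pdivlMr ?mulr_gt0//; lra.
have dd : 0 < Num.min d1 d2 / 2 by rewrite divr_gt0// lt_min d10.
have [|r r0 hr] := @complex_extension R c L A uA a _ Y (fun k => B * rho ^+ k) dd Y1.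
  move=> k x rx hx.
  have [h1 h2] : vmod x < d1 /\ vmod x < d2.
    apply/andP; rewrite -lt_min (le_lt_trans hx)// gtr_pMr ?invf_lt1 ?ltr1n//.
    by rewrite lt_min d10.
  have [q' e1 /andP[t1 _]] := hd1 x rx h1.
  have [q2 e2 /andP[_ t2]] := hd2 x rx h2.
  have q2q : q2 = q' by move: e2; rewrite e1 => -[].
  apply: (hB k (a + x) q') => //.
  - exact: real_vecD.
  - by rewrite (le_trans (vmodD _ _))// lerD2l ltW.
  - by rewrite (le_trans _ t1)//; lra.
  - by rewrite -q2q (le_trans t2).
apply: (@normal_geometric R P a r (B * growth Y) ((1 + rho) / 2)) => //.
- by rewrite mulr_ge0// growth_ge0.
- by apply/andP; split; lra.
move=> k h /(hr k)/le_trans; apply.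
have -> : (1 + rho) / 2 = rho * Y by rewrite /Y; field; rewrite gt_eqF.
by rewrite (exprMn k rho Y) [leRHS]mulrACA mulrA.
Qed.

(** Real vectors near the origin need not be multiples of points of the
    surface. Bounds are known at real points close to a point v of the surface;
    extrapolating along the line from v to x bounds the k-th term at all real x
    in the unit ball by a multiple of (2 Y)^k, for some Y. A second
    extrapolation reaches complex points, with bound a multiple of (4 Y)^k, and
    homogeneity restores a ratio less than 1 on a smaller ball. *)
Lemma cone_normal_vertex v : H v -> normal_at P 0.
Proof.
move=> [rv Qv].
have [d d0 hd] := @real_value_near v 1 (1 / 2) rv ltac:(by rewrite Qv rmorph1) ltac:(by lra).
have [B B0 hB] := @real_ray_bounded (vmod v + d) (1 / 2) 2 ltac:(by lra) ltac:(by lra).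
have hv k x : real_vec A x -> vmod x < d -> cmod (peval (P k) (v + x)) <= B * 2 ^+ k.
  move=> rx xd; have [q e1 /andP[t1 t2]] := hd x rx xd.
  apply: (hB k _ q) => //; [exact: real_vecD| |lra|lra].
  by rewrite (le_trans (vmodD _ _))// lerD2l ltW.
have v0 := vmod_ge0 v.
(* With A1 (Y + 1/Y) / 2 = 1, the parameters s with |s| <= A1 keep v + s (x -
   v) within distance d of v. *)
pose Y := Num.max 2 (4 * (1 + vmod v) / d).
have Y2 : 2 <= Y by rewrite le_max lexx.
have Yd : 4 * (1 + vmod v) <= Y * d by rewrite -ler_pdivrMr// le_max lexx orbT.
have Y0 : 0 < Y by lra.
have Y1 : 1 < Y by lra.
have YC : cmod (Y%:C : C) = Y by rewrite cmod_real gtr0_norm.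
pose A1 := 2 / (Y + Y^-1).
have YY : 0 < Y + Y^-1 by rewrite addr_gt0// invr_gt0.
have A10 : 0 < A1 by rewrite divr_gt0.
have A1d : A1 * (1 + vmod v) < d.
  have iY : 0 < Y^-1 by rewrite invr_gt0.
  rewrite mulrAC ltr_pdivrMr//.
  have := mulr_gt0 d0 iY; rewrite (mulrDr d) (mulrC d Y).
  set b := Y * d in Yd *; set b' := d / Y; lra.
have hx k x : real_vec A x -> vmod x <= 1 ->
    cmod (peval (P k) (0 + x)) <= B * growth Y * (2 * Y) ^+ k.
  move=> rx x1; rewrite add0r.
  have [q sq hq] := line_poly c L k v (x - v).
  have -> : x = v + (1 : C) *: (x - v) by rewrite scale1r addrC subrK.
  rewrite -hq.
  have -> : 1 = A1%:C * (Y%:C + Y%:C^-1) / 2 :> C.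
    have E (s t : R) : s%:C * (t%:C + t%:C^-1) / 2 = (s * (t + t^-1) / 2)%:C :> C.
      by rewrite [RHS]rmorphM rmorphM rmorphD !fmorphV rmorph_nat.
    rewrite E.
    by rewrite /A1 divfK ?gt_eqF// divff ?pnatr_eq0.
  apply: (le_trans (@bernstein R q k A1 (B * 2 ^+ k) Y%:C sq _ (ltW A10) _)).
  - move=> s sA; rewrite hq; apply: hv.
      by apply: real_vecZ; apply: real_vecD => //; exact: real_vecN.
    rewrite vmodZ cmod_real (le_lt_trans _ A1d)// ler_pM ?vmod_ge0//.
    by rewrite (le_trans (vmodB _ _))// lerD2r.
  - by rewrite YC.
  by rewrite YC exprMn -!mulrA ler_wpM2l// mulrCA.
have [r r0 hr] := @complex_extension R c L A uA 0 1 2 _ ltr01 ltac:(by rewrite ltr1n) hx.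
pose K := B * growth Y * growth 2.
have K0 : 0 <= K by rewrite !mulr_ge0// growth_ge0// ltr1n.
have Y8 : 0 < 8 * Y by rewrite mulr_gt0.
apply: (@normal_geometric R P 0 (r / (8 * Y)) K (1 / 2)) => //.
- by rewrite divr_gt0.
- by apply/andP; split; lra.
move=> k h; rewrite ler_pdivlMr// add0r => hh.
have Y8C : (8 * Y)%:C != 0 :> C by rewrite -cmod_gt0 cmod_real normr_gt0 gt_eqF.
have -> : h = (8 * Y)^-1%:C *: ((8 * Y)%:C *: h) by rewrite scalerA fmorphV mulVf ?scale1r.
rewrite series_term_homog cmodM cmodX cmod_real gtr0_norm ?invr_gt0//.
have := hr k ((8 * Y)%:C *: h); rewrite add0r vmodZ cmod_real gtr0_norm// mulrC => /(_ hh) h1.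
rewrite (le_trans (ler_wpM2l _ h1)) ?exprn_ge0 ?invr_ge0 ?(ltW Y8)//.
have -> : 1 / 2 = (8 * Y)^-1 * (2 * Y) * 2 by field; rewrite gt_eqF.
have E (x y z g g' : R) : x * (B * g * y * g' * z) = B * g * g' * (x * y * z) by ring.
by rewrite (exprMn k (_ * (2 * Y)) 2) (exprMn k (8 * Y)^-1 (2 * Y)) E.
Qed.

(** The sum of the series, which converges normally near each point of the open
    portion of the cone, and by hypothesis on the surface. *)
Lemma cone_extension : exists F : 'rV[C]_3 -> C,
  [/\ forall v, H v -> F v = f v, analytic_on (cone_portion H) F
    & forall v (t : C), H v -> 0 <= t < 1 ->
      (fun n => \sum_(0 <= k < n) t ^+ k * peval (P k) v) @ \oo --> F (t *: v)].
Proof.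
have cone_normal u : cone_portion H u -> normal_at P u.
  move=> [v Hv [t /andP[t0 t1] ->]].
  have /complex_realP[s hs] : t \is Num.real by exact: ger0_real.
  move: t0 t1; rewrite hs lecR -(rmorph1 (real_complex R)) ltcR => s0 s1.
  have [->|sn0] := eqVneq s 0; first by rewrite rmorph0 scale0r; exact: cone_normal_vertex Hv.
  have sp : 0 < s by rewrite lt_neqAle eq_sym sn0.
  apply: (@cone_normal_radial _ (s ^+ 2)).
  - by apply: real_vecZ; exact: Hv.1.
  - by rewrite scaleQ Hv.2 mulr1 rmorphXn.
  - by rewrite exprn_gt0// exprn_ilt1.
exists (psum P); split.
- by move=> v Hv; apply: psumE; exact: represents_csum hf closed_real_form_quadric Hv.
- exact: normal_analytic.
move=> v t Hv t1.
have [r [Mk r0 [B hN]]] : normal_at P (t *: v) by apply: cone_normal; exists v => //; exists t.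
have := normal_on_csum hN (h := 0); rewrite vmod0 addr0 => /(_ (ltW r0)) h.
apply/cvgC_P => e /h[n0 h1]; exists n0 => n /h1.
by under eq_bigr do rewrite series_term_homog.
Qed.

End Extension.
End RealForm.

(** * Polynomial approximation on totally real sets *)

Section Weierstrass.
Variable R : realType.
Local Notation C := (complexes R).
Implicit Types (F G : 'rV[C]_3 -> C) (u v w : 'rV[C]_3) (e r : R) (k n N : nat) (g h : 'rV[C]_3 -> R).

(** Polynomials in s that increase to the square root of s on [0, 1]: with s =
    x^2 they approximate |x|. *)
Definition sqrt_iter (s : R) n : R := iter n (fun y => y + (s - y ^+ 2) / 2) 0.

(** With y <= x, the error x - y is multiplied at each step by 1 - (x + y) / 2,
    hence at most by 1 - x / 2, and (1 - x / 2) (1 + (n + 1) x / 2) is at most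
    1 + n x / 2. *)
Lemma sqrt_iter_step (n x y : R) : 0 <= n -> 0 <= x <= 1 -> 0 <= y <= x -> (x - y) * (1 + n * x / 2) <= x ->
  0 <= y + (x ^+ 2 - y ^+ 2) / 2 <= x /\
  (x - (y + (x ^+ 2 - y ^+ 2) / 2)) * (1 + (n + 1) * x / 2) <= x.
Proof.
move=> n0 /andP[x0 x1] /andP[y0 yx] h.
have E : x - (y + (x ^+ 2 - y ^+ 2) / 2) = (x - y) * (1 - (x + y) / 2) by field.
have d0 : 0 <= x - y by rewrite subr_ge0.
have f0 : 0 <= 1 - (x + y) / 2 by lra.
split.
  apply/andP; split; last by rewrite -subr_ge0 E mulr_ge0.
  by rewrite addr_ge0// divr_ge0// subr_ge0; apply: lerXn2r; rewrite ?nnegrE.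
rewrite E -mulrA; apply: le_trans h; apply: ler_wpM2l => //.
have nx : 0 <= n * x by rewrite mulr_ge0.
have := mulr_ge0 f0 (addr_ge0 x0 nx).
have := mulr_ge0 y0 nx; have := mulr_ge0 x0 nx; have := mulr_ge0 x0 y0; have := mulr_ge0 x0 x0.
nra.
Qed.

Lemma sqrt_iter_bound (x : R) n : 0 <= x <= 1 ->
  0 <= sqrt_iter (x ^+ 2) n <= x /\ (x - sqrt_iter (x ^+ 2) n) * (1 + n%:R * x / 2) <= x.
Proof.
move=> hx; have /andP[x0 x1] := hx; elim: n => [|n [h1 h2]].
  by rewrite /sqrt_iter /= lexx x0 mul0r mul0r addr0 subr0 mulr1.
by have := sqrt_iter_step (ler0n R n) hx h1 h2; rewrite natr1.
Qed.

Lemma sqrt_iter_cvg (x : R) n : 0 <= x <= 1 -> `|x - sqrt_iter (x ^+ 2) n.+1| <= 2 / n.+1%:R.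
Proof.
move=> hx; have /andP[x0 x1] := hx; have [/andP[h0 h1] h2] := sqrt_iter_bound n.+1 hx.
rewrite ger0_norm ?subr_ge0//.
have [xz|xn] := eqVneq x 0.
  by rewrite xz in h0 h1 *; rewrite sub0r (@le_trans _ _ 0) ?oppr_le0// divr_ge0.
have xp : 0 < x by rewrite lt_neqAle eq_sym xn.
rewrite ler_pdivlMr// -(ler_pM2r xp).
have d0 : 0 <= x - sqrt_iter (x ^+ 2) n.+1 by rewrite subr_ge0.
move: h2 d0; move: (x - _) (n.+1%:R : R) => d m; nra.
Qed.

Section Bounded.
Variables (H : set 'rV[C]_3) (r0 : R).
Hypothesis Hr : forall v, H v -> vmod v <= r0.

Definition rapprox g := papprox H (fun v => (g v)%:C).

Lemma papprox_bounded F : papprox H F -> exists2 B : R, 0 < B & forall v, H v -> cmod (F v) <= B.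
Proof.
move=> /(_ r0 1 ltr01)[P hP].
have [B B0 hB] := bounded_on_vball r0 (@closedT _) (econt_peval (H := setT) P).
exists (1 + B) => [|v Hv]; first by rewrite addr_gt0.
rewrite -(subrK (peval P v) (F v)) (le_trans (cmodD _ _))// lerD//.
  by apply: hP => //; exact: Hr.
by apply: hB => //; exact: Hr.
Qed.

Lemma rapprox_ext g h : (forall v, H v -> g v = h v) -> rapprox g -> rapprox h.
Proof. by move=> gh; apply: papprox_ext => v Hv; rewrite gh. Qed.

Lemma rapprox_cst (s : R) : rapprox (fun=> s).
Proof.
apply: papprox_ext (papprox_peval H (mpolyC 3 s%:C)) => v _.
by rewrite /peval mevalC.
Qed.

Lemma rapproxD g h : rapprox g -> rapprox h -> rapprox (fun v => g v + h v).
Proof.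
move=> hg hh; apply: papprox_ext (papproxD hg hh) => v _.
by rewrite -rmorphD.
Qed.

Lemma rapproxM g h : rapprox g -> rapprox h -> rapprox (fun v => g v * h v).
Proof.
move=> hg hh; have [B B0 hB] := papprox_bounded hh.
apply: papprox_limit => r e e0.
have [P hP] := hg r0 (e / B) ltac:(by rewrite divr_gt0).
exists (fun v => peval P v * (h v)%:C); first exact: papprox_pmul.
move=> v Hv _; rewrite rmorphM -mulrBl cmodM.
rewrite (le_trans (ler_pM (cmod_ge0 _) (cmod_ge0 _) (hP v Hv (Hr Hv)) (hB v Hv)))//.
by rewrite divfK// gt_eqF.
Qed.

Lemma rapproxZ (s : R) g : rapprox g -> rapprox (fun v => s * g v).
Proof. by move=> hg; apply: rapproxM => //; exact: rapprox_cst. Qed.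

(** Rescale g into [-1, 1] and use the polynomial approximation of |x| by
    functions of x^2. *)
Lemma rapprox_abs g : rapprox g -> rapprox (fun v => `|g v|).
Proof.
move=> hg; have [B B0 hB] := papprox_bounded hg.
pose t v := B^-1 * g v.
have ht : rapprox t by exact: rapproxZ.
have hi n : rapprox (fun v => sqrt_iter (t v ^+ 2) n).
  elim: n => [|n IH]; first exact: rapprox_cst.
  have := rapproxD IH (rapproxZ 2^-1 (rapproxD (rapproxM ht ht) (rapproxZ (-1) (rapproxM IH IH)))).
  by apply: rapprox_ext => v _; rewrite /sqrt_iter iterS -/(sqrt_iter _ n); ring.
apply: (@rapprox_ext (fun v => B * `|t v|)).
  by move=> v _; rewrite /t normrM gtr0_norm ?invr_gt0// mulVKf// gt_eqF.
apply: rapproxZ; apply: papprox_limit => r e e0.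
have [n hn] : exists n, 2 / n.+1%:R < e.
  have h0 : 0 <= 2 / e by rewrite divr_ge0 ?ltW.
  exists (Num.bound (2 / e)); rewrite ltr_pdivrMr // mulrC -ltr_pdivrMr //.
  by rewrite (lt_trans (archi_boundP h0)) // ltr_nat.
exists (fun v => (sqrt_iter (t v ^+ 2) n.+1)%:C); first exact: hi.
move=> v Hv _.
rewrite -rmorphB cmod_real (le_trans _ (ltW hn))//.
rewrite -(real_normK (num_real (t v))); apply: sqrt_iter_cvg.
rewrite normr_ge0 /t normrM gtr0_norm ?invr_gt0// ler_pdivrMl// mulr1.
by have := hB v Hv; rewrite cmod_real.
Qed.

Lemma rapprox_min g h : rapprox g -> rapprox h -> rapprox (fun v => Num.min (g v) (h v)).
Proof.
move=> hg hh.
have := rapproxZ 2^-1 (rapproxD (rapproxD hg hh)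
  (rapproxZ (-1) (rapprox_abs (rapproxD hg (rapproxZ (-1) hh))))).
apply: rapprox_ext => v _; case: (leP (g v) (h v)) => gh.
  by rewrite ler0_norm; lra.
by rewrite ger0_norm; lra.
Qed.

Lemma rapprox_minimum (T : eqType) (s : seq T) (h : T -> 'rV[C]_3 -> R) : s != [::] ->
  (forall q, q \in s -> rapprox (h q)) -> exists2 g, rapprox g &
  forall v, (forall q, q \in s -> g v <= h q v) /\ (exists2 q, q \in s & g v = h q v).
Proof.
elim: s => // a s IH _ hs; have [->|s0] := eqVneq s [::].
  exists (h a); first by apply: hs; rewrite mem_head.
  by move=> v; split=> [q|]; [rewrite inE => /eqP ->|exists a; rewrite ?mem_head].
have [|g hg gv] := IH s0 _; first by move=> q qs; apply: hs; rewrite inE qs orbT.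
exists (fun v => Num.min (h a v) (g v)).
  by apply: rapprox_min => //; apply: hs; rewrite mem_head.
move=> v; have [g1 [q qs g2]] := gv v; split.
  by move=> b; rewrite inE ge_min => /predU1P[->|bs]; rewrite ?lexx// (g1 b bs) orbT.
case: (leP (h a v) (g v)) => _; first by exists a; rewrite ?mem_head.
by exists q; rewrite ?inE ?qs ?orbT.
Qed.

End Bounded.

(** Compactness of K, for the covering by balls of radius d. *)
Lemma finite_net (K : set 'rV[C]_3) d : compact K -> 0 < d ->
  exists s : seq 'rV[C]_3, (forall q, q \in s -> K q) /\
    forall v, K v -> exists2 q, q \in s & vmod (v - q) < d.
Proof.
rewrite compact_cover => cK d0.
have [|v Kv|D' D1 D2] := cK 'rV[C]_3 K (fun q => [set v | vmod (v - q) < d]).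
- by move=> q _; exact: open_vball.
- by exists v => //=; rewrite subrr vmod0.
exists (finmap.enum_fset D'); split.
  by move=> q qD; have := D1 q qD; rewrite inE.
by move=> v /D2[q qD hq]; exists q.
Qed.

Section Density.
Variables (A : 'M[C]_3) (H : set 'rV[C]_3).
Hypothesis uA : A \in unitmx.
Hypothesis cH : closed H.
Hypothesis realH : forall v, H v -> real_vec A v.

Definition rcoord v (i : 'I_3) : R := complex.Re ((v *m A) 0 i).
(** The l^1 distance in the real coordinates: unlike the norm of C^3 it is
    built from absolute values of functions that are polynomial on H. *)
Definition rdist v q : R := \sum_i `|rcoord v i - rcoord q i|.

Lemma rdist_ge0 v q : 0 <= rdist v q.
Proof. by rewrite sumr_ge0. Qed.

Lemma rcoordE v i : H v -> (rcoord v i)%:C = (v *m A) 0 i.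
Proof. by move=> /realH/(_ i)/complex_realP[s hs]; rewrite /rcoord hs. Qed.

Lemma rcoordB v q i : H v -> H q -> `|rcoord v i - rcoord q i| = cmod (((v - q) *m A) 0 i).
Proof.
move=> Hv Hq; have -> : ((v - q) *m A) 0 i = (v *m A) 0 i - (q *m A) 0 i by rewrite mulmxBl !mxE.
by rewrite -!rcoordE// -rmorphB cmod_real.
Qed.

Lemma rdist_equiv : exists2 K : R, 0 < K & forall v q, H v -> H q ->
  vmod (v - q) <= K * rdist v q /\ rdist v q <= K * vmod (v - q).
Proof.
have [K1 K10 h1] := mulmx_bounded A; have [K2 K20 h2] := mulmx_bounded (invmx A).
exists (3 * K1 + K2); first by rewrite addr_gt0// mulr_gt0.
move=> v q Hv Hq; have D0 := rdist_ge0 v q; have V0 := vmod_ge0 (v - q); split.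
  rewrite -{1}[v - q](mulmxK uA) (le_trans (h2 _))// mulrDl ler_wpDl ?mulr_ge0 ?(ltW K10)//.
  rewrite ler_pM2l//; apply/le_vmodP => [//|i].
  by rewrite -rcoordB// /rdist (bigD1 i)//= lerDl sumr_ge0.
rewrite mulrDl ler_wpDr ?mulr_ge0 ?(ltW K20)// -mulrA.
have -> : 3 * (K1 * vmod (v - q)) = \sum_(i < 3) K1 * vmod (v - q).
  by rewrite sumr_const card_ord mulr_natl.
by apply: ler_sum => i _; rewrite rcoordB// (le_trans (cmod_le_vmod _ _)).
Qed.

(** On the bounded part K of H, uniform continuity gives g u - g v <= e/4 + L
    rdist u v for all u, v and some L. So the minimum, over the q in a fine
    finite net, of the cones v -> g q + L rdist v q is uniformly close to g,
    and it is obtained from polynomials by absolute values and minima. *)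
Lemma weierstrass_real r (g : 'rV[C]_3 -> R) e : econt_on H (fun v => (g v)%:C) -> 0 < e ->
  exists P : mpoly 3 C, forall v, H v -> vmod v <= r -> cmod ((g v)%:C - peval P v) <= e.
Proof.
move=> cg e0.
pose K := H `&` [set v | vmod v <= r].
have Kr v : K v -> vmod v <= r by case.
have e4 : 0 < e / 4 by rewrite divr_gt0.
have [d d0 hd] := heine_cantor r cH cg e4.
have [B B0 hB] := bounded_on_vball r cH cg.
have [M M0 hM] := rdist_equiv.
(* At distance at least d, the oscillation 2 B of g is absorbed by the slope
   L. *)
pose L := 2 * B * M / d.
have L0 : 0 < L by rewrite divr_gt0// !mulr_gt0.
have lip u v : K u -> K v -> g u - g v <= e / 4 + L * rdist u v.
  move=> [Hu ur] [Hv vr]; have D0 := rdist_ge0 u v.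
  have [uv|uv] := ltP (vmod (u - v)) d.
    have := hd u v Hu Hv ur vr uv; rewrite -rmorphB cmod_real => h.
    by rewrite (le_trans (ler_norm _))// ler_wpDr// mulr_ge0// ltW.
  have [h1 _] := hM u v Hu Hv.
  have := hB u Hu ur; have := hB v Hv vr; rewrite !cmod_real !ler_norml => /andP[b1 b2] /andP[b3 b4].
  have h2 : 2 * B <= L * rdist u v.
    rewrite /L mulrAC ler_pdivlMr// -(mulrA (2 * B) M) ler_pM2l ?mulr_gt0//.
    exact: le_trans uv h1.
  lra.
clearbody L.
have eL : 0 < e / (4 * L * M) by rewrite divr_gt0// mulr_gt0// mulr_gt0.
have [s [sK sd]] := finite_net (compact_closed_vball (r := r) cH) eL.
have [s0|s0] := eqVneq s [::].
  by exists 0 => v Hv vr; have [|q] := sd v; rewrite ?s0.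
have cone q : q \in s -> rapprox K (fun v => g q + L * rdist v q).
  move=> qs; have [Hq qr] := sK q qs.
  apply: rapproxD; first exact: rapprox_cst.
  apply: (rapproxZ Kr).
  have ci i : rapprox K (fun v => `|rcoord v i - rcoord q i|).
    apply: (rapprox_abs Kr); apply: rapproxD; last exact: rapprox_cst.
    apply: papprox_ext (papprox_peval K (lform (A ^~ i))) => v [Hv _].
    by rewrite rcoordE// peval_lform mxE; apply: eq_bigr => j _; rewrite mulrC.
  have := rapproxD (ci ord0) (rapproxD (ci (lift ord0 ord0)) (ci (lift ord0 (lift ord0 ord0)))).
  by apply: rapprox_ext => v _; rewrite /rdist !big_ord_recl big_ord0 addr0.
have [F hF FE] := rapprox_minimum Kr s0 cone.
have [P hP] := hF r (e / 4) e4.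
exists P => v Hv vr; have Kv : K v by [].
have [F1 [q qs F2]] := FE v.
have Fl : g v - F v <= e / 4.
  by rewrite F2; have := lip v q Kv (sK q qs); lra.
have Fu : F v - g v <= 3 * (e / 4).
  have [q' q's vq'] := sd v Kv; have [Hq' _] := sK q' q's.
  have [_ h1] := hM v q' Hv Hq'; have [_ h3] := hM q' v Hq' Hv.
  have h2 := F1 q' q's; have h4 := lip q' v (sK q' q's) Kv.
  have vq : vmod (q' - v) = vmod (v - q') by rewrite -vmodN opprB.
  have lM : L * M * vmod (v - q') <= e / 4.
    have := ltW vq'; rewrite ler_pdivlMr; last by rewrite mulr_gt0// mulr_gt0.
    by rewrite ler_pdivlMr// => /(le_trans _); apply; rewrite le_eqVlt; apply/predU1l; ring.
  have lm1 : L * rdist v q' <= e / 4.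
    by rewrite (le_trans _ lM)// -mulrA ler_pM2l.
  have lm2 : L * rdist q' v <= e / 4.
    by rewrite (le_trans _ lM)// -mulrA ler_pM2l// -vq.
  lra.
have := hP v Kv vr.
have -> : (g v)%:C - peval P v = (g v - F v)%:C + ((F v)%:C - peval P v).
  by rewrite rmorphB addrA subrK.
move=> hPv; rewrite (le_trans (cmodD _ _))// cmod_real.
have : `|g v - F v| <= 3 * (e / 4) by rewrite ler_norml; apply/andP; split; lra.
lra.
Qed.

Lemma weierstrass f : econt_on H f -> papprox H f.
Proof.
move=> cf r e e0.
have cre : econt_on H (fun v => (complex.Re (f v))%:C).
  move=> p Hp e' /(cf p Hp)[d d0 hd]; exists d => // v Hv vp.
  rewrite -rmorphB cmod_real (le_trans _ (hd v Hv vp))//.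
  by case: (f v) (f p) => [a b] [a' b']; exact: (Re_le_cmod (Complex (a - a') (b - b'))).
have cim : econt_on H (fun v => (complex.Im (f v))%:C).
  move=> p Hp e' /(cf p Hp)[d d0 hd]; exists d => // v Hv vp.
  rewrite -rmorphB cmod_real (le_trans _ (hd v Hv vp))//.
  by case: (f v) (f p) => [a b] [a' b']; exact: (Im_le_cmod (Complex (a - a') (b - b'))).
have h1 : papprox H (fun v => (complex.Re (f v))%:C) by move=> r' e' /(weierstrass_real r' cre).
have h2 : papprox H (fun v => (complex.Im (f v))%:C) by move=> r' e' /(weierstrass_real r' cim).
have := papproxD h1 (papprox_pmul (mpolyC 3 (Complex 0 1 : C)) h2).
move=> /papprox_ext h; apply: h => // v _; rewrite /peval mevalC.
case: (f v) => a b; apply/eqP; rewrite eq_complex /=.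
by rewrite !mul0r !mul1r subr0 !addr0 !add0r !eqxx.
Qed.

End Density.
End Weierstrass.

(** * Density, symmetries and multipole representations *)

(** Any sequence of degrees can be brought to at most k + 1 at rank k by
    repeating its terms: move on to the next term only when its degree is
    allowed. *)
Lemma slow_down (s : nat -> nat) : (s 0 <= 1)%N -> exists J : nat -> nat,
  (forall k, (s (J k) <= k.+1)%N) /\ forall j, exists k0, forall k, (k0 <= k)%N -> (j <= J k)%N.
Proof.
move=> s0; pose J := fix J k := if k is k'.+1 then
  if (s (J k').+1 <= k.+1)%N then (J k').+1 else J k' else 0%N.
have sJ k : (s (J k) <= k.+1)%N.
  by elim: k => [//|k IH] /=; case: ifP => // _; exact: leqW.
have monoJ : {homo J : k l / (k <= l)%N}.
  by apply: homo_leq => //; [exact: leq_trans|move=> k /=; case: ifP].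
exists J; split=> // j; suff [k hk] : exists k, (j <= J k)%N.
  by exists k => l kl; rewrite (leq_trans hk)// monoJ.
elim: j => [|j [k hk]]; first by exists 0%N.
have [jJ|Jj] := ltnP j (J (k + s j.+1)%N); first by exists (k + s j.+1)%N.
have E : J (k + s j.+1)%N = j.
  by apply/eqP; rewrite eqn_leq Jj (leq_trans hk)// monoJ// leq_addr.
exists (k + s j.+1).+1 => /=; rewrite E ifT//.
by rewrite (leq_trans (leq_addl k _))// (leq_trans (leqnSn _)).
Qed.

Section Approximation.
Variable R : realType.
Local Notation C := (complexes R).
Implicit Types (u v w : 'rV[C]_3) (e r : R) (k n N : nat) (H : set 'rV[C]_3).
Implicit Types (f : 'rV[C]_3 -> C).

Lemma papprox_cvg H f : closed H -> papprox H f ->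
  exists P : nat -> mpoly 3 C, cvg_on_compacts H (fun n => peval (P n)) f.
Proof.
move=> cH hf.
have /choice[P hP] : forall n, exists P : mpoly 3 C, forall v, H v -> vmod v <= n%:R ->
    cmod (f v - peval P v) <= n.+1%:R^-1.
  by move=> n; apply: hf; rewrite invr_gt0.
exists P; apply/(cvg_on_compactsP _ _ cH) => r e e0.
exists (Num.bound `|r| + Num.bound e^-1)%N => n nn v Hv vr.
have nr : r <= n%:R.
  rewrite (le_trans (ler_norm r))// (le_trans (ltW (archi_boundP (normr_ge0 r))))// ler_nat.
  exact: leq_trans (leq_addr _ _) nn.
rewrite cmodBC (le_trans (hP n v Hv (le_trans vr nr)))// -(invrK e) lef_pV2 ?posrE ?invr_gt0//.
have e1 : 0 <= e^-1 by rewrite invr_ge0 ltW.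
rewrite (le_trans (ltW (archi_boundP e1)))// ler_nat.
exact: leq_trans (leq_trans (leq_addl _ _) nn) (leqnSn n).
Qed.

Lemma cvg_within_continuous H (fs : nat -> 'rV[C]_3 -> C) f : closed H ->
  (forall n, econt_on H (fs n)) -> cvg_on_compacts H fs f -> {within H, continuous f}.
Proof.
move=> cH cfs /(cvg_on_compactsP _ _ cH) hf; apply/within_continuousP => p Hp e e0.
have e3 : 0 < e / 3 by rewrite divr_gt0.
have [n hn] := hf (vmod p + 1) _ e3.
have [d d0 hd] := cfs n p Hp _ e3.
exists (Num.min d 1) => [|v Hv]; first by rewrite lt_min d0 ltr01.
rewrite lt_min => /andP[h1 h2].
have E : f v - f p = (fs n v - fs n p) - (fs n v - f v) + (fs n p - f p) by ring.
have vr : vmod v <= vmod p + 1.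
  by rewrite -(subrK p v) addrC (le_trans (vmodD _ _))// lerD2l ltW.
rewrite E (le_trans (cmodD _ _))//.
have := le_trans (cmodB _ _) (lerD (hd v Hv h1) (hn n (leqnn n) v Hv vr)).
have := hn n (leqnn n) p Hp ltac:(by rewrite lerDl).
set a := cmod _; set b := cmod _; lra.
Qed.

Lemma series_partial_sum c (L : forall k : nat, 'I_k -> linear_form C) n :
  (fun v => \sum_(0 <= k < n) peval (series_term c L k) v) =
  peval (\sum_(0 <= k < n) series_term c L k).
Proof. by apply: funext => v; rewrite /peval raddf_sum. Qed.

Lemma represents_continuous H c L f : closed H -> represents H c L f -> {within H, continuous f}.
Proof.
move=> cH; apply: cvg_within_continuous => // n.
by rewrite series_partial_sum; exact: econt_peval.
Qed.

(** The scalar is absorbed by the constant term and by the first factor of each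
    product. *)
Lemma scale_series (a c : C) (L : forall k : nat, 'I_k -> linear_form C) :
  exists c' (L' : forall k : nat, 'I_k -> linear_form C), forall k v,
    peval (series_term c' L' k) v = a * peval (series_term c L k) v.
Proof.
exists (a * c), (fun k (j : 'I_k) => if (j : nat) == 0%N then a *: L k j else L k j) => -[|k] v.
  by rewrite /peval /= !mevalC.
rewrite /peval /series_term !big_ord_recl !mevalM mulrA /=; congr (_ * _).
by rewrite linearZ.
Qed.

(** Linear forms composed with a linear map are linear forms. *)
Lemma substitute_series (g : 'M[C]_3) (c : C) (L : forall k : nat, 'I_k -> linear_form C) :
  exists L' : forall k : nat, 'I_k -> linear_form C, forall k v,
    peval (series_term c L' k) v = peval (series_term c L k) (v *m g).
Proof.
have hL (l : linear_form C) : exists l' : linear_form C, forall v,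
    peval (mpoly_of_dhomog l') v = peval (mpoly_of_dhomog l) (v *m g).
  have [d hd] := linear_form_covector l.
  by exists (pullback_linear_form g d) => v; rewrite hd peval_pullback_linear_form.
pose L' k (j : 'I_k) := projT1 (cid (hL (L k j))).
exists L' => -[|k] v; first by rewrite /peval /= !mevalC.
rewrite /peval /series_term !rmorph_prod; apply: eq_bigr => j _.
exact: (projT2 (cid (hL (L k.+1 j)))).
Qed.

Section Quadric.
Variables (Q : mpoly 3 C) (M : 'M[C]_3).
Hypothesis hQM : normal_form Q M.
Local Notation S := (quadric Q).

(** The case of the quadric z^2 - x y = 1, transported by a linear change of
    coordinates. *)
Lemma papprox_holomorphic f : holomorphic_on S f -> papprox S f.
Proof.
move=> /holomorphic_vdiff hf; have [uM hQ] := hQM.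
have S0S v : S0 v -> S (v *m invmx M).
  by rewrite /quadric /= hQ mulmxKV.
have SS0 v : S v -> S0 (v *m M) by rewrite /quadric /S0 /= hQ.
have hg : papprox (@S0 R) (fun v => f (v *m invmx M)).
  by apply: S0_papprox => p /S0S Sp; apply: (vdiff_mulmx S0S); exact: hf.
move=> r e e0; have [K K0 hK] := mulmx_bounded M.
have [P hP] := hg (K * r) e e0.
exists (comp_mpoly [tuple lform (M ^~ i) | i < 3] P) => v Sv vr.
have -> : peval (comp_mpoly [tuple lform (M ^~ i) | i < 3] P) v = peval P (v *m M).
  rewrite /peval comp_mpoly_meval; apply: meval_eq => i.
  rewrite tnth_mktuple -/(peval _ v) peval_lform mxE.
  by apply: eq_bigr => j _; rewrite mulrC.
have := hP (v *m M) (SS0 v Sv); rewrite mulmxK//; apply.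
by rewrite (le_trans (hK v))// ler_pM2l.
Qed.

Section Subset.
Variable H : set 'rV[C]_3.
Hypothesis (cH : closed H) (HS : H `<=` S).

(** On the quadric a polynomial is a finite sum of products of linear forms;
    the remaining terms of the series are products of zero forms. *)
Lemma peval_series_functions P : series_functions H (peval P).
Proof.
have [c [L hL]] := quadric_multipoles hQM (leqSpred (msize P)).
set n := (msize P).-1 in hL.
pose L0 k (j : 'I_k) : linear_form C := if (k <= n)%N then L k j else 0.
exists c, L0.
apply/(cvg_on_compactsP _ _ cH) => r e e0; exists n.+1 => N nN v Hv _.
rewrite (hL v (HS Hv)) big_ltn ?(leq_trans _ nN)//.
rewrite (@big_cat_nat _ _ _ n.+1 1 N)//=.
rewrite (_ : \sum_(n.+1 <= k < N) _ = 0) ?addr0; last first.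
  rewrite big_nat big1// => -[//|k] /andP[nk _].
  rewrite /peval /series_term big_ord_recl /L0 leqNgt nk /=.
  by rewrite mul0r meval0.
have t0 : peval (series_term c L0 0) v = c by rewrite /peval mevalC.
rewrite t0.
rewrite (_ : \sum_(1 <= k < n.+1) _ = \sum_(1 <= k < n.+1)
   \prod_(j < k) peval (mpoly_of_dhomog (L k j)) v) ?subrr ?cmod0 ?ltW//.
apply: eq_big_nat => -[//|k] /andP[_]; rewrite ltnS => kn.
by rewrite /peval /series_term rmorph_prod /L0 kn.
Qed.

Lemma series_functions_dense (B : set ('rV[C]_3 -> C)) : series_functions H `<=` B ->
  (forall f, B f -> papprox H f) -> dense_subset H (series_functions H) B.
Proof.
move=> AB hB; split=> // f /hB /(papprox_cvg cH)[P hP] U /hP[n _ hn].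
exists (peval (P n)); split; first exact: peval_series_functions.
exact: (hn n (leqnn n)).
Qed.

(** Slow the approximating sequence down, so that its k-th polynomial has
    degree at most k; on the quadric it is then the polynomial of a set of
    multipoles of orders 0 to k. *)
Lemma papprox_multipoles f : papprox H f ->
  exists w : forall k (j : 'I_k.+1), multipole_bar C j,
    cvg_on_compacts H (fun k => peval (multipoles_poly (w k))) f.
Proof.
move=> /(papprox_cvg cH)[P /(cvg_on_compactsP _ _ cH) hP].
(* The zero polynomial is put in front to give the slowed down sequence a
   starting point of admissible degree. *)
pose P0 i : mpoly 3 C := if i is i'.+1 then P i' else 0.
have [|J [J1 J2]] := @slow_down (fun i => msize (P0 i)); first by rewrite /= msize0.
have hw k : exists w : forall j : 'I_k.+1, multipole_bar C j, forall v, S v ->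
    peval (multipoles_poly w) v = peval (P0 (J k)) v.
  have [c [L hL]] := quadric_multipoles hQM (J1 k).
  have [w hw] := multipoles_poly_of k c L.
  by exists w => v Sv; rewrite hw hL.
exists (fun k => projT1 (cid (hw k))).
apply/(cvg_on_compactsP _ _ cH) => r e e0.
have [n0 h0] := hP r e e0; have [k0 hk] := J2 n0.+1.
exists k0 => k /hk Jk v Hv vr.
rewrite (projT2 (cid (hw k)) v (HS Hv)).
by case: (J k) Jk => // i; rewrite ltnS => ni; exact: h0.
Qed.

End Subset.

Lemma series_scale a f : series_functions S f -> series_functions S (fun v => a * f v).
Proof.
move=> [c [L hf]]; have [c' [L' hL]] := scale_series a c L; exists c', L'.
have cS := @closed_quadric R Q.
move: hf => /(cvg_on_compactsP _ _ cS) hf; apply/(cvg_on_compactsP _ _ cS) => r e e0.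
have a1 : 0 < cmod a + 1 by rewrite ltr_wpDl ?cmod_ge0.
have [n0 h0] := hf r (e / (cmod a + 1)) ltac:(by rewrite divr_gt0).
exists n0 => n nn v Sv vr; under eq_bigr do rewrite hL.
rewrite -mulr_sumr -mulrBr cmodM.
rewrite (le_trans (ler_wpM2l (cmod_ge0 _) (h0 n nn v Sv vr)))//.
by rewrite mulrCA ler_piMr ?(ltW e0)// ler_pdivrMr// mul1r lerDl.
Qed.

Lemma series_orthogonal g f : orthogonal_group Q g -> series_functions S f ->
  series_functions S (fun v => f (v *m g)).
Proof.
move=> [_ gQ] [c [L hf]]; have [L' hL] := substitute_series g c L; exists c, L'.
have cS := @closed_quadric R Q.
move: hf => /(cvg_on_compactsP _ _ cS) hf; apply/(cvg_on_compactsP _ _ cS) => r e e0.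
have [K K0 hK] := mulmx_bounded g.
have [n0 h0] := hf (K * r) e e0.
exists n0 => n nn v Sv vr; under eq_bigr do rewrite hL.
apply: h0 => //; first by rewrite /quadric /= gQ.
by rewrite (le_trans (hK v))// ler_pM2l.
Qed.

End Quadric.

Lemma totally_real_value (Q : mpoly 3 C) A v : factors_form Q A -> real_vec A v ->
  peval Q v \is Num.real.
Proof.
move=> [_ ->] rv; rewrite -mulmxA -trmx_mul mxE rpred_sum// => i _.
by rewrite [X in _ * X]mxE; exact: rpredM (rv i) (rv i).
Qed.

Lemma real_coefficients_value (Q : mpoly 3 C) v : Q \is a mpolyOver 3 Num.real ->
  real_vec 1%:M v -> peval Q v \is Num.real.
Proof.
move=> /mpolyOverP rQ rv; rewrite /peval mevalE rpred_sum// => m _.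
rewrite rpredM// rpred_prod// => i _; apply: rpredX.
by have := rv i; rewrite mulmx1.
Qed.

Lemma real_quadricE (Q : mpoly 3 C) : real_quadric Q = real_form_quadric 1%:M Q.
Proof.
apply/seteqP; split=> v.
  by move=> [h1 h2]; split=> // i; rewrite mulmx1.
by move=> [h1 h2]; split=> // i; have := h1 i; rewrite mulmx1.
Qed.

End Approximation.

Theorem theorem19 (R : realType) (Q : mpoly 3 (complexes R)) :
  quadratic_form Q -> irreducible_mpoly Q ->
  (* (1) *)
  [/\ forall f, holomorphic_on (quadric Q) f ->
        exists P : nat -> mpoly 3 (complexes R),
          cvg_on_compacts (quadric Q) (fun n => peval (P n)) f,
      forall P : mpoly 3 (complexes R),
        exists (c : complexes R)
               (L : forall k : nat, 'I_k -> linear_form (complexes R)),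
          forall v, quadric Q v ->
            peval P v = c + \sum_(1 <= k < (msize P).-1.+1)
                              \prod_(j < k) peval (mpoly_of_dhomog (L k j)) v
    & forall f, holomorphic_on (quadric Q) f ->
        exists w : forall k (j : 'I_k.+1), multipole_bar (complexes R) j,
          cvg_on_compacts (quadric Q)
            (fun k => peval (multipoles_poly (w k))) f]
  /\
  (* (2) *)
  [/\ dense_subset (quadric Q) (series_functions (quadric Q))
        (holomorphic_functions (quadric Q)),
      forall (a : complexes R) f, series_functions (quadric Q) f ->
        series_functions (quadric Q) (fun v => a * f v),
      forall g, orthogonal_group Q g ->
        forall f, series_functions (quadric Q) f ->
          series_functions (quadric Q) (fun v => f (v *m g))
    & forall c (L : forall k : nat, 'I_k -> linear_form (complexes R)) f,
        represents (quadric Q) c L f ->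
        exists F : 'rV[complexes R]_3 -> complexes R,
          [/\ forall v, quadric Q v -> F v = f v,
              holomorphic_on (round_hull (quadric Q)) F
            & forall v (l : complexes R), quadric Q v -> `|l| < 1 ->
                (fun n => \sum_(0 <= k < n)
                            l ^+ k * peval (series_term c L k) v)
                @ \oo --> F (l *: v)]]
  /\
  (* (3) *)
  forall H : set 'rV[complexes R]_3,
    (exists2 A, factors_form Q A & H = totally_real_sphere Q A) \/
    (Q \is a mpolyOver 3 Num.real /\ H = real_quadric Q) ->
    [/\ forall f : 'rV[complexes R]_3 -> complexes R,
          {within H, continuous f} ->
          exists P : nat -> mpoly 3 (complexes R),
            cvg_on_compacts H (fun n => peval (P n)) f,
        dense_subset H (series_functions H) (continuous_functions H),
        forall c (L : forall k : nat, 'I_k -> linear_form (complexes R)) f,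
          represents H c L f ->
          exists F : 'rV[complexes R]_3 -> complexes R,
            [/\ forall v, H v -> F v = f v,
                analytic_on (cone_portion H) F
              & forall v (t : complexes R), H v -> 0 <= t < 1 ->
                  (fun n => \sum_(0 <= k < n)
                              t ^+ k * peval (series_term c L k) v)
                  @ \oo --> F (t *: v)]
      & forall f : 'rV[complexes R]_3 -> complexes R,
          {within H, continuous f} ->
          exists w : forall k (j : 'I_k.+1), multipole_bar (complexes R) j,
            cvg_on_compacts H (fun k => peval (multipoles_poly (w k))) f].
Proof.
move=> qQ iQ; have [M hQM] := irreducible_normal_form qQ iQ.
have cS := @closed_quadric R Q.
split; last split.
- split.
  + by move=> f /(papprox_holomorphic hQM)/(papprox_cvg cS).
  + by move=> P; exact: (quadric_multipoles hQM (leqSpred (msize P))).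
  + by move=> f /(papprox_holomorphic hQM)/(papprox_multipoles hQM cS (fun v => id)).
- split.
  + apply: (series_functions_dense hQM cS (fun v => id)); last exact: (papprox_holomorphic hQM).
    move=> f [c [L hf]]; apply: (limit_holomorphic hQM (p := fun n => \sum_(0 <= k < n) series_term c L k)).
    move: hf; rewrite /represents; congr (cvg_on_compacts _ _ _).
    by apply: funext => n; exact: series_partial_sum.
  + exact: series_scale.
  + by move=> g gQ f; exact: series_orthogonal.
  + exact: round_hull_extension hQM.
move=> H hH.
have [A [uA [realQ HE]]] : exists A, A \in unitmx /\
    (forall v, real_vec A v -> peval Q v \is Num.real) /\ H = real_form_quadric A Q.
  case: hH => [[A fA ->]|[rQ ->]].
    by exists A; split; [exact: fA.1|split=> // v; exact: totally_real_value].
  exists 1%:M; rewrite unitmx1 -real_quadricE; split=> //; split=> // v.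
  exact: real_coefficients_value.
have cH : closed H by rewrite HE; exact: closed_real_form_quadric.
have HS : H `<=` quadric Q by rewrite HE => v [].
have rH v : H v -> real_vec A v by rewrite HE => -[].
have dH f : {within H, continuous f} -> papprox H f.
  by move=> /within_continuousP h; exact: (weierstrass uA cH rH h).
split.
- by move=> f /dH/(papprox_cvg cH).
- apply: (series_functions_dense hQM cH HS) => // f [c [L]].
  exact: represents_continuous.
- move=> c L f; rewrite HE => hf.
  exact: (cone_extension uA (quadratic_scale hQM) realQ hf).
- by move=> f /dH/(papprox_multipoles hQM cH HS).
Qed.
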